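(* There is a set $\mathcal{L}$ of linear maps $L:\mathbb{R}^d\to\mathbb{R}^{k-d}$ (identified with a subset of $\mathbb{R}^{d(k-d)}$ via matrix entries) of full Lebesgue measure with the following property. Let $L\in\mathcal{L}$, let $E$ be its graph (which is totally irrational), and let $\mathcal{W}$ be a window that is a parallelotope generated by vectors in $F\cap\mathbb{Z}^k$. Then for any admissible $F_0$, $\Omega$, regular $s$, and any $\epsilon>0$, for all sufficiently large $r$, \[\#\xi_2(r)\le(\log r)^{(1+\epsilon)(d+1)(k-d)}.\] Furthermore, suppose $\Omega$ is the set of points of $E$ whose first $d$ coordinates lie in a hypercube in $\mathbb{R}^d$ centered at the origin, i.e. $\Omega=\{(x,L(x)):x\in Q\}$ for such a hypercube $Q$. Then for any $\epsilon>0$ and all sufficiently large $r$, \[\#\xi_1(r)\le(\log r)^{(1+\epsilon)(d+1)(k-d)}.\]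
   Context: Fix integers $1\le d<k$. For $x\in\mathbb{R}^m$, $|x|=\max_i|x_i|$. Let $L:\mathbb{R}^d\to\mathbb{R}^{k-d}$ be linear, $L(x)=Ax$ with $A=(\alpha_{ij})$, and let $E=\{(x,L(x)):x\in\mathbb{R}^d\}\subseteq\mathbb{R}^k$. We say $E$ is totally irrational if $E+\mathbb{Z}^k$ is dense in $\mathbb{R}^k$. Let $F=\{0\}\times\mathbb{R}^{k-d}$, and let $F_0$ be a subspace complementary to $E$ with $F_0\cap\mathbb{Z}^k=\{0\}$. Denote by $\pi_1:\mathbb{R}^k\to E$ the projection along $F_0$, by $\pi_2:\mathbb{R}^k\to E$ the projection along $F$, and by $\pi^*:\mathbb{R}^k\to F$ the projection along $E$. A window is a compact $\mathcal{W}\subseteq F$ equal to the closure of its interior (in $F$). The strip is $\mathcal{S}=(\pi^* )^{-1}(\mathcal{W})$. A point $s$ is regular if $(\mathbb{Z}^k+s)\cap\partial\mathcal{S}=\emptyset$. The cut and project set is $Y=\pi_1(\mathcal{S}\cap(\mathbb{Z}^k+s))$. For $y\in Y$, $\tilde y$ denotes the unique point of $\mathcal{S}\cap(\mathbb{Z}^k+s)$ with $\pi_1(\tilde y)=y$. Let $\Omega\subseteq E$ be a bounded convex set containing a neighborhood of $0$ in $E$. For $y\in Y$ and $r\ge0$, define \[P_1(y,r)=\{y'\in Y:y'-y\in r\Omega\},\qquad P_2(y,r)=\{y'\in Y:\pi_2(\tilde y'-\tilde y)\in r\Omega\}.\] For $i\in\{1,2\}$, the patches $P_i(y_1,r)$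 and $P_i(y_2,r)$ are equivalent if $P_i(y_1,r)=P_i(y_2,r)+y_1-y_2$; write $\mathcal{P}_i(y,r)$ for the equivalence class. The frequency of a class $\mathcal{P}$ is \[\xi_{\mathcal{P}}=\lim_{R\to\infty}\frac{\#\{y'\in Y:|y'|\le R,\ \mathcal{P}_i(y',r)=\mathcal{P}\}}{\#\{y'\in Y:|y'|\le R\}}.\] $\xi_i(r)$ is the set of distinct frequencies of the type $i$ patch classes of size $r$. These notions are defined under the standing assumption that $E$ is totally irrational, and $\xi_i(r)$ is independent of the regular point $s$. A window is a parallelotope generated by vectors in $F\cap\mathbb{Z}^k$ if $\mathcal{W}=\{\sum_jt_jw_j:0\le t_j\le1\}$ for linearly independent $w_1,\dots,w_{k-d}\in F\cap\mathbb{Z}^k$. *)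

(* Defs.v *)
From HB Require Import structures.
From mathcomp Require Import all_boot all_order all_algebra.
From mathcomp Require Import finmap.
From mathcomp Require Import boolp classical_sets cardinality reals exp.
Set Implicit Arguments. Unset Strict Implicit. Unset Printing Implicit Defensive.
Import Order.TTheory GRing.Theory Num.Theory.
Local Open Scope ring_scope.
Local Open Scope classical_set_scope.

Section CutProject.
Context {R : realType}.

Definition vnorm {m : nat} (v : 'rV[R]_m) : R := \big[Num.max/0]_(i < m) `|v 0 i|.

Definition intvec {m : nat} (v : 'rV[R]_m) : Prop := forall i, exists z : int, v 0 i = z%:~R.

Definition lebesgue_null {m n : nat} (N : set 'M[R]_(m, n)) : Prop :=
  forall eps : R, 0 < eps -> exists a b : nat -> 'M[R]_(m, n),
    (forall j i l, a j i l <= b j i l) /\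
    (forall M, N M -> exists j, forall i l, a j i l <= M i l <= b j i l) /\
    (forall J : nat, \sum_(j < J) \prod_(i < m) \prod_(l < n) (b j i l - a j i l) <= eps).

Definition full_measure {m n : nat} (S : set 'M[R]_(m, n)) : Prop :=
  lebesgue_null (~` S).

Context {d k : nat}.
Local Notation n := (k - d)%N.
Local Notation V := 'rV[R]_(d + n).

Definition graphE (A : 'M[R]_(d, n)) : set V :=
  [set p | exists x : 'rV[R]_d, p = row_mx x (x *m A)].
Definition Emx (A : 'M[R]_(d, n)) : 'M[R]_(d + n) := (<< row_mx (1%:M : 'M[R]_d) A >>)%MS.
Definition Fmx : 'M[R]_(d + n) := (<< row_mx (0 : 'M[R]_(n, d)) (1%:M : 'M[R]_n) >>)%MS.

Definition totally_irrational (A : 'M[R]_(d, n)) : Prop :=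
  forall (p : V) (delta : R), 0 < delta ->
    exists e z : V, graphE A e /\ intvec z /\ vnorm (e + z - p) < delta.

Definition admissible_F0 (A : 'M[R]_(d, n)) (F0 : 'M[R]_(d + n)) : Prop :=
  (Emx A + F0 == (1%:M : 'M[R]_(d + n)))%MS /\ (Emx A :&: F0 == (0 : 'M[R]_(d + n)))%MS /\
  (forall v : V, intvec v -> (v <= F0)%MS -> v = 0).

Definition pi1 (A : 'M[R]_(d, n)) (F0 : 'M[R]_(d + n)) (p : V) : V := p *m proj_mx (Emx A) F0.
Definition pi2 (A : 'M[R]_(d, n)) (p : V) : V := p *m proj_mx (Emx A) Fmx.
Definition pistar (A : 'M[R]_(d, n)) (p : V) : V := p *m proj_mx Fmx (Emx A).

Definition int_generators (Wm : 'M[R]_n) : Prop :=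
  (forall i j, exists z : int, Wm i j = z%:~R) /\ row_free Wm.
Definition parallelotope (Wm : 'M[R]_n) : set V :=
  [set p | exists t : 'rV[R]_n, (forall j, 0 <= t 0 j <= 1) /\
     p = row_mx (0 : 'rV[R]_d) (t *m Wm)].

Definition strip (A : 'M[R]_(d, n)) (W : set V) : set V := [set p | W (pistar A p)].

Definition boundary (S : set V) : set V :=
  [set p | forall delta : R, 0 < delta ->
     (exists q, vnorm (q - p) < delta /\ S q) /\ (exists q, vnorm (q - p) < delta /\ ~ S q)].

Definition regular (A : 'M[R]_(d, n)) (W : set V) (s : V) : Prop :=
  forall p : V, intvec (p - s) -> ~ boundary (strip A W) p.

Definition admissible_Omega (A : 'M[R]_(d, n)) (Om : set V) : Prop :=
  Om `<=` graphE A /\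
  (exists C : R, forall w, Om w -> vnorm w <= C) /\
  (forall w1 w2 (t : R), Om w1 -> Om w2 -> 0 <= t <= 1 -> Om ((1 - t) *: w1 + t *: w2)) /\
  (exists delta : R, 0 < delta /\ forall e, graphE A e -> vnorm e < delta -> Om e).

Definition scaled (r : R) (Om : set V) : set V := [set v | exists w, Om w /\ v = r *: w].

Definition lift (A : 'M[R]_(d, n)) (F0 : 'M[R]_(d + n)) (W : set V) (s : V) (y p : V) : Prop :=
  intvec (p - s) /\ strip A W p /\ pi1 A F0 p = y.

Definition cps (A : 'M[R]_(d, n)) (F0 : 'M[R]_(d + n)) (W : set V) (s : V) : set V :=
  [set y | exists p, lift A F0 W s y p].

Definition patch1 A F0 W s (Om : set V) (y : V) (r : R) : set V :=
  [set y' | cps A F0 W s y' /\ scaled r Om (y' - y)].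

(* since lifts are unique, this is P_2(y,r) with the lifts ~y, ~y' *)
Definition patch2 A F0 W s (Om : set V) (y : V) (r : R) : set V :=
  [set y' | cps A F0 W s y' /\ exists p p', lift A F0 W s y p /\ lift A F0 W s y' p' /\
     scaled r Om (pi2 A (p' - p))].

Definition patch_equiv (P : V -> R -> set V) (r : R) (y1 y2 : V) : Prop :=
  P y1 r = [set z + (y1 - y2) | z in P y2 r].

Definition count (X : set V) : nat := #|` fset_set X |.

Definition is_frequency (Y : set V) (P : V -> R -> set V) (r : R) (y0 : V) (f : R) : Prop :=
  forall eps : R, 0 < eps -> exists M : R, forall Rad : R, M <= Rad ->
    `| (count [set y | Y y /\ vnorm y <= Rad /\ patch_equiv P r y y0])%:R
         / (count [set y | Y y /\ vnorm y <= Rad])%:R - f | < eps.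

Definition xi (Y : set V) (P : V -> R -> set V) (r : R) : set R :=
  [set f | exists y0, Y y0 /\ is_frequency Y P r y0 f].

End CutProject.

(* #X <= x (X possibly infinite): every finite list of distinct elements of X has length <= x *)
Definition card_atmost {R : realType} (X : set R) (x : R) : Prop :=
  forall l : seq R, uniq l -> (forall f, f \in l -> X f) -> (size l)%:R <= x.

(* Main.v *)
(* Write [tau p] for the coordinates of the projection of [p] to [F] in the basis of edges of the
   window.  The edges are integral, so lattice vectors act on the window coordinate by coordinate
   modulo 1, and the acceptance domain of a patch class of size [r] is a union of boxes cut out by
   the hyperplanes [tau_j = x], where [x] runs over the values [- tau_j z] of the lattice vectors
   [z] taking part in patches of size [r].

   For almost every [A], a second moment computation over prime fields and the Borel-Cantelli lemma
   show that in every integral direction the values of the vectors of size [2^h] are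
   [2^(- h d) psi h]-dense, with [psi h = h^(1 + o(1))].  At scale [r ~ 2^h] the gaps between
   consecutive cuts therefore have length at most [G ~ r^(-d) psi h], and since there are only
   [O(r^d)] vectors of size [r], averaging shows that the values in [(0, 2 G]] number [O(psi h)].
   For patches of type 1 it is uncertain whether the vectors near the faces of the cube take part;
   for almost every [A] a value of a vector with one bounded entry is not that small, so every face
   contributes at most one further cut to a gap, and opposite faces contribute cuts at a fixed
   distance.  Hence the acceptance domain is determined, up to translation, by one of
   [O((psi h)^(d + 1))] codes in each of the [k - d] directions and a bounded combinatorial datum.

   Two classes with the same code have acceptance domains that are translates of one another, hence
   the same frequency: the translation is approximated by lattice vectors, thin slabs around the
   walls have small density, and balls are compared along radii where the point count grows slowly.
*)
Require Import Defs.
From mathcomp Require Import all_boot all_order all_algebra.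
From mathcomp Require Import finmap.
From mathcomp Require Import boolp classical_sets cardinality reals sequences exp.
From mathcomp Require Import zify ring lra.
Import Order.TTheory GRing.Theory Num.Theory.
Set Implicit Arguments.
Unset Strict Implicit.
Unset Printing Implicit Defensive.
Local Open Scope ring_scope.

(** * Equidistribution over finite fields *)

(** Null sets are defined by covers with boxes, so every measure estimate has to come from an
    explicit countable cover. Rounding [A] to a grid of mesh [1 / p] reduces each estimate to an
    exact count over ['F_p]: a nonzero integer vector with entries below [p] stays nonzero there,
    and linear maps equidistribute exactly. A second moment only controls most targets of an orbit;
    all of them are reached by adding two vectors, at the cost of a factor 2 in size. The genericity
    conditions are imposed one direction at a time. A cell of the acceptance domain is a product of
    intervals, and in a single direction the orbit reaches the radius [r ^ (- d)], up to logarithms,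
    at which only a logarithmic number of lengths remains possible. A frequency enters only as the
    limit of a quotient of counts over balls. The comparison therefore proves an inequality between
    two given limits, by an injection of lattice points, and equality follows by exchanging the two
    classes. *)

Section FiniteField.
Variables (F : finFieldType) (d n m : nat).
Variables (b : 'M[F]_(n, m)) (c : 'M[F]_(m, n)).
Hypothesis cb1 : c *m b = 1%:M.
Local Notation Q := #|F|.

(** [v] has a right inverse and [b] a left inverse, so [g |-> v g b] is onto; its fibers are
    translates of one another and share the group equally. *)
Lemma card_fiber (v : 'rV[F]_d) (t : 'rV[F]_m) : v != 0 ->
  (#|[set g : 'M[F]_(d, n) | v *m g *m b == t]| * Q ^ m = Q ^ (d * n))%N.
Proof.
move=> v0.
have [w vw] : exists w : 'cV[F]_d, v *m w = 1%:M.
  have /rV0Pn [i vi] := v0.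
  exists (\col_j (if j == i then (v 0 i)^-1 else 0)).
  apply/matrixP => a a'; rewrite !ord1 !mxE (bigD1 i) //= mxE eqxx big1 ?addr0 ?divff //.
  by move=> j ji; rewrite mxE (negbTE ji) mulr0.
pose g0 (u : 'rV[F]_m) := w *m u *m c.
have vg0 u : v *m g0 u *m b = u.
  by rewrite /g0 !mulmxA vw mul1mx -mulmxA cb1 mulmx1.
have fib u : #|[set g : 'M[F]_(d, n) | v *m g *m b == u]| =
             #|[set g : 'M[F]_(d, n) | v *m g *m b == t]|.
  have inj : injective (fun g : 'M[F]_(d, n) => g + g0 (t - u)) by move=> x y /addIr.
  rewrite -(card_imset _ inj); apply: eq_card => g; rewrite inE; apply/imsetP/eqP.
    by case=> h; rewrite inE => /eqP hE ->; rewrite mulmxDr mulmxDl vg0 hE addrC subrK.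
  move=> hE; exists (g - g0 (t - u)); last by rewrite subrK.
  by rewrite inE mulmxBr mulmxBl vg0 hE opprB addrC subrK.
rewrite -(card_mx F d n) -[RHS]sum1_card.
rewrite (partition_big (fun g : 'M[F]_(d, n) => v *m g *m b) xpredT) //=.
rewrite (eq_bigr (fun=> #|[set g : 'M[F]_(d, n) | v *m g *m b == t]|)) => [|u _].
  by rewrite sum_nat_const card_mx mul1n mulnC.
by rewrite -(fib u) -sum1_card; apply: eq_bigl => g; rewrite inE.
Qed.

Variables (X : finType) (zv : X -> 'rV[F]_d) (Wd : {set 'rV[F]_m}).
Hypothesis zv_inj : injective zv.

Definition hits (g : 'M[F]_(d, n)) (y : 'rV[F]_m) : nat :=
  #|[set z | zv z *m g *m b - y \in Wd]|.

Local Notation N := #|X|.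
Local Notation W := #|Wd|.

Lemma card_shift (u : 'rV[F]_m) : #|[set y | u - y \in Wd]| = W.
Proof.
have inj : injective (fun y : 'rV[F]_m => u - y) by move=> x y /addrI /oppr_inj.
rewrite -(card_imset _ inj); apply: eq_card => y; apply/imsetP/idP.
  by case=> x; rewrite inE => h ->.
by move=> h; exists (u - y); rewrite ?inE opprB addrCA subrr addr0.
Qed.

Lemma hitsE g y : hits g y = (\sum_(z : X) (zv z *m g *m b - y \in Wd)%R)%N.
Proof. by rewrite /hits -sum1dep_card big_mkcond. Qed.

Lemma sum_hits : (\sum_g \sum_y hits g y = N * W * Q ^ (d * n))%N.
Proof.
rewrite (eq_bigr (fun=> N * W)%N); first by rewrite sum_nat_const card_mx mulnC.
move=> g _; under eq_bigr do rewrite hitsE.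
rewrite exchange_big /= (eq_bigr (fun=> W)) ?sum_nat_const // => z _.
by rewrite -(card_shift (zv z *m g *m b)) -sum1dep_card [RHS]big_mkcond.
Qed.

(** A substitution in [y] decouples the first condition from [g]; the second then involves [g] only
    through the nonzero vector [zv z' - zv z], which [card_fiber] handles. *)
Lemma card_pair (z z' : X) : z != z' ->
  ((\sum_g \sum_y (zv z *m g *m b - y \in Wd)%R * (zv z' *m g *m b - y \in Wd)%R) * Q ^ m
   = W * W * Q ^ (d * n))%N.
Proof.
move=> zz'.
have v0 : zv z' - zv z != 0.
  by rewrite subr_eq0; apply: contra zz' => /eqP /zv_inj ->.
have -> : (\sum_g \sum_y (zv z *m g *m b - y \in Wd)%R * (zv z' *m g *m b - y \in Wd)%R =
   \sum_(x in Wd) \sum_(x' in Wd) #|[set g : 'M[F]_(d, n) | ((zv z' - zv z) *m g *m b == x' - x)%R]|)%N.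
  have h g : (\sum_y (zv z *m g *m b - y \in Wd)%R * (zv z' *m g *m b - y \in Wd)%R =
     \sum_(x in Wd) \sum_(x' in Wd) ((zv z' - zv z) *m g *m b == x' - x)%R)%N.
    rewrite (reindex (fun y => zv z *m g *m b - y)) /=; last first.
      by exists (fun y => zv z *m g *m b - y) => y _; rewrite opprB addrC subrK.
    rewrite [RHS]big_mkcond /=; apply: eq_bigr => y _.
    set u := (zv z' - zv z) *m g *m b.
    rewrite opprB [zv z *m g *m b + _]addrC subrK.
    have -> : zv z' *m g *m b + (y - zv z *m g *m b) = y + u.
      by rewrite /u !mulmxBl addrCA.
    case: ifP => yW; last by rewrite mul0n.
    rewrite mul1n (eq_bigr (fun x' => (x' == y + u) : nat)); last first.
      by move=> x' _; rewrite [u == _]eq_sym subr_eq addrC.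
    case: (boolP (_ \in _)) => hu.
      rewrite (bigD1 (y + u)) //= eqxx big1 // => x /andP[_ /negbTE ->] //.
    rewrite big1 // => x xW; apply/eqP; rewrite eqb0; apply: contra hu => /eqP <- //.
  under eq_bigr do rewrite h.
  rewrite exchange_big /=; apply: eq_bigr => x _; rewrite exchange_big /=; apply: eq_bigr => x' _.
  by rewrite -sum1dep_card [RHS]big_mkcond.
rewrite big_distrl /= (eq_bigr (fun=> W * Q ^ (d * n)))%N ?sum_nat_const ?mulnA // => x _.
rewrite big_distrl /= (eq_bigr (fun=> Q ^ (d * n)))%N ?sum_nat_const // => x' _.
exact: card_fiber.
Qed.

Lemma sum_hits_sq :
  ((\sum_g \sum_y hits g y ^ 2) * Q ^ m = N * W * Q ^ (d * n) * Q ^ m + N * (N - 1) * W ^ 2 * Q ^ (d * n))%N.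
Proof.
have -> : (\sum_g \sum_y hits g y ^ 2 = \sum_(z : X) \sum_(z' : X)
  \sum_g \sum_y (zv z *m g *m b - y \in Wd)%R * (zv z' *m g *m b - y \in Wd)%R)%N.
  under eq_bigr do under eq_bigr do rewrite hitsE -mulnn big_distrl /=.
  under eq_bigr do rewrite exchange_big /=.
  rewrite exchange_big /=; apply: eq_bigr => z _.
  under eq_bigr do under eq_bigr do rewrite big_distrr /=.
  under eq_bigr do rewrite exchange_big /=.
  by rewrite exchange_big.
rewrite big_distrl /= (eq_bigr (fun=> W * Q ^ (d * n) * Q ^ m + (N - 1) * W ^ 2 * Q ^ (d * n))%N).
  by rewrite sum_nat_const mulnDr !mulnA.
move=> z _; rewrite (bigD1 z) //= mulnDl; congr (_ + _)%N.
  congr (_ * _)%N; rewrite (eq_bigr (fun=> W)) ?sum_nat_const ?card_mx 1?mulnC // => g _.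
  rewrite -(card_shift (zv z *m g *m b)) -sum1dep_card [RHS]big_mkcond.
  by apply: eq_bigr => y _; case: (_ \in _).
rewrite big_distrl /= (eq_bigr (fun=> W ^ 2 * Q ^ (d * n))%N) => [|z' zz'].
  by rewrite sum_nat_const cardC1 subn1 mulnA.
by rewrite card_pair 1?eq_sym // mulnn.
Qed.

(* Chebyshev: [hits] has mean [N W / Q^m] and variance at most its mean, because
   [(g, y) |-> zv z g b - y] for distinct [z] are pairwise independent. *)
Lemma card_nohits :
  (#|[set gy : 'M[F]_(d, n) * 'rV[F]_m | hits gy.1 gy.2 == 0]| * (N * W) <=
   Q ^ (d * n) * Q ^ m * Q ^ m)%N.
Proof.
set B := #|_|.
have [->|NW] := posnP (N * W)%N; first by rewrite muln0.
suff : (B * (N * W) ^ 2 <= N * W * (Q ^ (d * n) * Q ^ m * Q ^ m))%N.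
  by rewrite -mulnn mulnA mulnC leq_pmul2l.
set T := (Q ^ (d * n))%N; set q := (Q ^ m)%N.
(* The deviation from the mean is multiplied by [q] to stay in the integers, so a pair without hits
   contributes exactly [(N W) ^ 2]. *)
have low : ((B * (N * W) ^ 2)%N%:Z <=
   \sum_(g : 'M[F]_(d, n)) \sum_(y : 'rV[F]_m) (q%:Z * (hits g y)%:Z - (N * W)%N%:Z) ^+ 2).
  rewrite pair_big /= (bigID (fun gy => hits gy.1 gy.2 == 0%N)) /=.
  rewrite -[leLHS]addr0 lerD ?sumr_ge0 // => [|i _]; last exact: sqr_ge0.
  rewrite (eq_bigr (fun=> ((N * W) ^ 2)%N%:Z)) => [|gy /eqP ->].
    rewrite sumr_const -mulr_natr natz -PoszM lez_nat mulnC leq_mul2l; apply/orP; right.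
    by rewrite /B (_ : #|_| = #|[pred gy : 'M[F]_(d, n) * 'rV[F]_m | hits gy.1 gy.2 == 0%N]|) //; apply: eq_card => x; rewrite !inE.
  by rewrite mulr0 sub0r sqrrN -mulnn PoszM expr2.
have eqs : \sum_(g : 'M[F]_(d, n)) \sum_(y : 'rV[F]_m) (q%:Z * (hits g y)%:Z - (N * W)%N%:Z) ^+ 2 =
  q%:Z ^+ 2 * (\sum_(g : 'M[F]_(d, n)) \sum_(y : 'rV[F]_m) hits g y ^ 2)%N%:Z
  - q%:Z * 2 * (N * W)%N%:Z * (\sum_(g : 'M[F]_(d, n)) \sum_(y : 'rV[F]_m) hits g y)%N%:Z
  + (T * q)%N%:Z * (N * W)%N%:Z ^+ 2.
  have e1 : (\sum_(g : 'M[F]_(d, n)) \sum_(y : 'rV[F]_m) hits g y ^ 2)%N%:Z =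
     \sum_(g : 'M[F]_(d, n)) \sum_(y : 'rV[F]_m) (hits g y)%:Z ^+ 2.
    by rewrite -natz natr_sum; apply: eq_bigr => g _; rewrite natr_sum; apply: eq_bigr => y _; rewrite natrX natz.
  have e2 : (\sum_(g : 'M[F]_(d, n)) \sum_(y : 'rV[F]_m) hits g y)%N%:Z =
     \sum_(g : 'M[F]_(d, n)) \sum_(y : 'rV[F]_m) (hits g y)%:Z.
    by rewrite -natz natr_sum; apply: eq_bigr => g _; rewrite natr_sum; apply: eq_bigr => y _; rewrite natz.
  have e3 : (T * q)%N%:Z * (N * W)%N%:Z ^+ 2 =
     \sum_(g : 'M[F]_(d, n)) \sum_(y : 'rV[F]_m) (N * W)%N%:Z ^+ 2.
    by rewrite !sumr_const !card_mx mul1n -mulrnA -[RHS]mulr_natr natz mulrC [(q * T)%N]mulnC -/T -/q [(T * q)%N]mulnC.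
  rewrite e1 e2 e3 !mulr_sumr -sumrB -big_split /=; apply: eq_bigr => g _.
  rewrite !mulr_sumr -sumrB -big_split /=; apply: eq_bigr => y _; ring.
rewrite eqs in low.
have := sum_hits_sq; have := sum_hits; rewrite -/T -/q => s1 s2.
move: low s2; rewrite s1; set S := (\sum_g _)%N => low s2.
have : q%:Z ^+ 2 * S%:Z = q%:Z * (N * W * T * q + N * (N - 1) * W ^ 2 * T)%N%:Z.
  by rewrite -s2 PoszM; ring.
move=> e; rewrite e in low.
(* With [N * N] in place of [N * (N - 1)] the off-diagonal terms cancel against the squared mean,
   and only the diagonal is left. *)
have hN : (N * (N - 1) <= N * N)%N by rewrite leq_mul2l leq_subr orbT.
have hN2 : (q * (N * (N - 1) * W ^ 2 * T) <= q * (N * N * W ^ 2 * T))%N.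
  by rewrite leq_mul2l !leq_mul2r hN !orbT.
rewrite -lez_nat; apply: (le_trans low).
move: hN2; rewrite -lez_nat => hN2.
have -> : (N * W * (T * q * q))%N%:Z = q%:Z * (N * W * T * q)%N%:Z by rewrite !PoszM; ring.
rewrite PoszD mulrDr.
suff : q%:Z * (N * (N - 1) * W ^ 2 * T)%N%:Z <= q%:Z * (N * N * W ^ 2 * T)%N%:Z.
  have -> : (T * q)%N%:Z * (N * W)%N%:Z ^+ 2 = q%:Z * (N * N * W ^ 2 * T)%N%:Z.
    by rewrite -!mulnn !PoszM; ring.
  have -> : q%:Z * 2 * (N * W)%N%:Z * (N * W * T)%N%:Z = 2 * (q%:Z * (N * N * W ^ 2 * T)%N%:Z).
    by rewrite -!mulnn !PoszM; ring.
  set a := q%:Z * _%:Z; set b2 := q%:Z * _%:Z; set c2 := q%:Z * _%:Z; clearbody a b2 c2 => ?; lia.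
by rewrite -!PoszM.
Qed.

Definition half_missing (g : 'M[F]_(d, n)) : bool :=
  (Q ^ m <= 2 * #|[set y | hits g y == 0%N]|)%N.

(** Markov's inequality: each such [g] accounts for at least [Q ^ m / 2] of the pairs counted by
    [card_nohits]. *)
Lemma card_half_missing :
  (#|[set g | half_missing g]| * (N * W) <= 2 * Q ^ (d * n) * Q ^ m)%N.
Proof.
have h : (#|[set g | half_missing g]| * Q ^ m <=
   2 * #|[set gy : 'M[F]_(d, n) * 'rV[F]_m | hits gy.1 gy.2 == 0%N]|)%N.
  have -> : #|[set gy : 'M[F]_(d, n) * 'rV[F]_m | hits gy.1 gy.2 == 0%N]| =
    (\sum_g #|[set y | hits g y == 0%N]|)%N.
    rewrite -sum1dep_card big_mkcond /= -(pair_big xpredT xpredT (fun g y => if hits g y == 0%N then 1 else 0)%N) /=.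
    by apply: eq_bigr => g _; rewrite -sum1dep_card [RHS]big_mkcond.
  rewrite big_distrr /= -sum1dep_card big_distrl /= big_mkcond /=.
  by apply: leq_sum => g _; rewrite mul1n; case: ifP.
have Q0 : (0 < Q ^ m)%N by rewrite expn_gt0; apply/orP; left; apply/card_gt0P; exists 0.
rewrite -(leq_pmul2r Q0).
have := card_nohits; move: h.
move: (Q ^ m)%N (Q ^ (d * n))%N #|_| #|_| (N * W)%N => q T u v w h1 h2.
rewrite mulnAC; apply: leq_trans (leq_mul h1 (leqnn w)) _.
rewrite -!mulnA leq_mul2l /=; apply: leq_trans h2 _; by rewrite -!mulnA.
Qed.

(* Two subsets of a finite group, each with more than half of its elements, have full sumset. *)
Lemma half_missingN g : ~~ half_missing g -> forall y, exists z z' w w',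
  [/\ w \in Wd, w' \in Wd & zv z *m g *m b + zv z' *m g *m b = y + w + w'].
Proof.
rewrite /half_missing -ltnNge => h y.
set Bd := [set y | hits g y == 0%N] in h.
have inj : injective (fun x : 'rV[F]_m => y - x) by move=> x x' /addrI /oppr_inj.
have : exists x, x \in ~: (Bd :|: [set y - x | x in Bd]).
  apply/set0Pn; rewrite -card_gt0 cardsCs finset.setCK card_mx mul1n subn_gt0.
  apply: leq_ltn_trans h; rewrite mul2n -addnn.
  by apply: leq_trans (leq_of_leqif (leq_card_setU _ _)) _; rewrite (card_imset _ inj).
case=> x; rewrite finset.in_setC finset.in_setU negb_or !inE => /andP[hx hx'].
have hx2 : hits g (y - x) != 0%N.
  apply: contra hx' => hh; apply/imsetP; exists (y - x); first by rewrite inE.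
  by rewrite opprB addrC subrK.
move: hx hx2; rewrite /hits !cards_eq0 => /set0Pn[z] + /set0Pn[z']; rewrite !inE => h1 h2.
exists z, z', (zv z *m g *m b - x), (zv z' *m g *m b - (y - x)); split => //.
move: (zv z *m g *m b) (zv z' *m g *m b) => u u'.
by apply/rowP => i; rewrite !mxE; ring.
Qed.

End FiniteField.

Local Open Scope classical_set_scope.

(** * Covers by boxes *)

Lemma ler_sum_uniq_sub (R : numDomainType) (T : eqType) (F : T -> R) (s t : seq T) :
  uniq s -> uniq t -> {subset s <= t} -> (forall x, 0 <= F x) ->
  \sum_(x <- s) F x <= \sum_(x <- t) F x.
Proof.
move=> us ut st F0; rewrite [leRHS](bigID (mem s)) /=.
rewrite -[X in X <= _]addr0 lerD ?sumr_ge0 //.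
rewrite -[leRHS]big_filter; rewrite (perm_big (filter (mem s) t)) /= ?lexx //.
apply: uniq_perm => //; first exact: filter_uniq.
by move=> x; rewrite mem_filter /=; case: (boolP (x \in s)) => [xs|] //=; rewrite (st _ xs).
Qed.

Section Covers.
Context {R : realType} {m n : nat}.
Hypotheses (m0 : (0 < m)%N) (n0 : (0 < n)%N).
Local Notation M := 'M[R]_(m, n).

Definition vol (a b : M) : R := \prod_(i < m) \prod_(l < n) (b i l - a i l).

Definition in_box (a b A : M) : Prop := forall i l, a i l <= A i l <= b i l.

Definition coverable (N : set M) (e : R) : Prop := exists a b : nat -> M,
  (forall j i l, a j i l <= b j i l) /\
  (forall A, N A -> exists j, in_box (a j) (b j) A) /\
  (forall J : nat, \sum_(j < J) vol (a j) (b j) <= e).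

Lemma vol_ge0 (a b : M) : (forall i l, a i l <= b i l) -> 0 <= vol a b.
Proof. by move=> ab; apply: prodr_ge0 => i _; apply: prodr_ge0 => l _; rewrite subr_ge0. Qed.

Lemma vol0 : vol 0 0 = 0.
Proof.
rewrite /vol (bigD1 (Ordinal m0)) //= (bigD1 (Ordinal n0)) //=.
by rewrite !mxE subrr !mul0r.
Qed.

Lemma coverable_sub (N N' : set M) (e e' : R) :
  N `<=` N' -> e' <= e -> coverable N' e' -> coverable N e.
Proof.
move=> NN ee [a [b [ab [cov s]]]]; exists a, b; split=> //; split=> [A /NN /cov //|J].
exact: le_trans (s J) ee.
Qed.

Lemma coverable_set0 (e : R) : 0 <= e -> coverable set0 e.
Proof.
move=> e0; exists (fun=> 0), (fun=> 0); split => [? ? ?|]; first by rewrite mxE.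
by split => // J; rewrite big1 // => i _; exact: vol0.
Qed.

Lemma coverable_countable (I : countType) (a b : I -> M) (N : set M) (e : R) :
  (forall j i l, a j i l <= b j i l) ->
  (forall A, N A -> exists j, in_box (a j) (b j) A) ->
  (forall s : seq I, uniq s -> \sum_(j <- s) vol (a j) (b j) <= e) -> coverable N e.
Proof.
move=> ab cov sum.
pose a' (j : nat) := oapp a 0 (@pickle_inv I j); pose b' (j : nat) := oapp b 0 (@pickle_inv I j).
exists a', b'; split => [j i l|].
  by rewrite /a' /b'; case: (@pickle_inv I j) => //=; rewrite mxE.
split => [A /cov[j hj]|J].
  by exists (choice.pickle j); rewrite /a' /b' pickleK_inv.
apply: le_trans (sum (pmap (@pickle_inv I) (iota 0 J)) _); last first.
  by apply: (pmap_uniq (@pickle_invK I)); rewrite iota_uniq.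
rewrite -(big_mkord xpredT (fun j => vol (a' j) (b' j))) /index_iota subn0.
elim: (iota 0 J) => [|j s IH] /=; first by rewrite !big_nil.
rewrite big_cons {1}/a' {1}/b'; case: (@pickle_inv I j) => [i|] /=.
  by rewrite big_cons lerD2l.
by rewrite vol0 add0r.
Qed.

Lemma coverable_fin (I : finType) (a b : I -> M) (N : set M) (e : R) :
  (forall j i l, a j i l <= b j i l) ->
  (forall A, N A -> exists j, in_box (a j) (b j) A) ->
  \sum_j vol (a j) (b j) <= e -> coverable N e.
Proof.
move=> ab cov sum; apply: (@coverable_countable I a b N e ab cov) => s us.
apply: le_trans sum; apply: ler_sum_uniq_sub => [//||x _|x]; first exact: index_enum_uniq.
  exact: mem_index_enum.
by apply: vol_ge0 => i l; exact: ab.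
Qed.

Lemma coverable_bigcup (N : nat -> set M) (e_ : nat -> R) (e : R) :
  (forall i, coverable (N i) (e_ i)) -> (forall J, \sum_(i < J) e_ i <= e) ->
  coverable (\bigcup_i N i) e.
Proof.
move=> /choice[a /choice[b ab]] se.
have ab0 i j i' l : a i j i' l <= b i j i' l by have [h _] := ab i.
apply: (@coverable_countable (nat * nat)%type (fun p => a p.1 p.2) (fun p => b p.1 p.2)).
- by move=> p i l.
- by move=> A [i _ NA]; have [_ [h _]] := ab i; have [j hj] := h _ NA; exists (i, j).
move=> s us.
(* A finite list of pairs lies in a square, which is summed row by row. *)
have [B hB] : exists B, forall p, p \in s -> (p.1 < B)%N /\ (p.2 < B)%N.
  exists (\max_(p <- s) maxn p.1 p.2).+1 => p ps.
  have := @leq_bigmax_seq _ s xpredT (fun p : nat * nat => maxn p.1 p.2) p ps isT.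
  by rewrite geq_max !ltnS => /andP[].
have sB : {subset s <= [seq (i, j) | i <- iota 0 B, j <- iota 0 B]}.
  move=> [i j] /hB /= [iB jB]; apply/allpairsP; exists (i, j).
  by rewrite !mem_iota /= !add0n.
apply: (le_trans (@ler_sum_uniq_sub R _ (fun p => vol (a p.1 p.2) (b p.1 p.2)) s _ us _ sB _)).
- by apply: allpairs_uniq; rewrite ?iota_uniq // => -[x1 x2] [y1 y2] _ _ /=.
- by move=> p; apply: vol_ge0 => i l.
rewrite big_allpairs /=; apply: le_trans (se B).
rewrite -(big_mkord xpredT e_) /index_iota subn0; apply: ler_sum => i _.
have [_ [_ h]] := ab i.
by have := h B; rewrite -(big_mkord xpredT (fun j => vol (a i j) (b i j))) /index_iota subn0.
Qed.

Lemma sum_half_pow (J : nat) : \sum_(i < J) (2 ^+ i.+1)^-1 <= 1 :> R.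
Proof.
suff -> : \sum_(i < J) (2 ^+ i.+1)^-1 = 1 - (2 ^+ J)^-1 :> R.
  by rewrite lerBlDr lerDl invr_ge0 exprn_ge0.
elim: J => [|J IH]; first by rewrite big_ord0 expr0 invr1 subrr.
have : (2 : R) ^+ J != 0 by rewrite expf_neq0 // pnatr_eq0.
by rewrite big_ord_recr IH /= !exprS => ?; field.
Qed.

Lemma null_bigcup (N : nat -> set M) :
  (forall i, lebesgue_null (N i)) -> lebesgue_null (\bigcup_i N i).
Proof.
move=> Nn eps e0; apply: (@coverable_bigcup _ (fun i => eps * (2 ^+ i.+1)^-1)) => [i|J].
  by apply: Nn; rewrite mulr_gt0 ?invr_gt0 ?exprn_gt0.
by rewrite -mulr_sumr -[leRHS]mulr1 ler_pM2l ?sum_half_pow.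
Qed.

Lemma null_sub (N N' : set M) : N `<=` N' -> lebesgue_null N' -> lebesgue_null N.
Proof. by move=> NN n' eps e0; exact: (@coverable_sub N N' eps eps NN (lexx _) (n' _ e0)). Qed.

Lemma null_setU (N N' : set M) : lebesgue_null N -> lebesgue_null N' -> lebesgue_null (N `|` N').
Proof.
move=> h h'; pose N2 (i : nat) := if i is 0%N then N else N'.
have /null_sub : lebesgue_null (\bigcup_i N2 i) by apply: null_bigcup; case.
by apply=> A [NA|NA]; [exists 0%N|exists 1%N].
Qed.

Lemma null_countable (I : countType) (N : I -> set M) :
  (forall i, lebesgue_null (N i)) -> lebesgue_null [set A | exists i, N i A].
Proof.
move=> h; pose N2 (j : nat) := oapp N set0 (@pickle_inv I j).
have /null_sub : lebesgue_null (\bigcup_j N2 j); last first.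
  by apply=> A [i NA]; exists (choice.pickle i) => //; rewrite /N2 pickleK_inv.
apply: null_bigcup => j; rewrite /N2; case: (@pickle_inv I j) => [i|] /=; first exact: h.
by move=> eps e0; apply: coverable_set0; apply: ltW.
Qed.

(** Borel-Cantelli. The bounds are differences of a potential that becomes arbitrarily small, so the
    tail from [H] on telescopes to at most [Phi H]. *)
Lemma null_limsup (E : nat -> set M) (Phi : nat -> R) (h0 : nat) :
  (forall h, (h0 <= h)%N -> coverable (E h) (Phi h - Phi h.+1)) ->
  (forall h, (h0 <= h)%N -> 0 <= Phi h) ->
  (forall eps, 0 < eps -> exists2 h, (h0 <= h)%N & Phi h <= eps) ->
  lebesgue_null [set A | forall H, exists2 h, (H <= h)%N & E h A].
Proof.
move=> cE P0 Plim eps /Plim[H h0H PH].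
apply: (@coverable_sub _ (\bigcup_i E (H + i)%N) eps eps _ (lexx _)).
  by move=> A /(_ H)[h Hh EA]; exists (h - H)%N => //; rewrite subnKC.
apply: (@coverable_bigcup _ (fun i => Phi (H + i)%N - Phi (H + i).+1)) => [i|J].
  by apply: cE; rewrite (leq_trans h0H) // leq_addr.
suff -> : \sum_(i < J) (Phi (H + i)%N - Phi (H + i).+1) = Phi H - Phi (H + J)%N.
  rewrite lerBlDr (le_trans PH) // lerDl P0 // (leq_trans h0H) // leq_addr //.
elim: J => [|J IH]; first by rewrite big_ord0 addn0 subrr.
by rewrite big_ord_recr IH /= addnS; ring.
Qed.

Definition unit_cube : set M := [set A | forall i l, 0 <= A i l < 1].

(** [N] is contained in countably many integral translates of its part in the unit cube. *)
Lemma null_periodic (N : set M) :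
  (forall A (T : 'M[int]_(m, n)), N A -> N (A - map_mx intr T)) ->
  lebesgue_null (N `&` unit_cube) -> lebesgue_null N.
Proof.
move=> per nN.
pose N2 (T : 'M[int]_(m, n)) := [set A | (N `&` unit_cube) (A - map_mx intr T)].
have /null_sub : lebesgue_null [set A | exists T, N2 T A]; last first.
  apply=> A NA; exists (map_mx Num.floor A); split; first exact: per.
  move=> i l; rewrite !mxE subr_ge0 ge_floor /= ltrBlDr addrC.
  have := floorD1_gt (A i l); by rewrite intrD.
apply: null_countable => T eps e0; have [a [b [ab [cov s]]]] := nN _ e0.
exists (fun j => a j + map_mx intr T), (fun j => b j + map_mx intr T).
split => [j i l|]; first by rewrite !mxE lerD2r.
split => [A /cov[j hj]|J].
  exists j => i l; have := hj i l; by rewrite !mxE lerBrDr lerBlDr.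
apply: le_trans (s J); apply: ler_sum => j _; rewrite le_eqVlt; apply/orP; left; apply/eqP.
by apply: eq_bigr => i _; apply: eq_bigr => l _; rewrite !mxE opprD addrACA subrr addr0.
Qed.

(** Entries of [g] are read as their representatives below [p], so for prime [p] the cells cover the
    unit cube. *)
Definition cell (p : nat) (g : 'M['F_p]_(m, n)) : set M :=
  [set A | forall i l, (g i l : nat)%:R / p%:R <= A i l <= (g i l : nat).+1%:R / p%:R].

Lemma coverable_cells (p : nat) (G : {set 'M['F_p]_(m, n)}) : prime p ->
  coverable [set A | exists2 g, g \in G & cell g A] (#|G|%:R / p%:R ^+ (m * n)).
Proof.
move=> pp; have p0 : 0 < p%:R :> R by rewrite ltr0n prime_gt0.
pose a (g : 'M['F_p]_(m, n)) : M := if g \in G then \matrix_(i, l) ((g i l : nat)%:R / p%:R) else 0.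
pose b (g : 'M['F_p]_(m, n)) : M := if g \in G then \matrix_(i, l) ((g i l : nat).+1%:R / p%:R) else 0.
apply: (@coverable_fin _ a b) => [g i l|A [g gG hg]|].
- rewrite /a /b; case: ifP => _; rewrite !mxE // ler_pM2r ?invr_gt0 // ler_nat //.
- by exists g => i l; rewrite /a /b gG !mxE.
rewrite (bigID (mem G)) /= [X in _ + X]big1 ?addr0; last first.
  by move=> g /negbTE gG; rewrite /a /b gG vol0.
rewrite (eq_bigr (fun=> (p%:R ^+ (m * n))^-1)).
  by rewrite sumr_const -[X in X <= _]mulr_natl lexx.
move=> g gG; rewrite /vol (eq_bigr (fun=> (p%:R^-1) ^+ n)).
  by rewrite prodr_const card_ord -exprM mulnC exprVn.
move=> i _; rewrite (eq_bigr (fun=> p%:R^-1)) ?prodr_const ?card_ord // => l _.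
by rewrite /a /b gG !mxE -mulrBl -natrB ?leqnSn // subSnn mul1r.
Qed.

End Covers.

(** * Orbits modulo one *)

Notation imx := (map_mx (intr : int -> _)).

Lemma digit_row_inj (p Z d : nat) : prime p -> (Z <= p)%N ->
  injective (fun f : {ffun 'I_d -> 'I_Z} => \row_i (f i : nat)%:R : 'rV['F_p]_d).
Proof.
move=> pp Zp f g /rowP fg; apply/ffunP => i; apply: val_inj => /=.
move: (fg i); rewrite !mxE => /(congr1 (@nat_of_ord _)).
by rewrite !val_Fp_nat // !modn_small // (leq_trans (ltn_ord _)).
Qed.

Lemma Fp_intr_eq0 (p : nat) (t : int) : prime p -> (t%:~R == 0 :> 'F_p) = (p %| t)%Z.
Proof. by move=> pp; rewrite (dvdz_pcharf (pchar_Fp pp)). Qed.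

Lemma Fp_intr_neq0 (p : nat) (t : int) : prime p -> t != 0 -> (`|t| < p)%N ->
  t%:~R != 0 :> 'F_p.
Proof.
move=> pp t0 tp; rewrite Fp_intr_eq0 // dvdzE /=; apply/negP => /dvdn_leq.
by rewrite absz_gt0 t0 => /(_ isT); rewrite leqNgt tp.
Qed.

Section AlmostEvery.
Context {R : realType}.

Lemma mulmx3_bound (d n m : nat) (z : 'rV[R]_d) (E : 'M[R]_(d, n)) (b : 'M[R]_(n, m)) (zb eb : R) (j : 'I_m) :
  (forall i, `|z 0 i| <= zb) -> (forall i l, `|E i l| <= eb) -> 0 <= zb ->
  `|(z *m E *m b) 0 j| <= d%:R * zb * eb * \sum_l `|b l j|.
Proof.
move=> hz hE zb0; rewrite mxE mulr_sumr; apply: le_trans (ler_norm_sum _ _ _) _.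
apply: ler_sum => l _; rewrite normrM ler_wpM2r // mxE.
apply: le_trans (ler_norm_sum _ _ _) _.
apply: le_trans (_ : \sum_(i < d) zb * eb <= _).
  by apply: ler_sum => i _; rewrite normrM ler_pM.
by rewrite sumr_const card_ord -mulrA mulr_natl.
Qed.

Definition grid_index {d n} (p : nat) (A : 'M[R]_(d, n)) : 'M[int]_(d, n) :=
  \matrix_(i, l) Num.floor (p%:R * A i l).

Lemma grid_index_err {d n} (p : nat) (A : 'M[R]_(d, n)) i l : (0 < p)%N ->
  `|(A - p%:R^-1 *: imx (grid_index p A)) i l| <= p%:R^-1.
Proof.
move=> p0; rewrite !mxE; set f := Num.floor _.
have p1 : 0 < p%:R :> R by rewrite ltr0n.
have -> : A i l - p%:R^-1 * f%:~R = p%:R^-1 * (p%:R * A i l - f%:~R).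
  by rewrite mulrBr mulrA mulVf ?mul1r // gt_eqF.
have := floor_itv (p%:R * A i l); rewrite -/f intrD => /andP[h1 h2].
rewrite normrM gtr0_norm ?invr_gt0 // ger_pMr ?invr_gt0 // ger0_norm; lra.
Qed.

Lemma cell_grid_index {d n} (p : nat) (A : 'M[R]_(d, n)) : prime p -> unit_cube A ->
  @cell R d n p (imx (grid_index p A)) A.
Proof.
move=> pp UA i l; rewrite !mxE; have /andP[A0 A1] := UA i l.
have p1 : 0 < p%:R :> R by rewrite ltr0n prime_gt0.
have := floor_itv (p%:R * A i l); case: (Num.floor _) (floor_ge0 (p%:R * A i l)) => [f|f] /=; last first.
  by rewrite pmulr_rge0 // A0.
move=> _; rewrite intrD => /andP[h1 h2].
have fp : (f < p)%N by rewrite -(@ltr_nat R); apply: le_lt_trans h1 _; rewrite gtr_pMr.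
rewrite -pmulrn val_Fp_nat // modn_small // ler_pdivrMr // ler_pdivlMr // mulrC.
by rewrite h1 -natr1 ltW.
Qed.

(** Density in a torus: [v] takes up the integral part, which makes the notion invariant under
    integral translations of [A]. *)
Definition dense_orbit {d n m} (b : 'M[int]_(n, m)) (Z : nat) (G : R) (A : 'M[R]_(d, n)) : Prop :=
  forall y : 'rV[R]_m, exists2 z : 'rV[int]_d, (forall i, `|z 0 i| <= Z%:Z) &
    exists v : 'rV[int]_m, forall j, `|(imx z *m A *m imx b - imx v - y) 0 j| <= G.

Lemma dense_orbitS {d n m} (b : 'M[int]_(n, m)) (Z Z' : nat) (G G' : R) (A : 'M[R]_(d, n)) :
  (Z <= Z')%N -> G <= G' -> dense_orbit b Z G A -> dense_orbit b Z' G' A.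
Proof.
move=> ZZ GG h y; have [z hz [v hv]] := h y; exists z; last first.
  by exists v => j; apply: le_trans (hv j) GG.
by move=> i; apply: le_trans (hz i) _; rewrite lez_nat.
Qed.

Lemma dense_orbit_shift {d n m} (b : 'M[int]_(n, m)) (Z : nat) (G : R) (A : 'M[R]_(d, n)) (T : 'M[int]_(d, n)) :
  dense_orbit b Z G (A - imx T) -> dense_orbit b Z G A.
Proof.
move=> h y; have [z hz [v hv]] := h y; exists z => //; exists (v + z *m T *m b) => j.
rewrite (_ : _ - _ - y = imx z *m (A - imx T) *m imx b - imx v - y) //.
rewrite map_mxD !map_mxM mulmxBr mulmxBl.
by move: (imx z *m imx T *m imx b) (imx z *m A *m imx b) => ? ?; apply/matrixP => ? ?; rewrite !mxE; ring.
Qed.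

Lemma prime_large (x : R) : exists2 p : nat, prime p & x <= p%:R.
Proof.
have [p hp pp] := prime_above (Num.bound `|x|); exists p => //.
apply: le_trans (ler_norm x) _; apply/ltW.
by apply: lt_le_trans (archi_boundP (normr_ge0 x)) _; rewrite ler_nat ltnW.
Qed.

(* The matrices modulo a large prime [p] are a discrete model of the unit cube: those whose orbit
   misses at least half of the boxes of side about [p G / 4] are few by [card_half_missing]. *)
Lemma coverable_not_dense {d n m} (b : 'M[int]_(n, m)) (c : 'M[int]_(m, n)) (q : int) (Z : nat) (G : R) :
  (0 < d)%N -> (0 < n)%N -> (0 < Z)%N -> 0 < G -> q != 0 -> c *m b = q%:M ->
  coverable [set A : 'M[R]_(d, n) | unit_cube A /\ ~ dense_orbit b (2 * Z) G A]
    (2 * 8 ^+ m / (Z%:R ^+ d * G ^+ m)).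
Proof.
move=> d0 n0 Z0 G0 q0 cb.
(* For [G >= 1] the zero vector and the floor of the target already suffice, so there is nothing to
   cover. *)
have [G1|G1] := ltP G 1; last first.
  apply: (@coverable_sub _ _ _ _ set0) (lexx _) _ => [A [_ nA]|].
    case: nA => y; exists 0 => [i|]; first by rewrite mxE normr0.
    exists (- map_mx Num.floor y) => j; rewrite map_mx0 !mul0mx !mxE sub0r rmorphN opprK.
    rewrite distrC; have := floor_itv (y 0 j); rewrite intrD => /andP[h1 h2].
    by rewrite ger0_norm; lra.
  by apply: coverable_set0 => //; rewrite divr_ge0 ?mulr_ge0 ?exprn_ge0 // ltW.
pose B : R := \sum_l \sum_j `|(b l j)%:~R|.
have B0 : 0 <= B by apply: sumr_ge0 => l _; apply: sumr_ge0.
(* The summands ensure in turn: [w >= p G / 8] below, distinct digits modulo [p], [q] invertible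
   modulo [p], and a rounding error of at most [G / 2]. *)
have [p pp] := prime_large (8 / G + Z%:R + `|q|%:~R + 1 + 2 * (d%:R * (2 * Z%:R) * B + 1) / G).
have hG8 : 0 <= 8 / G by rewrite divr_ge0 // ltW.
have hGB : 0 <= 2 * (d%:R * (2 * Z%:R) * B + 1) / G.
  by rewrite divr_ge0 ?(ltW G0) // mulr_ge0 // addr_ge0 // !mulr_ge0.
have hq : 0 <= `|q|%:~R :> R by rewrite ler0z.
have hZ : 0 <= Z%:R :> R by [].
move=> plarge.
have p0 : 0 < p%:R :> R by rewrite ltr0n prime_gt0.
have pG8 : 8 <= p%:R * G.
  by rewrite -ler_pdivrMr //; lra.
have pZ : (Z <= p)%N by rewrite -(@ler_nat R); lra.
have pq : (`|q| < p)%N.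
  by rewrite -ltz_nat abszE -(@ltr_int R) -pmulrn; lra.
have pB : (d%:R * (2 * Z%:R) * B + 1) / p%:R <= G / 2.
  rewrite ler_pdivrMr //.
  have : 2 * (d%:R * (2 * Z%:R) * B + 1) / G <= p%:R by lra.
  by rewrite ler_pdivrMr //; lra.
(* Two digits below [w] displace a point by at most [2 w / p <= G / 2]; the other half of [G] is
   left to the rounding error. *)
pose w := Num.truncn (p%:R * G / 4).
have pG0 : 0 <= p%:R * G / 4 by lra.
have /andP[w1 w2] := truncn_itv pG0; rewrite -/w -[w.+1%:R]natr1 in w1 w2.
have wp : (w <= p)%N.
  rewrite -(@ler_nat R); have : p%:R * G <= p%:R by rewrite ger_pMr // ltW.
  by lra.
have w8 : p%:R * G / 8 <= w%:R by lra.
pose bF : 'M['F_p]_(n, m) := imx b.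
pose cF : 'M['F_p]_(m, n) := (q%:~R)^-1 *: imx c.
have cbF : cF *m bF = 1%:M.
  rewrite -scalemxAl -map_mxM cb map_scalar_mx scale_scalar_mx mulVf //.
  exact: Fp_intr_neq0.
pose zv (f : {ffun 'I_d -> 'I_Z}) : 'rV['F_p]_d := \row_i (f i : nat)%:R.
have zv_inj : injective zv by exact: digit_row_inj.
pose wv (f : {ffun 'I_m -> 'I_w}) : 'rV['F_p]_m := \row_i (f i : nat)%:R.
have wv_inj : injective wv by exact: digit_row_inj.
pose Wd : {set 'rV['F_p]_m} := [set wv f | f in [set: {ffun 'I_m -> 'I_w}]]%SET.
have cWd : #|Wd| = (w ^ m)%N by rewrite card_imset // cardsT card_ffun !card_ord.
pose Gd : {set 'M['F_p]_(d, n)} := [set g | half_missing bF zv Wd g]%SET.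
have := card_half_missing cbF Wd zv_inj; rewrite -/Gd cWd card_ffun !card_ord.
rewrite Fp_cast // => cG.
apply: (@coverable_sub _ _ _ _ [set A | exists2 g, g \in Gd & cell g A] _ (#|Gd|%:R / p%:R ^+ (d * n))); last first.
- exact: coverable_cells.
- rewrite ler_pdivlMr ?mulr_gt0 ?exprn_gt0 // ?ltr0n // mulrAC ler_pdivrMr ?exprn_gt0 //.
  have : (#|Gd| * (Z ^ d * w ^ m))%N%:R <= (2 * p ^ (d * n) * p ^ m)%N%:R :> R by rewrite ler_nat.
  rewrite !natrM !natrX => cG'.
  have w8m : (p%:R * G / 8) ^+ m <= w%:R ^+ m by rewrite lerXn2r // ?nnegrE; lra.
  have cG2 : #|Gd|%:R * (Z%:R ^+ d * (p%:R * G / 8) ^+ m) <= 2 * p%:R ^+ (d * n) * p%:R ^+ m.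
    apply: le_trans cG'; rewrite ler_wpM2l // ler_wpM2l // exprn_ge0 //.
  rewrite -(@ler_pM2r _ (p%:R ^+ m / 8 ^+ m)) ?divr_gt0 ?exprn_gt0 //.
  apply: le_trans (_ : #|Gd|%:R * (Z%:R ^+ d * (p%:R * G / 8) ^+ m) <= _).
    by rewrite !exprMn exprVn le_eqVlt; apply/orP; left; apply/eqP; ring.
  apply: le_trans cG2 _; rewrite le_eqVlt; apply/orP; left; apply/eqP.
  have : 8 ^+ m != 0 :> R by rewrite expf_neq0 // pnatr_eq0.
  by move=> ?; field.
move=> A [UA nA]; exists (imx (grid_index p A)); last exact: cell_grid_index.
apply: contrapT => /negP; rewrite inE => /half_missingN hm; apply: nA => y.
pose Y : 'rV[int]_m := map_mx Num.floor (p%:R *: y).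
have [z [z' [x [x' [xW x'W e]]]]] := hm (imx Y).
have [f _ fE] := imsetP xW; have [f' _ fE'] := imsetP x'W.
pose zeta : 'rV[int]_d := \row_i (z i + z' i)%N%:Z.
pose om : 'rV[int]_m := \row_i (f i + f' i)%N%:Z.
exists zeta => [i|].
  by rewrite mxE ger0_norm // lez_nat mul2n -addnn leq_add // ltnW.
have e2 : imx (zeta *m grid_index p A *m b) = imx (Y + om) :> 'rV['F_p]_m.
  rewrite !map_mxM map_mxD.
  have -> : imx zeta = zv z + zv z' :> 'rV['F_p]_d by apply/rowP => i; rewrite !mxE -pmulrn natrD.
  have -> : imx om = x + x' :> 'rV['F_p]_m by rewrite fE fE'; apply/rowP => i; rewrite !mxE -pmulrn natrD.
  by rewrite !mulmxDl e addrA.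
(* Divided by [p], a congruence modulo [p] is an equality modulo 1: the multiples of [p] become the
   integers [v]. *)
have /choice[v hv] : forall j, exists t : int, (zeta *m grid_index p A *m b) 0 j = (Y + om) 0 j + t * p%:Z.
  move=> j; move/rowP: e2 => /(_ j); rewrite !mxE => /eqP; rewrite -subr_eq0 -rmorphB Fp_intr_eq0 //.
  by move=> /dvdzP[t ht]; exists t; rewrite -ht addrC subrK.
exists (\row_j v j) => j.
have -> : (imx zeta *m A *m imx b - imx (\row_j v j) - y) 0 j =
   (imx zeta *m (A - p%:R^-1 *: imx (grid_index p A)) *m imx b) 0 j
   + (p%:R^-1 * (Y 0 j)%:~R - y 0 j) + p%:R^-1 * (om 0 j)%:~R.
  have hp : p%:R != 0 :> R by rewrite gt_eqF.
  have : p%:R^-1 * ((zeta *m grid_index p A *m b) 0 j)%:~R = p%:R^-1 * (Y 0 j)%:~R + p%:R^-1 * (om 0 j)%:~R + (v j)%:~R :> R.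
    by rewrite hv !mxE !rmorphD rmorphM /= -pmulrn; field.
  have -> : ((zeta *m grid_index p A *m b) 0 j)%:~R = (imx zeta *m imx (grid_index p A) *m imx b) 0 j :> R.
    by rewrite -!map_mxM [in RHS]mxE.
  rewrite mulmxBr mulmxBl -scalemxAr -scalemxAl.
  move: (imx zeta *m imx (grid_index p A) *m imx b) (imx zeta *m A *m imx b) => U1 U2 hU.
  move: ((Y 0 j)%:~R : R) ((om 0 j)%:~R : R) hU => a1 a2 hU.
  by rewrite !mxE hU; ring.
have h1 : `|(imx zeta *m (A - p%:R^-1 *: imx (grid_index p A)) *m imx b) 0 j| <= d%:R * (2 * Z%:R) * B / p%:R.
  apply: le_trans (@mulmx3_bound _ _ _ _ _ _ (2 * Z%:R) p%:R^-1 j _ _ _) _.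
  - move=> i; rewrite !mxE -pmulrn normr_nat -natrM ler_nat mul2n -addnn leq_add // ltnW //.
  - by move=> i l; apply: grid_index_err; rewrite prime_gt0.
  - by rewrite mulr_ge0.
  rewrite -!mulrA ler_wpM2l // ler_wpM2l // ler_wpM2l // mulrC ler_wpM2r ?invr_ge0 ?(ltW p0) //.
  by apply: ler_sum => l _; rewrite mxE (bigD1 j) //= lerDl sumr_ge0.
have h2 : `|p%:R^-1 * (Y 0 j)%:~R - y 0 j| <= p%:R^-1.
  have := @grid_index_err _ _ p y 0 j (prime_gt0 pp).
  by rewrite distrC !mxE.
have h3 : `|p%:R^-1 * (om 0 j)%:~R| <= G / 2.
  rewrite normrM gtr0_norm ?invr_gt0 // mulrC ler_pdivrMr // !mxE -pmulrn normr_nat.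
  have : (f j + f' j)%N%:R <= (w + w)%N%:R :> R by rewrite ler_nat leq_add // ltnW.
  by rewrite !natrD; lra.
have := ler_normD ((imx zeta *m (A - p%:R^-1 *: imx (grid_index p A)) *m imx b) 0 j + (p%:R^-1 * (Y 0 j)%:~R - y 0 j)) (p%:R^-1 * (om 0 j)%:~R).
have := ler_normD ((imx zeta *m (A - p%:R^-1 *: imx (grid_index p A)) *m imx b) 0 j) (p%:R^-1 * (Y 0 j)%:~R - y 0 j).
rewrite mulrDl mul1r in pB.
by lra.
Qed.

End AlmostEvery.

(** * Convergence of the sum of the exceptional measures *)

Section BorelCantelli.
Context {R : realType}.

(* The series of the [1 / psi h] converges by comparison with the telescoping [1 / ln h], while
   [psi h] is still only [h ^ (1 + o(1))]. *)
Definition psi (h : nat) : R := (h.+1)%:R * ln (h.+1)%:R ^+ 2.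

Lemma ln_nat_gt0 (h : nat) : (1 < h)%N -> 0 < ln h%:R :> R.
Proof. by move=> h1; rewrite ln_gt0 // ltr1n. Qed.

Lemma psi_gt0 (h : nat) : (0 < h)%N -> 0 < psi h.
Proof. by move=> h0; rewrite mulr_gt0 // exprn_gt0 // ln_nat_gt0. Qed.

(** The logarithm grows by at least [1 / (h + 1)] from [h] to [h + 1], because
    [ln (1 - x) <= - x]. *)
Lemma inv_psi_telescope (h : nat) : (1 < h)%N ->
  (psi h)^-1 <= (ln h%:R)^-1 - (ln h.+1%:R)^-1 :> R.
Proof.
move=> h1; have a0 := ln_nat_gt0 h1; have b0 := @ln_nat_gt0 h.+1 (leqW h1).
have h0 : 0 < h%:R :> R by rewrite ltr0n ltnW.
have hS : 0 < h.+1%:R :> R by rewrite ltr0n.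
have ab : ln h%:R <= ln h.+1%:R :> R by rewrite ler_ln ?posrE // ler_nat.
have key : h.+1%:R^-1 <= ln h.+1%:R - ln h%:R :> R.
  have e : h%:R = h.+1%:R * (1 + - h.+1%:R^-1) :> R.
    by rewrite mulrDr mulr1 mulrN divff ?gt_eqF // -natr1 addrK.
  have hi : h.+1%:R^-1 < 1 :> R by rewrite invf_lt1 // ltr1n ltnW.
  rewrite e lnM ?posrE ?subr_gt0 //.
  have := @le_ln1Dx R (- h.+1%:R^-1); rewrite ltrN2 => /(_ hi).
  by move: (h.+1%:R^-1) (ln _) (ln _) => x y z; lra.
have -> : (ln h%:R)^-1 - (ln h.+1%:R)^-1 = (ln h.+1%:R - ln h%:R) / (ln h%:R * ln h.+1%:R) :> R.
  by field; rewrite !gt_eqF.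
rewrite ler_pdivlMr ?mulr_gt0 // /psi invfM mulrAC -mulrA mulrC.
apply: le_trans (_ : 1 * h.+1%:R^-1 <= _); last by rewrite mul1r.
rewrite ler_pM2r ?invr_gt0 // ler_pdivrMr ?exprn_gt0 // mul1r expr2.
by rewrite ler_pM2r.
Qed.

Lemma ln_inv_small (eps : R) : 0 < eps -> exists2 H, (1 < H)%N & (ln H%:R)^-1 <= eps.
Proof.
move=> e0; pose H := (Num.bound (expR eps^-1)).+2; exists H => //.
have hH : expR eps^-1 <= H%:R.
  apply: ltW; apply: lt_le_trans (archi_boundP (expR_ge0 _)) _.
  by rewrite ler_nat /H leqW.
rewrite -[leRHS]invrK lef_pV2 ?posrE ?invr_gt0 ?ln_nat_gt0 //.
by rewrite -ler_expR lnK // posrE ltr0n.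
Qed.

Lemma coverable_seq {m n : nat} (I : eqType) (s : seq I) (N : I -> set 'M[R]_(m, n)) (e : R) :
  (0 < m)%N -> (0 < n)%N -> 0 <= e ->
  (forall i, i \in s -> coverable (N i) e) ->
  coverable [set A | exists2 i, i \in s & N i A] ((size s)%:R * e).
Proof.
move=> m0 n0 e0 h; case: s h => [|i0 s] h.
  apply: (coverable_sub _ (lexx _) (coverable_set0 m0 n0 _)); last by rewrite mul0r.
  by move=> A [i].
set t := i0 :: s in h *.
pose N2 j := if (j < size t)%N then N (nth i0 t j) else set0.
apply: (@coverable_sub _ _ _ _ (\bigcup_j N2 j) _ _ _ (lexx _)).
  move=> A [i it NA]; exists (index i t) => //; rewrite /N2 index_mem it nth_index //.
apply: (@coverable_bigcup _ _ _ m0 n0 N2 (fun j => if (j < size t)%N then e else 0)) => [j|J].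
  rewrite /N2; case: ifP => jt; last exact: coverable_set0.
  by apply: h; rewrite mem_nth.
rewrite -big_mkcond sumr_const -[leLHS]mulr_natl ler_wpM2r // ler_nat.
rewrite -[leqRHS]card_ord.
have inj : injective (fun j : {j : 'I_J | (j < size t)%N} => Ordinal (valP j)).
  by move=> x y /(congr1 val) /= /val_inj /val_inj.
by have := leq_card _ inj; rewrite card_sig.
Qed.

End BorelCantelli.

(** Codes the integers of absolute value at most [w] by the numbers below [(2 * w).+1]; the later
    counts of integer vectors rest on it. *)
Lemma absz_shift (u : int) (w : nat) : `|u| <= w%:Z ->
  (absz (u + w%:Z)%R < (2 * w).+1)%N /\ Posz (absz (u + w%:Z)) - w%:Z = u.
Proof. by split; lia. Qed.

(** * Matrices with a value close to an integer *)

Section Thin.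
Context {R : realType}.

Lemma card_fiber_set (F : finFieldType) (d n m : nat) (b : 'M[F]_(n, m)) (c : 'M[F]_(m, n))
    (v : 'rV[F]_d) (T : {set 'rV[F]_m}) : c *m b = 1%:M -> v != 0 ->
  (#|[set g : 'M[F]_(d, n) | v *m g *m b \in T]%SET| * #|F| ^ m = #|T| * #|F| ^ (d * n))%N.
Proof.
move=> cb v0; rewrite -sum1dep_card.
rewrite (partition_big (fun g : 'M[F]_(d, n) => v *m g *m b) (mem T)) //=.
rewrite big_distrl -sum_nat_const /=; apply: eq_bigr => t tT.
rewrite -(card_fiber cb t v0) -sum1dep_card; congr (_ * _)%N; apply: eq_bigl => g.
by case: eqP => [->|]; rewrite ?tT ?andbF.
Qed.

(** For fixed [v] the value is equidistributed modulo 1, so the true measure is about [2 * delta].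
    Rounding to the grid doubles the width, and the odd number [(2 * w).+1] of residues costs one
    more [1 / p <= delta]. *)
Lemma coverable_thin {d n} (b : 'cV[int]_n) (v : 'rV[int]_d) (delta : R) :
  (0 < d)%N -> (0 < n)%N -> b != 0 -> v != 0 -> 0 < delta ->
  coverable [set A : 'M[R]_(d, n) | unit_cube A /\
    exists m : int, `|(imx v *m A *m imx b) 0 0 - m%:~R| < delta] (5 * delta).
Proof.
move=> d0 n0 b0 v0 D0.
have [l0 bl0] : exists l, b l 0 != 0.
  apply: contrapT => h; case/negP: b0; apply/eqP/colP => l; rewrite mxE.
  by apply: contrapT => hl; apply: h; exists l; apply/eqP.
have [i0 vi0] := rV0Pn _ v0.
pose B : R := \sum_l `|(imx b : 'cV[R]_n) l 0|.
pose V : R := \sum_i `|(imx v : 'rV[R]_d) 0 i|.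
have B0 : 0 <= B by apply: sumr_ge0.
have V0 : 0 <= V by apply: sumr_ge0.
have hVi i : `|(imx v : 'rV[R]_d) 0 i| <= V by rewrite /V (bigD1 i) //= lerDl sumr_ge0.
(* The first terms keep [b] and [v] nonzero modulo [p]; the last two bound the rounding error and 1
   by [p * delta]. *)
have [p pp] := prime_large (`|b l0 0|%:~R + `|v 0 i0|%:~R + 1 + (d%:R * V * B) / delta + delta^-1 : R).
have hb : 0 <= `|b l0 0|%:~R :> R by rewrite ler0z.
have hv : 0 <= `|v 0 i0|%:~R :> R by rewrite ler0z.
have hd : 0 <= d%:R * V * B / delta by rewrite divr_ge0 ?(ltW D0) // !mulr_ge0.
have hD : 0 < delta^-1 by rewrite invr_gt0.
move=> plarge.
have p0 : 0 < p%:R :> R by rewrite ltr0n prime_gt0.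
have pb : (absz (b l0 (0 : 'I_1)%R) < p)%N by rewrite -ltz_nat abszE -(@ltr_int R) -pmulrn; lra.
have pv : (absz (v (0 : 'I_1)%R i0) < p)%N by rewrite -ltz_nat abszE -(@ltr_int R) -pmulrn; lra.
have pD1 : 1 <= p%:R * delta by rewrite -ler_pdivrMr // mul1r; lra.
have pDB : d%:R * V * B <= p%:R * delta by rewrite -ler_pdivrMr //; lra.
pose w := Num.truncn (2 * (p%:R * delta)).
have pG0 : 0 <= 2 * (p%:R * delta) by lra.
have /andP[w1 w2] := truncn_itv pG0; rewrite -/w -[w.+1%:R]natr1 in w1 w2.
pose bF : 'M['F_p]_(n, 1) := imx b.
pose cF : 'M['F_p]_(1, n) := ((b l0 0)%:~R)^-1 *: delta_mx 0 l0.
have cbF : cF *m bF = 1%:M.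
  apply/matrixP => i j; rewrite !ord1 -scalemxAl -rowE !mxE mulVf //.
  exact: Fp_intr_neq0.
have vF0 : imx v != 0 :> 'rV['F_p]_d.
  by apply/rV0Pn; exists i0; rewrite mxE; exact: Fp_intr_neq0.
pose tv (s : 'I_(2 * w).+1) : 'rV['F_p]_1 := const_mx ((s : nat)%:Z - w%:Z)%:~R.
pose T : {set 'rV['F_p]_1} := [set tv s | s in [set: 'I_(2 * w).+1]]%SET.
have cT : (#|T| <= (2 * w).+1)%N.
  by apply: leq_trans (leq_imset_card _ _) _; rewrite cardsT card_ord.
pose Gd := [set g : 'M['F_p]_(d, n) | imx v *m g *m bF \in T]%SET.
have := card_fiber_set T cbF vF0; rewrite -/Gd card_ord Fp_cast // expn1 => cG.
apply: (@coverable_sub _ _ _ _ [set A | exists2 g, g \in Gd & cell g A] _ (#|Gd|%:R / p%:R ^+ (d * n))); last first.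
- exact: coverable_cells.
- rewrite ler_pdivrMr ?exprn_gt0 // -(ler_pM2r p0).
  have -> : #|Gd|%:R * p%:R = #|T|%:R * p%:R ^+ (d * n) :> R by rewrite -natrM cG natrM natrX.
  rewrite mulrAC ler_wpM2r ?exprn_ge0 //.
  apply: le_trans (_ : (2 * w).+1%:R <= _); first by rewrite ler_nat.
  by rewrite -natr1 natrM; lra.
move=> A [UA [m hm]]; exists (imx (grid_index p A)); last exact: cell_grid_index.
pose N := (v *m grid_index p A *m b) 0 0.
have hN : `|N - p%:Z * m| <= w%:Z.
  have : `|N - p%:Z * m|%:~R <= 2 * (p%:R * delta).
    have e : (imx v *m (A - p%:R^-1 *: imx (grid_index p A)) *m imx b) 0 0 =
       (imx v *m A *m imx b) 0 0 - p%:R^-1 * N%:~R :> R.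
      have -> : N%:~R = (imx v *m imx (grid_index p A) *m imx b) 0 0 :> R.
        by rewrite -!map_mxM [in RHS]mxE.
      rewrite mulmxBr mulmxBl -scalemxAr -scalemxAl.
      by move: (imx v *m imx (grid_index p A) *m imx b) (imx v *m A *m imx b) => U1 U2; rewrite !mxE.
    have := @mulmx3_bound R _ _ _ (imx v) (A - p%:R^-1 *: imx (grid_index p A)) (imx b) V p%:R^-1 0 hVi _ V0.
    rewrite e -/B => /(_ (fun i l => grid_index_err A i l (prime_gt0 pp))) h.
    have -> : `|N - p%:Z * m|%:~R = p%:R * `|p%:R^-1 * N%:~R - m%:~R| :> R.
      rewrite -[X in _ = X * _](gtr0_norm p0) -normrM mulrBr mulrA mulfV ?gt_eqF // mul1r.
      by rewrite intr_norm rmorphB rmorphM /= -pmulrn.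
    rewrite mulrCA ler_pM2l //.
    apply: le_trans (ler_distD ((imx v *m A *m imx b) 0 0) _ _) _.
    rewrite distrC; apply: le_trans (lerD h (ltW hm)) _.
    rewrite [2 * _]mulrDl mul1r lerD2r mulrAC ler_pdivrMr //.
    by rewrite [delta * _]mulrC.
  have : (w.+1%:R : R) = (w%:Z + 1)%:~R by rewrite intrD -natr1 -pmulrn.
  move=> e h; rewrite -ltzD1 -(@ltr_int R) -e; apply: le_lt_trans h _.
  by rewrite -[w.+1%:R]natr1.
rewrite inE; apply/imsetP.
have [u uE] : exists u : int, u = N - p%:Z * m by exists (N - p%:Z * m).
rewrite -uE in hN.
have [hs hs2] := absz_shift hN.
exists (Ordinal hs); first by rewrite inE.
have -> : imx v *m imx (grid_index p A) *m bF = const_mx (N%:~R) :> 'M['F_p]_(1,1).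
  by apply/matrixP => i j; rewrite !ord1 -!map_mxM [in RHS]mxE [in LHS]mxE.
rewrite /tv /=; congr const_mx.
rewrite hs2 uE.
by rewrite rmorphB rmorphM /= -[(p%:Z)%:~R]pmulrn pchar_Fp_0 // mul0r subr0.
Qed.

End Thin.

(** * Generic matrices *)

Section Generic.
Context {R : realType}.

Lemma nat_above (x : R) : exists2 N : nat, (0 < N)%N & x <= N%:R.
Proof. by have [p pp hp] := prime_large x; exists p => //; apply: prime_gt0. Qed.

Definition cover_radius (d h : nat) : R := psi h / 2 ^+ (h * d).

(** With one entry bounded there are [O(2 ^ (h (d - 1)))] vectors of size [2 ^ h]; the square makes
    the exceptional measures summable. The gap exceeds [cover_radius d h] by a factor [2 ^ h], up to
    powers of [h]. *)
Definition thin_gap (d h : nat) : R := (2 ^+ (h * d.-1) * h.+1%:R ^+ 2)^-1.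

Definition eventually_dense {d n} (b : 'cV[int]_n) (A : 'M[R]_(d, n)) : Prop :=
  exists h0, forall h, (h0 <= h)%N -> dense_orbit b (2 ^ h) (cover_radius d h) A.

Definition eventually_thin {d n} (b : 'cV[int]_n) (kappa : nat) (A : 'M[R]_(d, n)) : Prop :=
  exists h0, forall h, (h0 <= h)%N -> forall v : 'rV[int]_d, v != 0 ->
    (forall i, `|v 0 i| <= (2 ^ h)%N%:Z) -> (exists i, `|v 0 i| <= kappa%:Z) ->
    forall m : int, thin_gap d h <= `|(imx v *m A *m imx b) 0 0 - m%:~R|.

(** Integral directions [b] and bounds [kappa] are countable in number, so a single null set is
    discarded for all windows at once. *)
Definition generic {d n} (A : 'M[R]_(d, n)) : Prop :=
  (forall eps : R, 0 < eps -> exists Z, dense_orbit 1%:M Z eps A) /\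
  (forall b : 'cV[int]_n, b != 0 -> eventually_dense b A /\ forall kappa, eventually_thin b kappa A).

Lemma null_not_eventually_dense {d n} (b : 'cV[int]_n) : (0 < d)%N -> (0 < n)%N -> b != 0 ->
  lebesgue_null [set A : 'M[R]_(d, n) | ~ eventually_dense b A].
Proof.
move=> d0 n0 b0; apply: null_periodic => // [A T h [h0 hd]|].
  by apply: h; exists h0 => h1 /hd; apply: dense_orbit_shift.
have [l0 bl0] : exists l, b l 0 != 0.
  apply: contrapT => h; case/negP: b0; apply/eqP/colP => l; rewrite mxE.
  by apply: contrapT => hl; apply: h; exists l; apply/eqP.
have cb : (delta_mx 0 l0 : 'rV[int]_n) *m b = (b l0 0)%:M.
  by apply/matrixP => i j; rewrite !ord1 -rowE !mxE.
(* The size [2 ^ h] is written [2 * 2 ^ h.-1] because targets are reached by sums of two vectors.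
   Passing to [h.-1] costs the factor [2 ^+ d] of the potential below, and [16] is [2 * 8 ^ 1]. *)
pose E h := [set A : 'M[R]_(d, n) | unit_cube A /\ ~ dense_orbit b (2 * 2 ^ h.-1) (cover_radius d h) A].
apply: (@null_sub _ _ _ _ [set A | forall H, exists2 h, (H <= h)%N & E h A]) => [A [nA UA] H|].
  apply: contrapT => hh; apply: nA; exists H.+1 => h Hh.
  apply: contrapT => nd; apply: hh; exists h; first exact: ltnW.
  by split => //; rewrite -expnS prednK // (leq_ltn_trans _ Hh).
apply: (@null_limsup _ _ _ d0 n0 E (fun h => 16 * 2 ^+ d / ln h%:R) 2) => [h h2|h h2|eps e0].
- have h0 : (0 < h)%N by apply: ltn_trans h2.
  have G0 : 0 < cover_radius d h by rewrite divr_gt0 ?psi_gt0 // exprn_gt0.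
  have Z0 : (0 < 2 ^ h.-1)%N by rewrite expn_gt0.
  have q0 := bl0.
  apply: (coverable_sub _ _ (coverable_not_dense d0 n0 Z0 G0 q0 cb)); first by [].
  rewrite -mulrBr; apply: le_trans (_ : 16 * 2 ^+ d * (psi h)^-1 <= _); last first.
    by rewrite ler_pM2l ?inv_psi_telescope // mulr_gt0 // exprn_gt0.
  rewrite le_eqVlt; apply/orP; left; apply/eqP.
  rewrite !expr1 /cover_radius natrX -exprM.
  have -> : (h * d = d + h.-1 * d)%N by rewrite -mulSn prednK.
  rewrite exprD.
  have : 2 ^+ d != 0 :> R by rewrite expf_neq0 // pnatr_eq0.
  have : 2 ^+ (h.-1 * d) != 0 :> R by rewrite expf_neq0 // pnatr_eq0.
  have : psi h != 0 :> R by rewrite gt_eqF // psi_gt0.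
  by move: (psi h) => x ? ? ?; field; apply/and3P.
- by rewrite divr_ge0 ?mulr_ge0 ?exprn_ge0 // ltW // ln_nat_gt0.
have c0 : 0 < 16 * 2 ^+ d :> R by rewrite mulr_gt0 // exprn_gt0.
have [H H1 hH] := @ln_inv_small R (eps / (16 * 2 ^+ d)) (divr_gt0 e0 c0).
by exists H => //; rewrite mulrC -ler_pdivlMr.
Qed.

Lemma null_not_dense {d n} : (0 < d)%N -> (0 < n)%N ->
  lebesgue_null [set A : 'M[R]_(d, n) | ~ forall eps : R, 0 < eps -> exists Z, dense_orbit 1%:M Z eps A].
Proof.
move=> d0 n0.
pose N (e : nat) := [set A : 'M[R]_(d, n) | ~ exists Z, dense_orbit 1%:M Z (e.+1%:R^-1) A].
apply: (@null_sub _ _ _ _ [set A | exists e, N e A]) => [A nA|].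
  apply: contrapT => h; apply: nA => eps e0; apply: contrapT => hZ; apply: h.
  exists (Num.bound eps^-1) => -[Z hd]; apply: hZ; exists Z; apply: dense_orbitS hd => //.
  rewrite -[leRHS]invrK lef_pV2 ?posrE ?invr_gt0 //.
  by apply/ltW/(lt_trans (archi_boundP _)); rewrite ?invr_ge0 ?(ltW e0) // ltr_nat.
apply: null_countable => // e; apply: null_periodic => // [A T h [Z hd]|].
  by apply: h; exists Z; apply: dense_orbit_shift hd.
move=> eps e0.
have e1 : 0 < e.+1%:R^-1 :> R by rewrite invr_gt0.
pose c : R := 2 * 8 ^+ n / e.+1%:R^-1 ^+ n.
have c0 : 0 < c by rewrite divr_gt0 ?mulr_gt0 ?exprn_gt0.
have [Z Z0 hZ] := nat_above (c / eps).
have i1 : (1%:M : 'M[int]_n) *m 1%:M = 1%:M by rewrite mul1mx.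
have q0 : (1 : int) != 0 by [].
apply: (coverable_sub _ _ (coverable_not_dense d0 n0 Z0 e1 q0 i1)) => [A [nA UA]|].
  by split => // hd; apply: nA; exists (2 * Z)%N.
have -> : 2 * 8 ^+ n / (Z%:R ^+ d * e.+1%:R^-1 ^+ n) = c / Z%:R ^+ d.
  by rewrite /c invfM -!mulrA; congr (_ * (_ * _)); rewrite mulrC.
rewrite ler_pdivrMr // in hZ.
have Zd : Z%:R <= Z%:R ^+ d :> R.
  by rewrite -[leLHS]expr1 ler_weXn2l // ler1n.
rewrite ler_pdivrMr ?exprn_gt0 ?ltr0n //; apply: le_trans hZ _.
by rewrite mulrC ler_pM2l.
Qed.

Lemma null_not_eventually_thin {d n} (b : 'cV[int]_n) (kappa : nat) : (0 < d)%N -> (0 < n)%N -> b != 0 ->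
  lebesgue_null [set A : 'M[R]_(d, n) | ~ eventually_thin b kappa A].
Proof.
case: d => // d _ n0 b0; apply: null_periodic => // [A T h [h0 hd]|].
  apply: h; exists h0 => h1 /hd {}hd v v0 hv hv' m.
  have := hd v v0 hv hv' (m - (v *m T *m b) 0 0).
  rewrite mulmxBr mulmxBl -!map_mxM rmorphB /=.
  move: (imx v *m A *m imx b) (v *m T *m b) => U1 U2.
  by rewrite !mxE opprB addrA subrK.
(* The place and the value of the bounded entry, then the remaining [d] entries. *)
pose I (h : nat) := ('I_d.+1 * 'I_(2 * kappa).+1 * {ffun 'I_d -> 'I_(2 * 2 ^ h).+1})%type.
pose vec h (x : I h) : 'rV[int]_d.+1 :=
  \row_j oapp (fun j' => (x.2 j' : nat)%:Z - (2 ^ h)%N%:Z) ((x.1.2 : nat)%:Z - kappa%:Z) (unlift x.1.1 j).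
pose s h := [seq v <- [seq vec h x | x : I h] | v != 0].
pose E h := [set A : 'M[R]_(d.+1, n) | exists2 v, v \in s h & unit_cube A /\
    exists m : int, `|(imx v *m A *m imx b) 0 0 - m%:~R| < thin_gap d.+1 h].
have gap0 h : 0 < thin_gap d.+1 h by rewrite invr_gt0 mulr_gt0 // exprn_gt0.
apply: (@null_sub _ _ _ _ [set A | forall H, exists2 h, (H <= h)%N & E h A]) => [A [nA UA] H|].
  apply: contrapT => hh; apply: nA; exists H => h Hh v v0 hv [i hi] m.
  rewrite leNgt; apply/negP => hm; apply: hh; exists h => //; exists v; last by split => //; exists m.
  rewrite mem_filter v0 /=; apply/mapP.
  have [hs1 hs2] := absz_shift hi.
  have hf j := absz_shift (hv j).
  exists (i, Ordinal hs1, [ffun j => Ordinal (hf (lift i j)).1]); first exact: mem_enum.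
  apply/rowP => j; rewrite mxE /=; case: unliftP => [j' ->|->] /=; last by rewrite hs2.
  by rewrite ffunE /= (hf _).2.
(* [3 ^+ d] comes from [2 * 2 ^ h + 1 <= 3 * 2 ^ h], and [5] from [coverable_thin]. The sum of
   [1 / (h + 1) ^ 2] is then telescoped by [1 / h]. *)
pose C : R := d.+1%:R * (2 * kappa).+1%:R * 3 ^+ d * 5.
have C0 : 0 < C by rewrite !mulr_gt0 // exprn_gt0.
apply: (@null_limsup R d.+1 n isT n0 E (fun h => C / h%:R) 1) => [h h1|h h1|eps e0].
- apply: (@coverable_sub _ _ _ _ (E h) _ ((size (s h))%:R * (5 * thin_gap d.+1 h))) => //; last first.
    apply: coverable_seq => // [|v]; first by rewrite mulr_ge0 // ltW.
    rewrite mem_filter => /andP[v0 _]; exact: coverable_thin.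
  have ss : (size (s h))%:R <= d.+1%:R * (2 * kappa).+1%:R * 3 ^+ d * 2 ^+ (h * d) :> R.
    have sI : (size (s h) <= #|{: I h}|)%N.
      by rewrite size_filter (leq_trans (count_size _ _)) // size_map -cardE.
    apply: (@le_trans _ _ (#|{: I h}|%:R)); first by rewrite ler_nat.
    rewrite !card_prod !card_ord card_ffun !card_ord !natrM natrX -!mulrA ler_pM2l // ler_pM2l //.
    rewrite exprM -exprMn lerXn2r ?nnegrE ?mulr_ge0 ?exprn_ge0 //.
    rewrite -natrX -natrM ler_nat mulSn -addn1 addnC leq_add2r expn_gt0 //.
  apply: le_trans (_ : C / h.+1%:R ^+ 2 <= _).
    apply: le_trans (_ : d.+1%:R * (2 * kappa).+1%:R * 3 ^+ d * 2 ^+ (h * d) * (5 * thin_gap d.+1 h) <= _).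
      by rewrite ler_wpM2r // mulr_ge0 // ltW.
    rewrite le_eqVlt; apply/orP; left; apply/eqP; rewrite /thin_gap /C /= -[d.+1%:R]natr1.
    have : 2 ^+ (h * d) != 0 :> R by rewrite expf_neq0 // pnatr_eq0.
    have : h.+1%:R != 0 :> R by rewrite pnatr_eq0.
    by move: (h.+1%:R : R) ((2 * kappa).+1%:R : R) => x y ? ?; field; apply/andP.
  rewrite -mulrBr ler_pM2l // -natr1.
  have : 0 < h%:R :> R by rewrite ltr0n.
  move: (h%:R : R) => x x0.
  have -> : x^-1 - (x + 1)^-1 = (x * (x + 1))^-1 by field; rewrite !gt_eqF // ltr_wpDr.
  rewrite lef_pV2 ?posrE ?exprn_gt0 ?mulr_gt0 ?ltr_wpDr // expr2 ler_pM2r ?ltr_wpDr //.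
  by rewrite lerDl.
- by rewrite divr_ge0 // ltW.
have [H H0 hH] := nat_above (C / eps).
by exists H => //; rewrite ler_pdivrMr ?ltr0n // mulrC -ler_pdivrMr.
Qed.

Lemma full_measure_generic {d n} : (0 < d)%N -> (0 < n)%N ->
  full_measure [set A : 'M[R]_(d, n) | generic A].
Proof.
move=> d0 n0.
pose N1 := [set A : 'M[R]_(d, n) | ~ forall eps : R, 0 < eps -> exists Z, dense_orbit 1%:M Z eps A].
pose N2 (b : 'cV[int]_n) := [set A : 'M[R]_(d, n) | b != 0 /\ ~ eventually_dense b A].
pose N3 (bk : 'cV[int]_n * nat) := [set A : 'M[R]_(d, n) | bk.1 != 0 /\ ~ eventually_thin bk.1 bk.2 A].
apply: (@null_sub _ _ _ _ (N1 `|` ([set A | exists b, N2 b A] `|` [set A | exists bk, N3 bk A]))).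
  move=> A /= nG; apply: contrapT => h; apply: nG; split => [|b b0].
    by apply: contrapT => hN; apply: h; left.
  split; first by apply: contrapT => hN; apply: h; right; left; exists b.
  by move=> kappa; apply: contrapT => hN; apply: h; right; right; exists (b, kappa).
apply: null_setU => //; first exact: null_not_dense.
apply: null_setU => //.
  apply: null_countable => // b; have [b0|b0] := eqVneq b 0.
    by apply: (@null_sub _ _ _ _ set0) => [A []|eps e0]; [rewrite b0 eqxx|exact: coverable_set0 (ltW e0)].
  by apply: null_sub (null_not_eventually_dense d0 n0 b0) => A [].
apply: null_countable => // -[b kappa]; have [b0|b0] := eqVneq b 0.
  by apply: (@null_sub _ _ _ _ set0) => [A []|eps e0]; [rewrite b0 eqxx|exact: coverable_set0 (ltW e0)].
by apply: null_sub (null_not_eventually_thin kappa d0 n0 b0) => A [].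
Qed.

End Generic.

(** * Values in one direction *)

Section OneDirection.
Context {R : realType}.

Lemma bernoulli_ineq (eta : R) (m : nat) : 0 <= eta -> 1 + eta *+ m <= (1 + eta) ^+ m.
Proof.
move=> e0; elim: m => [|m IH]; first by rewrite mulr0n addr0 expr0.
rewrite exprS; apply: le_trans (_ : (1 + eta) * (1 + eta *+ m) <= _).
  rewrite mulrS -mulr_natr; have : 0 <= m%:R :> R by [].
  by move: (m%:R : R) => x x0; nra.
by rewrite ler_wpM2l // addr_ge0.
Qed.

Lemma exp_beats_poly (eta C : R) (e k : nat) : 0 < eta ->
  exists H, forall h, (H <= h)%N -> C * (h + e)%:R ^+ k < (1 + eta) ^+ h.
Proof.
move=> eta0.
pose m1 := Num.min eta 1.
have m10 : 0 < m1 by rewrite lt_min eta0 ltr01.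
pose D := (k.+1%:R / m1) ^+ k.+1.
have D0 : 0 < D by rewrite exprn_gt0 // divr_gt0.
have [H H0 hH] := nat_above (`|C| * e.+1%:R ^+ k * D).
exists H => h Hh.
have hh : `|C| * e.+1%:R ^+ k * D < h.+1%:R.
  by apply: le_lt_trans hH _; rewrite ltr_nat ltnS.
(* Bernoulli's inequality for the exponent [h %/ k.+1], raised to the power [k.+1], gives growth of
   degree [k.+1], one more than required. *)
have low : h.+1%:R ^+ k.+1 <= D * (1 + eta) ^+ h.
  have step : h.+1%:R <= k.+1%:R / m1 * (1 + eta) ^+ (h %/ k.+1).
    have : h.+1%:R <= k.+1%:R * (h %/ k.+1).+1%:R :> R.
      by rewrite -natrM ler_nat mulnC; apply: ltn_ceil.
    move=> /le_trans; apply; rewrite -mulrA ler_pM2l // mulrC ler_pdivlMr //.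
    apply: le_trans (_ : 1 + eta *+ (h %/ k.+1) <= _); last first.
      by apply/bernoulli_ineq/ltW.
    rewrite -natr1 mulrDl mul1r addrC lerD //; first by rewrite ge_min lexx orbT.
    by rewrite mulr_natl lerMn2r ge_min lexx orbT.
  have m1' : 0 < m1^-1 by rewrite invr_gt0.
  have e1 : 0 < 1 + eta by rewrite addr_gt0.
  apply: le_trans (_ : (k.+1%:R / m1 * (1 + eta) ^+ (h %/ k.+1)) ^+ k.+1 <= _).
    by rewrite lerXn2r // ?nnegrE // !mulr_ge0 ?exprn_ge0 ?(ltW m1') ?(ltW e1).
  rewrite exprMn -/D ler_pM2l // -exprM ler_weXn2l ?lerDl ?ltW //.
  exact: leq_trunc_div.
have hk : 0 < h.+1%:R ^+ k :> R by rewrite exprn_gt0.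
rewrite -(ltr_pM2l D0); apply: lt_le_trans low.
rewrite exprS; apply: le_lt_trans (_ : D * (`|C| * (e.+1%:R ^+ k * h.+1%:R ^+ k)) < _).
  rewrite ler_pM2l //; apply: le_trans (ler_norm _) _; rewrite normrM ler_wpM2l //.
  rewrite ger0_norm ?exprn_ge0 // -exprMn lerXn2r ?nnegrE ?mulr_ge0 // -natrM ler_nat.
  by rewrite mulSn mulnS; lia.
rewrite !mulrA ltr_pM2r // (_ : D * _ * _ = `|C| * e.+1%:R ^+ k * D) //.
by rewrite -mulrA mulrC.
Qed.

Lemma psi_le (h : nat) : psi h <= h.+1%:R ^+ 3 :> R.
Proof.
have h1 : 1 <= h.+1%:R :> R by rewrite ler1n.
rewrite /psi [leRHS]exprS ler_wpM2l // lerXn2r ?nnegrE ?ln_ge0 //.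
have h0 : 0 < h.+1%:R :> R by [].
move: (h.+1%:R : R) h0 => x x0.
by have := @le_ln1Dx R (x - 1); rewrite [1 + _]addrC subrK => h2; apply: le_trans (h2 _) _; lra.
Qed.

Section Values.
Context {d n : nat} (A : 'M[R]_(d, n)) (b : 'cV[int]_n) (q : int) (w : 'cV[R]_n).
Hypothesis q0 : q != 0.
Hypothesis qw : q%:~R *: w = imx b.

(** With [w] a column of the inverse window matrix, this is one coordinate of the lattice vector
    [(z1, z2)] in the basis of edges; [q] clears the denominators of [w]. *)
Definition value (z1 : 'rV[int]_d) (z2 : 'rV[int]_n) : R :=
  ((imx z2 - imx z1 *m A) *m w) 0 0.

Lemma valueD z1 z2 z1' z2' : value (z1 + z1') (z2 + z2') = value z1 z2 + value z1' z2'.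
Proof. by rewrite /value !map_mxD [_ *m A]mulmxDl opprD addrACA mulmxDl mxE. Qed.

Lemma valueB z1 z2 z1' z2' : value (z1 - z1') (z2 - z2') = value z1 z2 - value z1' z2'.
Proof.
by apply/eqP; rewrite eq_sym subr_eq -valueD !subrK.
Qed.

Lemma q_value z1 z2 : q%:~R * value z1 z2 =
  ((z2 *m b) 0 0)%:~R - (imx z1 *m A *m imx b) 0 0.
Proof.
have e (m : nat) (u : 'M[R]_(m, n)) : u *m imx b = q%:~R *: (u *m w) by rewrite -qw scalemxAr.
have -> : ((z2 *m b) 0 0)%:~R = (imx z2 *m imx b) 0 0 :> R.
  by rewrite -map_mxM [in RHS]mxE.
rewrite /value !e mulmxBl; move: (imx z2 *m w) (imx z1 *m A *m w) => U V.
by rewrite !mxE mulrBr.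
Qed.

Definition small_values (B G : R) : set R :=
  [set x | 0 < x <= 2 * G /\
    exists (z1 : 'rV[int]_d) (z2 : 'rV[int]_n), (forall i, `|z1 0 i|%:~R <= B) /\ value z1 z2 = x].

(* Adding the small values to [T] well separated values produces [T * size s] distinct values of
   vectors of size [2 B], of which there are [O(B^d)]; [T] can be taken of order [1 / G]. *)
Lemma card_small_values (B G : R) (T : nat) (s : seq R) :
  0 <= B -> 0 < G -> 5 * G * T%:R <= 1 ->
  (forall y, exists (z1 : 'rV[int]_d) (z2 : 'rV[int]_n), (forall i, `|z1 0 i|%:~R <= B) /\ `|value z1 z2 - y| <= G) ->
  uniq s -> (forall x, x \in s -> small_values B G x) ->
  (size s)%:R * T%:R <= (4 * B + 1) ^+ d * (10 * `|q|%:~R + 3).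
Proof.
move=> B0 G0 TG cov us hs.
have [T0|T0] := posnP T.
  by rewrite T0 mulr0 mulr_ge0 ?exprn_ge0 ?addr_ge0 ?mulr_ge0 // ler0z.
have G5 : 5 * G <= 1.
  apply: le_trans TG; rewrite ler_peMr ?mulr_ge0 ?(ltW G0) // ler1n //.
(* Targets at spacing [5 * G], reached up to [G] and then moved by at most [2 * G], remain in
   disjoint intervals. *)
have /choice[a1 /choice[a2 ha]] : forall t : 'I_T, exists z1 : 'rV[int]_d, exists z2 : 'rV[int]_n,
    (forall i, `|z1 0 i|%:~R <= B) /\ `|value z1 z2 - 5 * G * t%:R| <= G by move=> t; exact: cov.
have /choice[v1 /choice[v2 hv]] : forall i : 'I_(size s), exists z1 : 'rV[int]_d, exists z2 : 'rV[int]_n,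
    (forall j, `|z1 0 j|%:~R <= B) /\ value z1 z2 = s`_i.
  by move=> i; have [_ h] := hs _ (mem_nth 0 (ltn_ord i)).
have hv2 (i : 'I_(size s)) : 0 < value (v1 i) (v2 i) <= 2 * G.
  by rewrite (hv i).2; have [h _] := hs _ (mem_nth 0 (ltn_ord i)).
pose N := Num.truncn (2 * B).
have hN (z : int) : `|z|%:~R <= 2 * B -> `|z| <= N%:Z.
  case: (`|z|%R) (normr_ge0 z) => // m _ hm.
  by rewrite lez_nat truncn_ge_nat ?mulr_ge0.
pose Q := absz q.
have Qq : `|q|%:~R = Q%:R :> R by rewrite -abszE -pmulrn.
pose dig (z : int) (M : nat) : 'I_(2 * M).+1 := inord (absz (z + M%:Z)).
have digK z M : `|z| <= M%:Z -> (dig z M : nat)%:Z - M%:Z = z.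
  by move=> h; have [h1 h2] := absz_shift h; rewrite /dig inordK.
pose zz (p : 'I_T * 'I_(size s)) := a1 p.1 + v1 p.2.
(* Once [zz p] is known, the integer [m p] determines the value. It is bounded because the values
   lie between -1 and 2, so it contributes only a constant factor. *)
pose m (p : 'I_T * 'I_(size s)) : int := ((a2 p.1 + v2 p.2) *m b) 0 0 - Num.floor ((imx (zz p) *m A *m imx b) 0 0).
pose code p : {ffun 'I_d -> 'I_(2 * N).+1} * 'I_(2 * (5 * Q + 1)).+1 :=
  ([ffun i => dig (zz p 0 i) N], dig (m p) (5 * Q + 1)%N).
have hzz p i : `|zz p 0 i| <= N%:Z.
  apply: hN; rewrite !mxE; have := (ha p.1).1 i; have := (hv p.2).1 i.
  have := ler_normD (a1 p.1 0 i) (v1 p.2 0 i); rewrite -(@ler_int R) intrD.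
  move: (`|a1 _ _ _|%:~R : R) (`|v1 _ _ _|%:~R : R) (`|_ + _|%:~R : R) => x y z; lra.
have hval p : value (zz p) (a2 p.1 + v2 p.2) = value (a1 p.1) (a2 p.1) + value (v1 p.2) (v2 p.2).
  by rewrite valueD.
have hrange p : -1 <= value (zz p) (a2 p.1 + v2 p.2) <= 2.
  rewrite hval; have /andP[x0 x1] := hv2 p.2.
  have := (ha p.1).2; rewrite ler_distl => /andP[y0 y1].
  have t0 : 0 <= 5 * G * (p.1)%:R by rewrite !mulr_ge0 // ltW.
  have t1 : 5 * G * (p.1)%:R <= 1.
    apply: le_trans TG; rewrite ler_pM2l ?mulr_gt0 // ler_nat ltnW //.
  by apply/andP; split; lra.
have hm p : `|m p| <= (5 * Q + 1)%N%:Z.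
  have := q_value (zz p) (a2 p.1 + v2 p.2); have := hrange p.
  move: (value _ _) => x /andP[x0 x1] e.
  have : `|q%:~R * x| <= 2 * Q%:R.
    rewrite normrM -Qq -intr_norm mulrC ler_wpM2r ?ler0z // ler_norml; apply/andP; split; lra.
  rewrite e /m; set u := (_ *m b) 0 0; set f := (_ *m imx b) 0 0 => hu.
  have /andP[f1 f2] := floor_itv f; rewrite intrD in f2.
  have Q1 : 1 <= Q%:R :> R by rewrite ler1n absz_gt0.
  rewrite -(@ler_int R) intr_norm rmorphB /= -pmulrn natrD natrM ler_norml.
  move: hu; rewrite ler_norml => /andP[u1 u2].
  by apply/andP; split; lra.
have code_inj : injective code.
  move=> p p' [/ffunP e1 e2].
  have ez : zz p = zz p'.
    apply/rowP => i; have := e1 i; rewrite !ffunE => e3.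
    by rewrite -(digK _ _ (hzz p i)) e3 digK.
  have em : m p = m p' by rewrite -(digK _ _ (hm p)) e2 digK.
  have ev : value (zz p) (a2 p.1 + v2 p.2) = value (zz p') (a2 p'.1 + v2 p'.2).
    have qn : q%:~R != 0 :> R by rewrite intr_eq0.
    apply: (mulfI qn); rewrite !q_value ez; congr (_ - _); congr (_%:~R).
    by move: em; rewrite /m ez => /addIr.
  move: ev; rewrite !hval.
  have hx := hv2 p.2; have hx' := hv2 p'.2.
  have := (ha p.1).2; have := (ha p'.1).2; rewrite !ler_distl => hy' hy ev.
  have et : p.1 = p'.1.
    apply: val_inj; apply: contrapT => /eqP; rewrite neq_ltn => /orP[] hlt.
      have : 5 * G * ((p.1)%:R + 1) <= 5 * G * (p'.1)%:R.
        by rewrite ler_pM2l ?mulr_gt0 // natr1 ler_nat.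
      by move: hx hx' hy hy' => /andP[? ?] /andP[? ?] /andP[? ?] /andP[? ?]; lra.
    have : 5 * G * ((p'.1)%:R + 1) <= 5 * G * (p.1)%:R.
      by rewrite ler_pM2l ?mulr_gt0 // natr1 ler_nat.
    by move: hx hx' hy hy' => /andP[? ?] /andP[? ?] /andP[? ?] /andP[? ?]; lra.
  move: ev; rewrite et => /addrI; rewrite (hv p.2).2 (hv p'.2).2 => /eqP.
  rewrite nth_uniq // => /eqP /val_inj.
  by move: p p' et {e1 e2 ez em hx hx' hy hy'} => [t i] [t' i'] /= -> ->.
have := leq_card _ code_inj; rewrite !card_prod card_ffun !card_ord => le.
rewrite mulrC -natrM; apply: le_trans (_ : ((2 * N).+1 ^ d * (2 * (5 * Q + 1)).+1)%N%:R <= _).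
  by rewrite ler_nat.
rewrite natrM natrX ler_pM ?exprn_ge0 //.
  rewrite lerXn2r ?nnegrE ?addr_ge0 ?mulr_ge0 // -natr1 lerD2r natrM.
  by have := truncn_le (2 * B); rewrite mulr_ge0 // -/N; lra.
by rewrite Qq -natr1 natrM natrD natrM; lra.
Qed.

End Values.

End OneDirection.

Lemma norm_int_lt1 (u : int) : `|u| < 1 -> u = 0.
Proof. by lia. Qed.

(** * Estimates at one dyadic scale *)

Section DirectionScale.
Context {R : realType}.
Context {d n : nat} (A : 'M[R]_(d, n)) (b : 'cV[int]_n) (q : int) (w : 'cV[R]_n).
Hypothesis d0 : (0 < d)%N.
Hypothesis q0 : q != 0.
Hypothesis qw : q%:~R *: w = imx b.
Hypothesis w_int : forall m : int, exists z2 : 'rV[int]_n, (imx z2 *m w) 0 0 = m%:~R.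
Hypothesis dense_b : eventually_dense b A.
Hypothesis thin_b : forall kappa, eventually_thin b kappa A.

Local Notation value := (value A w).

(** Multiplying the horizontal vector by [q] replaces [w] by the integral direction [b]; the
    integral part is supplied by [w_int]. *)
Lemma cover_values (h : nat) (G : R) (y : R) : dense_orbit b (2 ^ h) G A ->
  exists (z1 : 'rV[int]_d) (z2 : 'rV[int]_n),
   (forall i, `|z1 0 i|%:~R <= `|q|%:~R * 2 ^+ h :> R) /\ `|value z1 z2 - y| <= G.
Proof.
move=> /(_ (const_mx (- y)))[z hz [v hv]].
have [z2 hz2] := w_int (v 0 0).
exists (q *: z), z2; split => [i|].
  rewrite mxE normrM intrM ler_wpM2l ?ler0z // -natrX pmulrn ler_int; exact: hz.
have := hv 0; rewrite -normrN; congr (`|_| <= _).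
have -> : imx z *m A *m imx b = imx (q *: z) *m A *m w.
  by rewrite -qw map_mxZ /= -!scalemxAl -scalemxAr.
have e : ((imx v : 'rV[R]_1) 0 0) = (imx z2 *m w) 0 0 by rewrite hz2 mxE.
rewrite /value mulmxBl; move: (imx z2 *m w) (imx (q *: z) *m A *m w) (imx v : 'rV[R]_1) e => U V W e.
by rewrite !mxE e; ring.
Qed.

(** Density and thinness are compatible at the same scale: since [2 ^ h] beats every power of [h],
    the thin gap exceeds the required multiple of [G]. The shift [e] makes room for vectors of size
    [4 * C1 * r]. *)
Lemma direction_scale (c1 C1 : R) (kappa : nat) : 0 < c1 -> c1 <= C1 ->
  exists (C : R) (H : nat), forall h, (H <= h)%N -> forall r,
  `|q|%:~R * 2 ^+ h <= c1 * r -> c1 * r <= `|q|%:~R * 2 ^+ h.+1 ->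
  exists G : R, [/\ 0 < G,
   forall y, exists (z1 : 'rV[int]_d) (z2 : 'rV[int]_n),
     (forall i, `|z1 0 i|%:~R <= c1 * r) /\ `|value z1 z2 - y| <= G,
   forall s : seq R, uniq s -> (forall x, x \in s -> small_values A w (2 * C1 * r) G x) ->
     (size s)%:R <= C * psi h
   & forall (z1 : 'rV[int]_d) (z2 : 'rV[int]_n), (forall i, `|z1 0 i|%:~R <= 4 * C1 * r) ->
     z1 = 0 \/ (exists i, `|z1 0 i| <= (4 * kappa)%N%:Z) -> `|value z1 z2| <= 4 * G ->
     value z1 z2 = 0].
Proof.
move=> c10 c1C1.
have q1 : 1 <= `|q|%:~R :> R by rewrite ler1z -gtz0_ge1 normr_gt0.
have C10 : 0 < C1 by apply: lt_le_trans c1C1.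
pose C3 := 16 * C1 * `|q|%:~R / c1 + 1.
have C30 : 0 <= C3 by rewrite addr_ge0 // divr_ge0 ?(ltW c10) // !mulr_ge0 ?(ltW C10) // ler0z.
have [e e0 he] := nat_above (8 * C1 * `|q|%:~R / c1).
have [Hd hd] := dense_b.
have [Ht ht] := thin_b (4 * kappa).
(* The power 5 is 3 for [psi], by [psi_le], and 2 for the square in [thin_gap]. *)
have [H1 hH1] := @exp_beats_poly R 1 (10 * `|q|%:~R * 2 ^+ (e * d.-1)) e.+1 5 ltr01.
exists (10 * C3 ^+ d * (10 * `|q|%:~R + 3)), (maxn Hd (maxn Ht (maxn H1 1))) => h.
rewrite !geq_max => /and4P[hHd hHt hH h1] r qr rq.
have {hH} := hH1 _ hH; rewrite (_ : 1 + 1 = 2) // => hH.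
have r0 : 0 < r.
  rewrite -(pmulr_rgt0 _ c10); apply: lt_le_trans qr; rewrite mulr_gt0 ?exprn_gt0 //.
  exact: lt_le_trans q1.
have two_d : 2 ^+ (h * d) = 2 ^+ (h * d.-1) * 2 ^+ h :> R.
  by rewrite -exprD -mulnSr prednK.
have p0 : 0 < psi h :> R by exact: psi_gt0.
have P (m : nat) : 0 < 2 ^+ m :> R by rewrite exprn_gt0.
have P1 (m : nat) : 1 <= 2 ^+ m :> R by rewrite exprn_ege1 // ler1n.
have hG : 10 * `|q|%:~R * 2 ^+ (e * d.-1) * (h + e.+1)%:R ^+ 2 * psi h < 2 ^+ h :> R.
  apply: le_lt_trans hH.
  rewrite -[leLHS]mulrA ler_wpM2l ?mulr_ge0 ?exprn_ge0 ?ler0z //.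
  rewrite (exprD _ 2 3) ler_wpM2l ?exprn_ge0 //.
  apply: le_trans (psi_le h) _; rewrite lerXn2r ?nnegrE // ler_nat addnS ltnS leq_addr //.
have he1 : 1 <= (h + e.+1)%:R ^+ 2 :> R by rewrite exprn_ege1 // ler1n addnS.
set G := cover_radius d h : R.
have G0 : 0 < G by rewrite divr_gt0.
have qG : 10 * `|q|%:~R * G < 1.
  rewrite /G /cover_radius mulrA ltr_pdivrMr // mul1r two_d.
  apply: le_lt_trans (_ : _ <= 10 * `|q|%:~R * 2 ^+ (e * d.-1) * (h + e.+1)%:R ^+ 2 * psi h) _.
    rewrite ler_pM2r // -[leLHS]mulr1 -[leRHS]mulrA ler_wpM2l ?mulr_ge0 ?ler0z //.
    by rewrite -[leLHS]mulr1 ler_pM.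
  by apply: lt_le_trans hG _; rewrite ler_peMl // ltW.
exists G; split => //.
- move=> y; have [z1 [z2 [hz1 hz2]]] := cover_values y (hd _ hHd).
  by exists z1, z2; split => // i; apply: le_trans (hz1 i) qr.
- move=> s us hs.
  (* As [10 * G < 1], truncation at most halves: [T >= 1 / (10 G)]. The count is then of order
     [2 ^ (h d) * G], which is [psi h]. *)
  pose T := Num.truncn (5 * G)^-1.
  have G50 : 0 < 5 * G by rewrite mulr_gt0.
  have G5 : 10 * G < 1.
    by apply: le_lt_trans qG; rewrite ler_pM2r // ler_peMr.
  have G10 : 0 < 10 * G by rewrite mulr_gt0.
  have T2 : 1 <= (10 * G)^-1.
    by rewrite -(ler_pM2l G10) mulr1 divff ?gt_eqF // ltW.
  have eT : (5 * G)^-1 = 2 * (10 * G)^-1 by field; rewrite gt_eqF.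
  have i0 : 0 <= (5 * G)^-1 by rewrite invr_ge0 ltW.
  have /andP[t1 t2] := truncn_itv i0; rewrite -/T -[T.+1%:R]natr1 in t1 t2.
  have TG : 5 * G * T%:R <= 1 by rewrite mulrC -ler_pdivlMr // mul1r.
  have B0 : 0 <= 2 * C1 * r by rewrite !mulr_ge0 // ltW.
  have cov y : exists (z1 : 'rV[int]_d) (z2 : 'rV[int]_n),
     (forall i, `|z1 0 i|%:~R <= 2 * C1 * r) /\ `|value z1 z2 - y| <= G.
    have [z1 [z2 [hz1 hz2]]] := cover_values y (hd _ hHd).
    exists z1, z2; split => // i; apply: le_trans (hz1 i) (le_trans qr _).
    rewrite ler_pM2r //; apply: le_trans c1C1 _; lra.
  have K := card_small_values q0 qw B0 G0 TG cov us hs.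
  have TG2 : (10 * G)^-1 <= T%:R.
    by move: (10 * G)^-1 (5 * G)^-1 T2 eT t2 => x y; lra.
  have hB : 4 * (2 * C1 * r) + 1 <= C3 * 2 ^+ h.
    rewrite /C3 [leRHS]mulrDl mul1r lerD // [leRHS]mulrAC ler_pdivlMr //.
    have := rq; rewrite exprS => rq2.
    have : 8 * C1 * (c1 * r) <= 8 * C1 * (`|q|%:~R * (2 * 2 ^+ h)) by rewrite ler_pM2l // mulr_gt0.
    rewrite (_ : 8 * C1 * (`|q|%:~R * (2 * 2 ^+ h)) = 16 * C1 * `|q|%:~R * 2 ^+ h); last by ring.
    by rewrite (_ : 8 * C1 * (c1 * r) = 4 * (2 * C1 * r) * c1) //; ring.
  have hB0 : 0 <= 4 * (2 * C1 * r) + 1 by lra.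
  have Q3 : 0 <= 10 * `|q|%:~R + 3 :> R by lra.
  have : (size s)%:R * (10 * G)^-1 <= (C3 * 2 ^+ h) ^+ d * (10 * `|q|%:~R + 3).
    apply: le_trans (_ : (size s)%:R * T%:R <= _); first by rewrite ler_wpM2l.
    by apply: le_trans K _; rewrite ler_wpM2r // lerXn2r // nnegrE mulr_ge0 // ltW.
  rewrite (ler_pdivrMr _ _ G10) => /le_trans; apply.
  rewrite le_eqVlt; apply/orP; left; apply/eqP.
  rewrite exprMn -exprM /G /cover_radius.
  have hne : 2 ^+ (h * d) != 0 :> R by rewrite gt_eqF.
  by move: (2 ^+ (h * d)) (psi h) (C3 ^+ d) (`|q|%:~R) hne => x y u v hne; field.
move=> z1 z2 hz1 hz hv.
have qv : `|q%:~R * value z1 z2| <= `|q|%:~R * (4 * G).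
  by rewrite normrM -intr_norm ler_wpM2l // ler0z.
rewrite (q_value _ qw) in qv.
(* For [z1 = 0] thinness says nothing, but [q] times the value is an integer of absolute value below
   1. *)
have [z10|z10] := eqVneq z1 0.
  have : q%:~R * value z1 z2 = 0.
    rewrite (q_value _ qw) z10 map_mx0 !mul0mx [X in _ - X]mxE subr0.
    rewrite z10 map_mx0 !mul0mx [X in _ - X]mxE subr0 -intr_norm in qv.
    have : `|(z2 *m b) 0 0|%:~R < 1%:~R :> R.
      by apply: le_lt_trans qv _; move: (`|q|%:~R : R) qG => x; nra.
    by rewrite ltr_int => /norm_int_lt1 ->.
  by move/eqP; rewrite mulf_eq0 intr_eq0 (negbTE q0) => /eqP.
exfalso; case: hz => [/eqP|hz]; first by rewrite (negbTE z10).
have bz i : `|z1 0 i| <= (2 ^ (h + e))%N%:Z.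
  rewrite -(@ler_int R) -pmulrn natrX exprD; apply: le_trans (hz1 i) _.
  apply: le_trans (_ : e%:R * 2 ^+ h <= _); last first.
    by rewrite mulrC ler_pM2l // -natrX ler_nat ltnW // ltn_expl.
  apply: le_trans (_ : 8 * C1 * `|q|%:~R / c1 * 2 ^+ h <= _); last by rewrite ler_pM2r.
  rewrite [leRHS]mulrAC ler_pdivlMr //.
  have : 4 * C1 * (c1 * r) <= 4 * C1 * (`|q|%:~R * 2 ^+ h.+1) by rewrite ler_pM2l // mulr_gt0.
  rewrite exprS (_ : 4 * C1 * (`|q|%:~R * (2 * 2 ^+ h)) = 8 * C1 * `|q|%:~R * 2 ^+ h); last by ring.
  by rewrite (_ : 4 * C1 * (c1 * r) = 4 * C1 * r * c1) //; ring.
have hte : (Ht <= h + e)%N by rewrite (leq_trans hHt) // leq_addr.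
have := ht _ hte z1 z10 bz hz ((z2 *m b) 0 0).
rewrite distrC => /le_trans /(_ qv); apply/negP; rewrite -ltNge.
rewrite /thin_gap mulnDl exprD -addnS -[ltRHS]mul1r ltr_pdivlMr ?mulr_gt0 ?exprn_gt0 ?ltr0n ?addnS //.
rewrite -addnS; move: hG; rewrite /G /cover_radius two_d.
have hP := P h; have hP2 := P (h * d.-1)%N.
have E0 := ltW (P (e * d.-1)%N).
have Q0 : 0 <= `|q|%:~R :> R by rewrite ler0z.
move: (2 ^+ h) (2 ^+ (h * d.-1)) (2 ^+ (e * d.-1)) (psi h) ((h + e.+1)%:R ^+ 2) (`|q|%:~R : R) hP hP2 E0 Q0 he1 p0.
move=> x y u v s Q x0 y0 u0 Q0 s1 v0 hx.
rewrite (_ : Q * (4 * (v / (y * x))) * (y * u * s) = 4 * (Q * u * s * v) / x); last first.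
  by field; rewrite !gt_eqF.
rewrite ltr_pdivrMr // mul1r; apply: le_lt_trans hx.
have : 0 <= Q * u * s * v by rewrite !mulr_ge0 // ?(ltW v0) // (le_trans ler01).
by rewrite -!mulrA; move: (Q * _) => t; lra.
Qed.

End DirectionScale.

(** * Geometry of the strip *)

Section VectorNorm.
Context {R : realType}.

Lemma vnorm_ge0 m (v : 'rV[R]_m) : 0 <= vnorm v.
Proof. by rewrite /vnorm; elim/big_ind: _ => // x y x0 y0; rewrite le_max x0. Qed.

Lemma coord_le_vnorm m (v : 'rV[R]_m) i : `|v 0 i| <= vnorm v.
Proof. by rewrite /vnorm (bigD1 i) //= le_max lexx. Qed.

Lemma vnorm_le m (v : 'rV[R]_m) B : 0 <= B -> (forall i, `|v 0 i| <= B) -> vnorm v <= B.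
Proof.
move=> B0 h; rewrite /vnorm; elim/big_ind: _ => // x y xB yB.
by rewrite ge_max xB.
Qed.

Lemma vnormD m (u v : 'rV[R]_m) : vnorm (u + v) <= vnorm u + vnorm v.
Proof.
apply: vnorm_le => [|i]; first by rewrite addr_ge0 // vnorm_ge0.
by rewrite mxE (le_trans (ler_normD _ _)) // lerD // coord_le_vnorm.
Qed.

Lemma vnormN m (v : 'rV[R]_m) : vnorm (- v) = vnorm v.
Proof. by rewrite /vnorm; apply: eq_bigr => i _; rewrite mxE normrN. Qed.

Lemma vnorm_mulmx m n (Q : 'M[R]_(m, n)) :
  exists2 C : R, 0 <= C & forall v, vnorm (v *m Q) <= C * vnorm v.
Proof.
exists (\sum_i \sum_j `|Q i j|); first by apply: sumr_ge0 => i _; apply: sumr_ge0.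
move=> v; apply: vnorm_le => [|j].
  by rewrite mulr_ge0 ?vnorm_ge0 // sumr_ge0 // => i _; rewrite sumr_ge0.
rewrite mxE mulr_suml; apply: le_trans (ler_norm_sum _ _ _) _.
apply: ler_sum => i _; rewrite normrM mulrC ler_pM ?coord_le_vnorm //.
by rewrite (bigD1 j) //= lerDl sumr_ge0.
Qed.

Lemma intvec_imx m (v : 'rV[R]_m) : intvec v <-> exists z : 'rV[int]_m, v = imx z.
Proof.
split => [/choice[f hf]|[z ->] i]; last by exists (z 0 i); rewrite mxE.
by exists (\row_i f i); apply/rowP => i; rewrite !mxE.
Qed.

Lemma intvecD m (u v : 'rV[R]_m) : intvec u -> intvec v -> intvec (u + v).
Proof. by move=> /intvec_imx[x ->] /intvec_imx[y ->]; apply/intvec_imx; exists (x + y); rewrite map_mxD. Qed.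

Lemma intvecN m (u : 'rV[R]_m) : intvec u -> intvec (- u).
Proof. by move=> /intvec_imx[x ->]; apply/intvec_imx; exists (- x); rewrite map_mxN. Qed.

End VectorNorm.

Section Geometry.
Context {R : realType} {d k : nat}.
Local Notation n := (k - d)%N.
Local Notation V := 'rV[R]_(d + n).
Variables (A : 'M[R]_(d, n)) (Wm : 'M[R]_n).
Hypothesis HW : int_generators Wm.

(** The difference is the projection of [p] to [F] along [E]; [invmx Wm] passes to the basis of
    edges, the rows of [Wm]. *)
Definition window_coord (p : V) : 'rV[R]_n := (rsubmx p - lsubmx p *m A) *m invmx Wm.
Local Notation tau := window_coord.

Lemma Wm_unit : Wm \in unitmx.
Proof. by case: HW => _; rewrite row_free_unit. Qed.

Lemma tauD p p' : tau (p + p') = tau p + tau p'.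
Proof. by rewrite /window_coord !linearD /= [_ *m A]mulmxDl opprD addrACA mulmxDl. Qed.

Lemma tauN p : tau (- p) = - tau p.
Proof. by rewrite /window_coord !linearN /= mulNmx opprK addrC -mulNmx opprB. Qed.

Lemma tauB p p' : tau (p - p') = tau p - tau p'.
Proof. by rewrite tauD tauN. Qed.

Definition fiber_shift (v : 'rV[R]_n) : V := row_mx 0 (v *m Wm).

Lemma fiber_shiftE v : fiber_shift v = v *m row_mx (0 : 'M[R]_(n, d)) Wm.
Proof. by rewrite mul_mx_row mulmx0. Qed.

Lemma tau_fiber_shift v : tau (fiber_shift v) = v.
Proof. by rewrite /window_coord row_mxKl row_mxKr mul0mx subr0 mulmxK // Wm_unit. Qed.

Lemma intvec_fiber_shift (v : 'rV[int]_n) : intvec (fiber_shift (imx v)).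
Proof.
have [hW _] := HW.
move=> i; rewrite /fiber_shift; case: (splitP i) => j ij.
  have -> : i = lshift _ j by apply: val_inj.
  by exists 0; rewrite row_mxEl mxE.
have -> : i = rshift _ j by apply: val_inj.
rewrite row_mxEr mxE.
have /choice[g hg] : forall l, exists z : int, Wm l j = z%:~R by move=> l; apply: hW.
exists (\sum_l v 0 l * g l); rewrite rmorph_sum; apply: eq_bigr => l _.
by rewrite mxE hg rmorphM.
Qed.

Lemma Emx_Fmx_cap0 : (Emx A :&: @Fmx R d k = 0)%MS.
Proof.
apply/eqP; rewrite -submx0; apply/rV_subP => v; rewrite sub_capmx !genmxE => /andP[/submxP[x vE] /submxP[y vF]].
have := vE; rewrite vF !mul_mx_row mulmx0 !mulmx1 => /eq_row_mx[x0 yA].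
by rewrite yA -x0 mul0mx row_mx0 sub0mx.
Qed.

Lemma decomp (p : V) : p = row_mx (lsubmx p) (lsubmx p *m A) + row_mx 0 (rsubmx p - lsubmx p *m A).
Proof. by rewrite add_row_mx addr0 addrC subrK hsubmxK. Qed.

Lemma graph_sub_Emx (x : 'rV[R]_d) : (row_mx x (x *m A) <= Emx A)%MS.
Proof. by rewrite genmxE; apply/submxP; exists x; rewrite mul_mx_row mulmx1. Qed.

Lemma fiber_sub_Fmx (y : 'rV[R]_n) : (row_mx 0 y <= @Fmx R d k)%MS.
Proof. by rewrite genmxE; apply/submxP; exists y; rewrite mul_mx_row mulmx1 mulmx0. Qed.

Lemma pi2E (p : V) : pi2 A p = row_mx (lsubmx p) (lsubmx p *m A).
Proof.
rewrite /pi2 {1}(decomp p) mulmxDl (proj_mx_id Emx_Fmx_cap0 (graph_sub_Emx _)).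
by rewrite (proj_mx_0 Emx_Fmx_cap0 (fiber_sub_Fmx _)) addr0.
Qed.

Lemma pistarE (p : V) : pistar A p = row_mx 0 (rsubmx p - lsubmx p *m A).
Proof.
have cap : (@Fmx R d k :&: Emx A = 0)%MS by rewrite capmxC Emx_Fmx_cap0.
rewrite /pistar {1}(decomp p) mulmxDl (proj_mx_id cap (fiber_sub_Fmx _)).
by rewrite (proj_mx_0 cap (graph_sub_Emx _)) add0r.
Qed.

Lemma stripE (p : V) : strip A (parallelotope Wm) p <-> forall j, 0 <= tau p 0 j <= 1.
Proof.
rewrite /strip /parallelotope /= pistarE; split => [[t [ht /eq_row_mx[_ e]]] j|h].
  by rewrite /window_coord e mulmxK ?Wm_unit.
by exists (tau p); split => //; rewrite /window_coord mulmxKV ?Wm_unit.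
Qed.

Variable s : V.
Hypothesis Hreg : regular A (parallelotope Wm) s.

Definition lattice_coset (p : V) : Prop := intvec (p - s).
Local Notation orbit := lattice_coset.

Lemma orbitD p z : orbit p -> intvec z -> orbit (p + z).
Proof. by rewrite /lattice_coset addrAC; exact: intvecD. Qed.

Lemma orbitB p p' : orbit p -> orbit p' -> intvec (p - p').
Proof.
move=> hp hp'; have -> : p - p' = (p - s) - (p' - s) by rewrite opprB addrA subrK.
by apply: intvecD => //; apply: intvecN.
Qed.

(** A lattice vector folds all coordinates into the window and sends an integral one to 0; the point
    would then lie on a face of the strip, against regularity. *)
Lemma tau_notint p j (m : int) : orbit p -> tau p 0 j <> m%:~R.
Proof.
move=> op tj.
pose v : 'rV[int]_n := \row_i (if i == j then m else Num.floor (tau p 0 i)).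
pose p' := p - fiber_shift (imx v).
have op' : orbit p' by apply: orbitD => //; apply/intvecN/intvec_fiber_shift.
have tp' i : tau p' 0 i = tau p 0 i - (v 0 i)%:~R.
  by rewrite /p' tauB tau_fiber_shift !mxE.
have tp'j : tau p' 0 j = 0 by rewrite tp' tj mxE eqxx subrr.
have st : strip A (parallelotope Wm) p'.
  apply/stripE => i; have [->|ij] := eqVneq i j; first by rewrite tp'j lexx ler01.
  rewrite tp' [v 0 i]mxE (negbTE ij); have := floor_itv (tau p 0 i); rewrite intrD => /andP[h1 h2].
  by apply/andP; split; lra.
apply: (Hreg op') => delta delta0; split.
  by exists p'; split => //; rewrite subrr; apply: le_lt_trans delta0; apply: vnorm_le => // i; rewrite mxE normr0.
have [C C0 hC] := vnorm_mulmx (row_mx (0 : 'M[R]_(n, d)) Wm).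
pose e := delta / (2 * (C + 1)).
have e0 : 0 < e by rewrite divr_gt0 // mulr_gt0 // ltr_wpDl.
(* Pushing the point out through the face [j] by [e] leaves the strip while moving less than
   [delta]. *)
exists (p' - fiber_shift (e *: delta_mx (0 : 'I_1) j)); split.
  rewrite addrAC subrr add0r vnormN fiber_shiftE.
  apply: le_lt_trans (hC _) _.
  apply: le_lt_trans (_ : _ <= C * e) _.
    rewrite ler_wpM2l // vnorm_le ?(ltW e0) // => i; rewrite !mxE /=.
    by case: (i == j); rewrite ?mulr1 ?mulr0 ?normr0 ?gtr0_norm // ltW.
  rewrite /e mulrA ltr_pdivrMr ?mulr_gt0 ?ltr_wpDl //.
  by rewrite mulrC ltr_pM2l //; lra.
have tq : tau (p' - fiber_shift (e *: delta_mx (0 : 'I_1) j)) 0 j = tau p' 0 j - e.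
  by rewrite tauB tau_fiber_shift; move: (tau p') => u; rewrite !mxE !eqxx /= mulr1.
move/stripE => /(_ j); rewrite tq tp'j sub0r => /andP[].
by rewrite oppr_ge0 leNgt e0.
Qed.

Lemma orbit_strip p : orbit p -> strip A (parallelotope Wm) p <-> forall j, 0 < tau p 0 j < 1.
Proof.
move=> op; split => [/stripE h j|h]; last first.
  by apply/stripE => j; have /andP[h1 h2] := h j; rewrite !ltW.
have /andP[h1 h2] := h j; rewrite !lt_neqAle h1 h2 !andbT; apply/andP; split; apply/eqP => e.
  by apply: (@tau_notint p j 0).
by apply: (@tau_notint p j 1).
Qed.

Variable F0 : 'M[R]_(d + n).
Hypothesis HF0 : admissible_F0 A F0.

Lemma pi1D p p' : pi1 A F0 (p + p') = pi1 A F0 p + pi1 A F0 p'.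
Proof. by rewrite /pi1 mulmxDl. Qed.

Lemma pi1N p : pi1 A F0 (- p) = - pi1 A F0 p.
Proof. by rewrite /pi1 mulNmx. Qed.

Lemma pi1B p p' : pi1 A F0 (p - p') = pi1 A F0 p - pi1 A F0 p'.
Proof. by rewrite pi1D pi1N. Qed.

Lemma cap_EF0 : (Emx A :&: F0 = 0)%MS.
Proof. by have [_ [h _]] := HF0; apply/eqP; rewrite -submx0 (eqmxP h). Qed.

Lemma pi1_inj_int z : intvec z -> pi1 A F0 z = 0 -> z = 0.
Proof.
move=> iz z0; have [h1 [_ h3]] := HF0; apply: h3 => //.
have zs : (z <= Emx A + F0)%MS by rewrite (eqmxP h1) submx1.
rewrite -(add_proj_mx cap_EF0 zs); move: z0; rewrite /pi1 => ->.
by rewrite add0r proj_mx_sub.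
Qed.

Lemma pi1_inj p p' : orbit p -> orbit p' -> pi1 A F0 p = pi1 A F0 p' -> p = p'.
Proof.
move=> op op' e; apply/eqP; rewrite -subr_eq0; apply/eqP/pi1_inj_int; first exact: orbitB.
by rewrite pi1B e subrr.
Qed.

Lemma pi1E p : pi1 A F0 p = row_mx (lsubmx p) (lsubmx p *m A) + pi1 A F0 (fiber_shift (tau p)).
Proof.
rewrite {1}(decomp p) /pi1 mulmxDl (proj_mx_id cap_EF0 (graph_sub_Emx _)).
by rewrite /fiber_shift /window_coord mulmxKV ?Wm_unit.
Qed.

Lemma pi1_graph p : pi1 A F0 p = row_mx (lsubmx (pi1 A F0 p)) (lsubmx (pi1 A F0 p) *m A).
Proof.
have : (pi1 A F0 p <= Emx A)%MS by rewrite /pi1 proj_mx_sub.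
by rewrite genmxE => /submxP[x ->]; rewrite mul_mx_row mulmx1 row_mxKl.
Qed.

(** The projections along [F0] and along [F] differ by a linear function of [tau], which is bounded
    on the strip. *)
Lemma lsub_pi1_bound : exists2 C : R, 0 <= C & forall p i,
  `|lsubmx (pi1 A F0 p) 0 i - lsubmx p 0 i| <= C * vnorm (tau p).
Proof.
have [C C0 hC] := vnorm_mulmx (row_mx (0 : 'M[R]_(n, d)) Wm *m proj_mx (Emx A) F0).
exists C => // p i.
have -> : lsubmx (pi1 A F0 p) 0 i - lsubmx p 0 i = pi1 A F0 (fiber_shift (tau p)) 0 (lshift _ i).
  by rewrite pi1E linearD /= row_mxKl mxE addrAC subrr add0r mxE.
apply: le_trans (coord_le_vnorm _ _) _; rewrite /pi1 fiber_shiftE -mulmxA; exact: hC.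
Qed.

(** A point is recovered linearly from [pi1] and [tau]; hence strip points with bounded projection
    are bounded, and counts are finite. *)
Lemma vnorm_bound : exists2 C : R, 0 <= C & forall p, vnorm p <= vnorm (pi1 A F0 p) + C * vnorm (tau p).
Proof.
have [C C0 hC] := vnorm_mulmx (row_mx (0 : 'M[R]_(n, d)) Wm *m (1%:M - proj_mx (Emx A) F0)).
exists C => // p.
have e : p = pi1 A F0 p + tau p *m (row_mx (0 : 'M[R]_(n, d)) Wm *m (1%:M - proj_mx (Emx A) F0)).
  rewrite mulmxA -fiber_shiftE mulmxBr mulmx1 -/(pi1 A F0 (fiber_shift (tau p))).
  rewrite pi1E -addrA [X in _ + X]addrC subrK {1}(decomp p); congr (_ + _).
  by rewrite /fiber_shift /window_coord mulmxKV ?Wm_unit.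
rewrite {1}e; apply: le_trans (vnormD _ _) _; rewrite lerD2l; exact: hC.
Qed.

End Geometry.

(** * Comparison of frequencies *)

Section FiniteCounts.
Context {R : realType} {d k : nat}.
Local Notation V := 'rV[R]_(d + (k - d)).
Local Notation count := (@Defs.count R d k).

Lemma finite_enum (X : set V) : finite_set X ->
  exists l : seq V, [/\ uniq l, forall x, x \in l <-> X x & size l = count X].
Proof.
move=> fX; exists (enum_fset (fset_set X)); split => //; first exact: fset_uniq.
move=> x; rewrite -[x \in _]/(x \in fset_set X) in_fset_set //; split; first by rewrite inE.
by move=> Xx; rewrite inE.
Qed.

Lemma finite_of_inj (J : finType) (X : set V) (f : V -> J) :
  (forall x y, X x -> X y -> f x = f y -> x = y) -> finite_set X /\ (count X <= #|J|)%N.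
Proof.
move=> finj.
pose g (j : J) : V := xget 0 [set x | X x /\ f x = j].
have gK x : X x -> g (f x) = x.
  by move=> Xx; rewrite /g; case: xgetP => [y _ [Xy] /finj -> //|/(_ x)[]].
have fX : finite_set X.
  apply: (@sub_finite_set _ X (g @` [set: J])); last exact/finite_image/finite_finset.
  by move=> x Xx; exists (f x) => //; exact: gK.
split => //; have [l [ul lX <-]] := finite_enum fX.
rewrite cardE -(size_map f); apply: uniq_leq_size; last by move=> j _; rewrite mem_enum.
by rewrite map_inj_in_uniq // => x y /lX Xx /lX Xy; apply: finj.
Qed.

Lemma count_le_inj (I : finType) (X X' : set V) (g : I -> V -> V) :
  finite_set X -> finite_set X' -> (forall i x, X x -> X' (g i x)) ->
  (forall i x i' x', X x -> X x' -> g i x = g i' x' -> i = i' /\ x = x') ->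
  (#|I| * count X <= count X')%N.
Proof.
move=> /finite_enum[l [ul lX <-]] /finite_enum[l' [ul' lX' <-]] gX ginj.
rewrite cardE -(size_allpairs g); apply: uniq_leq_size.
  apply: allpairs_uniq => //; first exact: enum_uniq.
  move=> [i x] [i' x'] /allpairsP[[a y] /= [_ /lX Xy [-> ->]]] /allpairsP[[a' y'] /= [_ /lX Xy' [-> ->]]] /= e.
  by have [-> ->] := ginj _ _ _ _ Xy Xy' e.
by move=> y /allpairsP[[i x] /= [_ /lX Xx ->]]; apply/lX'/gX.
Qed.

Lemma count_sub (X X' : set V) : finite_set X' -> X `<=` X' -> (count X <= count X')%N.
Proof.
move=> fX' XX'; have fX := sub_finite_set XX' fX'.
by rewrite -[count X]mul1n -card_unit; apply: (count_le_inj (g := fun=> id)) => // [] [] x [] x'.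
Qed.

Lemma count_cover (I : eqType) (s : seq I) (X X0 : set V) (B : I -> set V) :
  finite_set X -> X `<=` X0 `|` [set x | exists2 i, i \in s & B i x] ->
  (count X <= count (X `&` X0) + \sum_(i <- s) count (X `&` B i))%N.
Proof.
move=> fX XB; have fXI Y : finite_set (X `&` Y) by exact: finite_setIl.
have [l [ul lX <-]] := finite_enum fX.
have [l0 [ul0 lX0 <-]] := finite_enum (fXI X0).
have /choice[m hm] i := finite_enum (fXI (B i)).
apply: (@leq_trans (size (l0 ++ flatten [seq m i | i <- s]))).
  apply: uniq_leq_size => // x /lX Xx; rewrite mem_cat.
  have [X0x|[i is_ Bx]] := XB x Xx; first by apply/orP; left; apply/lX0.
  apply/orP; right; apply/flatten_mapP; exists i => //.
  by have [_ h _] := hm i; apply/h.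
rewrite size_cat size_flatten sumnE /shape big_map big_map leq_add2l.
by apply: leq_sum => i _; have [_ _ ->] := hm i.
Qed.

End FiniteCounts.

Lemma slab_close {R : realType} (x om a a' b b' e e' : R) :
  `|a - x| <= om -> `|a' - x| <= om -> `|b - e| < om -> `|b' - e'| < om ->
  `|a + b - (a' + b') - (e - e')| < 4 * om.
Proof.
rewrite !ltr_norml !ler_norml => /andP[? ?] /andP[? ?] /andP[? ?] /andP[? ?].
by apply/andP; split; lra.
Qed.

Lemma small_diff {R : realType} (a b b' om : R) : `|a - (b - b')| < 4 * om ->
  0 <= b <= 2^-1 -> 0 <= b' <= 2^-1 -> om <= 8^-1 -> `|a| < 1.
Proof.
rewrite !ltr_norml => /andP[? ?] /andP[? ?] /andP[? ?] ?.
by apply/andP; split; lra.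
Qed.

Lemma floor_sum_bound {R : realType} (a b f om : R) : 0 <= a <= 1 -> `|b - f| < om ->
  0 <= f <= 2^-1 -> om <= 8^-1 -> `|(Num.floor (a + b))%:~R : R| <= 3.
Proof.
move=> /andP[? ?]; rewrite ltr_norml => /andP[? ?] /andP[? ?] ?.
have := floor_itv (a + b); rewrite intrD => /andP[? ?].
by rewrite ler_norml; apply/andP; split; lra.
Qed.

Lemma ord_close {R : realType} (M : nat) (i i' : 'I_M) (c : R) :
  0 < c -> `|c * (i%:R - i'%:R)| < c -> i = i'.
Proof.
move=> c0; rewrite normrM gtr0_norm // gtr_pMr // => h.
apply: val_inj; apply: contrapT => /eqP; rewrite neq_ltn => /orP[] hlt; move: h; rewrite ltNge.
  by rewrite distrC ger0_norm ?subr_ge0 ?ler_nat ?(ltnW hlt) // lerBrDr nat1r ler_nat hlt.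
by rewrite ger0_norm ?subr_ge0 ?ler_nat ?(ltnW hlt) // lerBrDr nat1r ler_nat hlt.
Qed.

Section Frequency.
Context {R : realType} {d k : nat}.
Hypothesis dk : (d < k)%N.
Local Notation n := (k - d)%N.
Local Notation V := 'rV[R]_(d + n).
Local Notation count := (@Defs.count R d k).
Variables (A : 'M[R]_(d, n)) (Wm : 'M[R]_n) (F0 : 'M[R]_(d + n)) (s : V).
Hypothesis HW : int_generators Wm.
Hypothesis HF0 : admissible_F0 A F0.
Hypothesis Hreg : regular A (parallelotope Wm) s.
Hypothesis Hdense : forall eps : R, 0 < eps -> exists Z, dense_orbit 1%:M Z eps A.
Local Notation tau := (window_coord A Wm).
Local Notation strip := (strip A (parallelotope Wm)).
Local Notation pi1 := (pi1 A F0).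
Local Notation orbit := (lattice_coset s).

Lemma window_coordD_coord p q l : tau (p + q) 0 l = tau p 0 l + tau q 0 l.
Proof. by rewrite tauD mxE. Qed.

(** Counting is done on lifts, where lattice translations act; injectivity of [pi1] transfers the
    counts to the cut and project set. *)
Definition selected (D : V -> Prop) (rad : R) : set V :=
  [set p | orbit p /\ strip p /\ D p /\ vnorm (pi1 p) <= rad].

Definition total (rad : R) : nat := count (selected (fun=> True) rad).

(** The crude degree [k] is enough: the bound serves for finiteness and to exclude exponential
    growth. *)
Lemma selected_bound : exists C : R, [/\ 0 <= C & forall D rad, 0 <= rad ->
  finite_set (selected D rad) /\ (count (selected D rad))%:R <= (C * (rad + 1)) ^+ k].
Proof.
have [C C0 hC] := vnorm_bound HW HF0.
pose B rad := rad + C + vnorm s.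
have B0 rad : 0 <= rad -> 0 <= B rad by move=> h; rewrite !addr_ge0 // vnorm_ge0.
have key D p rad i : selected D rad p -> `|(p - s) 0 i| <= B rad.
  move=> [op [st [_ pr]]]; apply: le_trans (coord_le_vnorm _ _) _.
  apply: le_trans (vnormD _ _) _; rewrite vnormN lerD2r; apply: le_trans (hC p) _.
  apply: lerD => //; rewrite -[leRHS]mulr1 ler_wpM2l //; apply: vnorm_le => // j.
  by have /stripE := st => /(_ HW j) /andP[h1 h2]; rewrite ger0_norm.
exists (2 * (C + vnorm s) + 3); split => [|D rad rad0].
  by rewrite !addr_ge0 // mulr_ge0 // addr_ge0 // vnorm_ge0.
pose N := Num.truncn (B rad).
pose f (p : V) : {ffun 'I_(d + n) -> 'I_(2 * N).+1} :=
  [ffun i => inord (absz (Num.floor ((p - s) 0 i) + N%:Z))].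
have hf p i : selected D rad p -> exists2 z : int, (p - s) 0 i = z%:~R & (f p i : nat)%:Z - N%:Z = z.
  move=> sp; have [op _] := sp; have [z hz] := op i; exists z => //.
  rewrite ffunE hz intrKfloor.
  have zN : `|z| <= N%:Z.
    have := key _ _ _ i sp; rewrite hz -intr_norm; case: (`|z|%R) (normr_ge0 z) => // m _ hm.
    by rewrite lez_nat truncn_ge_nat // B0.
  by have [h1 h2] := absz_shift zN; rewrite inordK.
have [fin le] : finite_set (selected D rad) /\ (count (selected D rad) <= #|{: {ffun 'I_(d + n) -> 'I_(2 * N).+1}}|)%N.
  apply: (@finite_of_inj _ _ _ _ _ f) => p p' sp sp' ff.
  apply: (addIr (- s)); apply/rowP => i.
  have [z -> <-] := hf p i sp; have [z' -> <-] := hf p' i sp'.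
  by rewrite ff.
split => //; apply: le_trans (_ : (#|{: {ffun 'I_(d + n) -> 'I_(2 * N).+1}}|)%:R <= _).
  by rewrite ler_nat.
have -> : #|{: {ffun 'I_(d + n) -> 'I_(2 * N).+1}}| = ((2 * N).+1 ^ k)%N.
  by rewrite card_ffun !card_ord; congr (_ ^ _)%N; rewrite subnKC // ltnW.
rewrite natrX lerXn2r ?nnegrE //.
  by rewrite mulr_ge0 ?addr_ge0 ?mulr_ge0 ?addr_ge0 ?vnorm_ge0.
have := truncn_le (B rad); rewrite B0 // -/N -natr1 natrM => NB.
have : (B rad) <= (C + vnorm s + 1) * (rad + 1).
  rewrite /B; have := vnorm_ge0 s; move: (vnorm s) => v v0; nra.
have := vnorm_ge0 s; move: (vnorm s) => v v0.
nra.
Qed.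

Lemma finite_selected D rad : finite_set (selected D rad).
Proof.
have [C [C0 h]] := selected_bound.
apply: (@sub_finite_set _ _ (selected D `|rad|)); last by have [] := h D `|rad| (normr_ge0 _).
by move=> p [op [st [Dp pr]]]; do 3!split => //; apply: le_trans pr (ler_norm _).
Qed.

Lemma total_mono rad rad' : rad <= rad' -> (total rad <= total rad')%N.
Proof.
move=> rr; apply: count_sub; first exact: finite_selected.
by move=> p [op [st [_ pr]]]; do 3!split => //; apply: le_trans rr.
Qed.

(* Otherwise [total] would grow exponentially, contradicting [selected_bound]. *)
Lemma slow_growth (R0 c eta M : R) : (0 < total R0)%N -> 0 <= c -> 0 < eta ->
  exists rad, [/\ M <= rad, R0 <= rad & (total (rad + c))%:R <= (1 + eta) * (total rad)%:R].
Proof.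
move=> t0 c0 eta0; apply: contrapT => h.
have [C [C0 hC]] := selected_bound.
pose r0 := `|M| + `|R0|.
have hr0 : 0 <= r0 by rewrite addr_ge0.
have step i : (1 + eta) ^+ i <= (total (r0 + c *+ i))%:R.
  elim: i => [|i IH].
    rewrite mulr0n addr0 expr0 ler1n (leq_trans t0) // total_mono //.
    by rewrite (le_trans (ler_norm _)) // lerDr.
  rewrite exprS mulrS [c + _]addrC addrA; apply: contrapT => /negP; rewrite -ltNge => hlt.
  apply: h; exists (r0 + c *+ i); split.
  - by rewrite -[leLHS]addr0 lerD ?mulrn_wge0 // (le_trans (ler_norm _)) // lerDl.
  - by rewrite -[leLHS]addr0 lerD ?mulrn_wge0 // (le_trans (ler_norm _)) // lerDr.
  by apply: le_trans (ltW hlt) _; rewrite ler_pM2l // addr_gt0.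
have [H hH] := @exp_beats_poly R eta ((C * (r0 + c + 1)) ^+ k) 1 k eta0.
have := hH H (leqnn H); apply/negP; rewrite -leNgt; apply: le_trans (step H) _.
have [_ b] := hC (fun=> True) (r0 + c *+ H) (addr_ge0 hr0 (mulrn_wge0 _ c0)).
apply: le_trans b _; rewrite -exprMn lerXn2r ?nnegrE //.
- by rewrite mulr_ge0 // !addr_ge0 // mulrn_wge0.
- by rewrite !mulr_ge0 // !addr_ge0.
rewrite -mulrA ler_wpM2l // natrD -[c *+ H]mulr_natr.
have : 0 <= H%:R :> R by []; move: (H%:R : R) => x x0; nra.
Qed.

Lemma tau_dense (t : 'rV[R]_n) (eps : R) : 0 < eps ->
  exists2 z : V, intvec z & forall j, `|tau z 0 j - t 0 j| < eps.
Proof.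
move=> eps0; have [C C0 hC] := vnorm_mulmx (invmx Wm).
have e0 : 0 < eps / (C + 1) by rewrite divr_gt0 // ltr_wpDl.
have [Z /(_ (- (t *m Wm)))[z1 _ [v hv]]] := Hdense e0.
exists (row_mx (imx z1) (imx v)); first by apply/intvec_imx; exists (row_mx z1 v); rewrite map_row_mx.
move=> j.
have e : tau (row_mx (imx z1) (imx v)) - t = - (imx z1 *m A *m imx 1%:M - imx v - - (t *m Wm)) *m invmx Wm.
  rewrite /window_coord row_mxKl row_mxKr map_mx1 mulmx1 opprK -[in LHS](mulmxK (Wm_unit HW) t) -mulmxBl.
  by congr (_ *m _); rewrite !opprD opprK [- _ + _]addrC.
have -> : tau (row_mx (imx z1) (imx v)) 0 j - t 0 j = (tau (row_mx (imx z1) (imx v)) - t) 0 j.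
  by rewrite [in RHS]mxE [(- t) 0 j]mxE.
apply: le_lt_trans (coord_le_vnorm _ _) _; rewrite e; apply: le_lt_trans (hC _) _.
apply: le_lt_trans (_ : _ <= C * (eps / (C + 1))) _.
  rewrite ler_wpM2l // vnormN vnorm_le ?(ltW e0) //.
by rewrite mulrA ltr_pdivrMr ?ltr_wpDl // mulrC ltr_pM2l // ltrDl.
Qed.

Definition slab (j : 'I_n) (x om : R) (p : V) : Prop := `|tau p 0 j - x| <= om.

(* If [tau p] lies in a thin slab, the translates of [p] by suitable lattice vectors, folded
   back into the strip, are pairwise distinct: [M] disjoint copies of the slab fit in the window. *)
Lemma slab_small (j : 'I_n) (x eta : R) : 0 < eta ->
  exists om c, [/\ 0 < om, 0 <= c & forall rad,
    (count (selected (slab j x om) rad))%:R <= eta * (total (rad + c))%:R].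
Proof.
move=> eta0; have [M M0 hM] := nat_above eta^-1.
have M0' : 0 < M%:R :> R by rewrite ltr0n.
(* The [M] translates, spaced by [4 * om], occupy half of the unit interval, so that reduction
   modulo 1 cannot confuse two of them. *)
have [om om0 omM] : exists2 om : R, 0 < om & 8 * om * M%:R = 1.
  exists (8 * M%:R)^-1; first by rewrite invr_gt0 mulr_gt0.
  by rewrite invfM mulrA mulfV ?pnatr_eq0 // mul1r mulVf // gt_eqF.
have om4 : 0 < 4 * om by rewrite mulr_gt0.
have /choice[z hz] : forall i : 'I_M, exists z : V, intvec z /\ forall l, `|tau z 0 l - 4 * om * i%:R| < om.
  move=> i; have [z iz hz] := tau_dense (const_mx (4 * om * i%:R)) om0.
  by exists z; split => // l; have := hz l; rewrite [const_mx _ _ _]mxE.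
have [C C0 hC] := vnorm_mulmx (row_mx (0 : 'M[R]_(n, d)) Wm *m proj_mx (Emx A) F0).
pose c := (\sum_(i < M) vnorm (pi1 (z i))) + C * 3.
have c0 : 0 <= c by rewrite addr_ge0 ?mulr_ge0 // sumr_ge0 // => i _; exact: vnorm_ge0.
exists om, c; split => // rad.
pose fl (p : V) : 'rV[int]_n := map_mx Num.floor (tau p).
pose g (i : 'I_M) (p : V) : V := p + z i - fiber_shift Wm (imx (fl (p + z i))).
have tau_g i p l : tau (g i p) 0 l = tau (p + z i) 0 l - (Num.floor (tau (p + z i) 0 l))%:~R.
  by rewrite /g tauB (tau_fiber_shift _ HW) /fl; move: (tau (p + z i)) => u; rewrite !mxE.
have i1 (i : 'I_M) : 0 <= 4 * om * i%:R <= 2^-1.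
  rewrite !mulr_ge0 ?(ltW om0) //=.
  have : 4 * om * i%:R <= 4 * om * M%:R by rewrite ler_pM2l ?mulr_gt0 // ler_nat ltnW.
  have : 4 * om * M%:R = 2^-1 by lra.
  lra.
have om1 : om <= 8^-1.
  have : 8 * om * 1 <= 8 * om * M%:R by rewrite ler_pM2l ?mulr_gt0 // ler1n.
  by rewrite omM; lra.
have count_g : (M * count (selected (slab j x om) rad) <= total (rad + c))%N.
  rewrite -[M in (M * _)%N]card_ord.
  apply: (count_le_inj (g := g)); try exact: finite_selected.
    move=> i p [op [st [_ pr]]].
    have og : orbit (g i p).
      by apply: orbitD; [apply: orbitD => //; case: (hz i)|apply/intvecN/(intvec_fiber_shift HW)].
    split => //; split.
      apply/(stripE _ HW) => l; rewrite tau_g.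
      have := floor_itv (tau (p + z i) 0 l); rewrite intrD.
      by move: (tau _ _ _) (_%:~R) => a b /andP[a1 a2]; apply/andP; split; lra.
    split => //; rewrite /g pi1B pi1D; apply: le_trans (vnormD _ _) _.
    apply: le_trans (lerD (vnormD _ _) (lexx _)) _; rewrite /c -addrA lerD // lerD //.
      by rewrite (bigD1 i) //= lerDl sumr_ge0 // => i' _; exact: vnorm_ge0.
    rewrite vnormN /Defs.pi1 fiber_shiftE -mulmxA; apply: le_trans (hC _) _.
    rewrite ler_wpM2l // vnorm_le // => l.
    have -> : (imx (fl (p + z i)) : 'rV[R]_n) 0 l = (Num.floor (tau p 0 l + tau (z i) 0 l))%:~R.
      by rewrite /fl tauD; move: (tau p) (tau (z i)) => u v; rewrite !mxE.
    have /(stripE _ HW) /(_ l) hp := st; have [_ /(_ l) hzl] := hz i.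
    exact: floor_sum_bound hp hzl (i1 i) om1.
  move=> i p i' p' [op [st [xp _]]] [op' [st' [xp' _]]] gg.
  rewrite /slab in xp xp'.
  have ej : tau p 0 j + tau (z i) 0 j - (tau p' 0 j + tau (z i') 0 j) =
      (Num.floor (tau (p + z i) 0 j) - Num.floor (tau (p' + z i') 0 j))%:~R.
    have := tau_g i p j; rewrite gg tau_g rmorphB /=.
    have := window_coordD_coord p (z i) j; have := window_coordD_coord p' (z i') j.
    move: (tau (p + z i) 0 j) (tau (p' + z i') 0 j) => a b -> ->.
    move: (tau p 0 j) (tau p' 0 j) (tau (z i) 0 j) (tau (z i') 0 j) (_%:~R) (_%:~R) => u v e e' x1 x2 h.
    by lra.
  have [_ /(_ j) hzi] := hz i; have [_ /(_ j) hzi'] := hz i'.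
  have close : `|(tau p 0 j + tau (z i) 0 j - (tau p' 0 j + tau (z i') 0 j)) - 4 * om * (i%:R - i'%:R)| < 4 * om.
    by rewrite mulrBr; apply: slab_close xp xp' hzi hzi'.
  (* Both displacements lie near [[0, 1/2]] and both points in the same slab, so the integers
     removed by folding agree. *)
  have zero : Num.floor (tau (p + z i) 0 j) - Num.floor (tau (p' + z i') 0 j) = 0.
    apply: norm_int_lt1; rewrite -(@ltr_int R) intr_norm -ej.
    by rewrite mulrBr in close; exact: small_diff close (i1 i) (i1 i') om1.
  have ii' : i = i'.
    move: close; rewrite ej zero mulr0z sub0r normrN => close.
    exact: ord_close om4 close.
  split; first exact: ii'.
  rewrite -ii' in gg.
  have fe : fl (p + z i) = fl (p' + z i).
    apply/rowP => l; rewrite [LHS]mxE [RHS]mxE.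
    have tl : tau p 0 l - tau p' 0 l = (Num.floor (tau (p + z i) 0 l) - Num.floor (tau (p' + z i) 0 l))%:~R.
      have := tau_g i p l; rewrite gg tau_g.
      have := window_coordD_coord p (z i) l; have := window_coordD_coord p' (z i) l.
      rewrite rmorphB /=.
      move: (tau (p + z i) 0 l) (tau (p' + z i) 0 l) (tau (z i) 0 l) => a b e -> ->.
      by move: (tau p 0 l) (tau p' 0 l) (_%:~R) (_%:~R) => u v x1 x2 h; lra.
    apply/eqP; rewrite -subr_eq0; apply/eqP/norm_int_lt1; rewrite -(@ltr_int R) intr_norm -tl.
    have /(orbit_strip HW Hreg op) /(_ l) := st; have /(orbit_strip HW Hreg op') /(_ l) := st'.
    move: (tau p 0 l) (tau p' 0 l) => a b /andP[? ?] /andP[? ?].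
    by rewrite ltr_norml; apply/andP; split; lra.
  by move: gg; rewrite /g fe => /addIr /addIr.
have : (M * count (selected (slab j x om) rad))%N%:R <= (total (rad + c))%:R :> R.
  by rewrite ler_nat.
rewrite natrM => h.
rewrite -(@ler_pM2l _ M%:R) //; apply: le_trans h _; rewrite mulrA ler_peMl //.
by rewrite mulrC -ler_pdivrMl // mulr1.
Qed.

End Frequency.

Section FrequencyComparison.
Context {R : realType} {d k : nat}.
Hypothesis dk : (d < k)%N.
Local Notation n := (k - d)%N.
Local Notation V := 'rV[R]_(d + n).
Local Notation count := (@Defs.count R d k).
Variables (A : 'M[R]_(d, n)) (Wm : 'M[R]_n) (F0 : 'M[R]_(d + n)) (s : V).
Hypothesis HW : int_generators Wm.
Hypothesis HF0 : admissible_F0 A F0.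
Hypothesis Hreg : regular A (parallelotope Wm) s.
Hypothesis Hdense : forall eps : R, 0 < eps -> exists Z, dense_orbit 1%:M Z eps A.
Local Notation tau := (window_coord A Wm).
Local Notation strip := (strip A (parallelotope Wm)).
Local Notation pi1 := (pi1 A F0).
Local Notation orbit := (lattice_coset s).
Local Notation selected := (selected A Wm F0 s).
Local Notation total := (total A Wm F0 s).

Definition has_frequency (D : V -> Prop) (f : R) : Prop :=
  forall eps : R, 0 < eps -> exists M : R, forall rad, M <= rad ->
    `|(count (selected D rad))%:R / (total rad)%:R - f| < eps.

(** The factor [3 + |f2| + 2 W] dominates all error terms of [(f2 + eta + W eta) (1 + eta) + eta]
    once [eta <= 1]. *)
Lemma frequency_gap (f1 f2 eta W T T' N1 N2 : R) :
  0 < eta <= 1 -> eta * (3 + `|f2| + 2 * W) <= f1 - f2 -> 0 <= W -> 1 <= T -> 0 < T' ->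
  0 <= N2 -> T' <= (1 + eta) * T -> N1 <= N2 + W * eta * T' ->
  `|N1 / T - f1| < eta -> `|N2 / T' - f2| < eta -> False.
Proof.
move=> /andP[eta0 eta1] gap W0 T1 T'0 N20 TT hN; rewrite !ltr_norml => /andP[h1 _] /andP[h2 h2'].
have T0 : 0 < T by apply: lt_le_trans T1.
have a1 : (f1 - eta) * T < N1 by rewrite -ltr_pdivlMr //; lra.
have a2 : N2 < (f2 + eta) * T' by rewrite -ltr_pdivrMr //; lra.
have f2n : 0 <= f2 + eta.
  have : 0 <= N2 / T' by rewrite divr_ge0 // ltW.
  lra.
have a3 : (f1 - eta) * T < (f2 + eta + W * eta) * T'.
  apply: lt_le_trans a1 _; apply: le_trans hN _; rewrite [leRHS]mulrDl lerD2r; exact: ltW.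
have a4 : (f1 - eta) * T < (f2 + eta + W * eta) * ((1 + eta) * T).
  apply: lt_le_trans a3 _; rewrite ler_wpM2l // addr_ge0 // mulr_ge0 // ltW //.
rewrite mulrA ltr_pM2r // in a4.
have n2 := ler_norm f2; have n3 := normr_ge0 f2.
have e2 : eta * eta <= eta by rewrite ger_pMr.
have e3 : W * (eta * eta) <= W * eta by rewrite ler_wpM2l.
have e4 : eta * f2 <= eta * `|f2| by rewrite ler_pM2l.
have : (f2 + eta + W * eta) * (1 + eta) = f2 + eta * f2 + eta + eta * eta + W * eta + W * (eta * eta) by ring.
have : eta * (3 + `|f2| + 2 * W) = 3 * eta + eta * `|f2| + 2 * (W * eta) by ring.
move: (eta * `|f2|) (eta * f2) (W * eta) (W * (eta * eta)) (eta * eta) ((f2 + eta + W * eta) * (1 + eta)) (eta * (3 + `|f2| + 2 * W)) gap a4 e2 e3 e4.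
move=> x1 x2 x3 x4 x5 x6 x7 *; lra.
Qed.

Lemma min_le_seq (I : eqType) (w : seq I) (om : I -> R) : (forall i, 0 < om i) ->
  exists2 m : R, 0 < m & forall i, i \in w -> m <= om i.
Proof.
move=> om0; elim: w => [|i w [m m0 hm]]; first by exists 1.
exists (Num.min (om i) m); first by rewrite lt_min om0 m0.
by move=> l; rewrite inE => /orP[/eqP ->|/hm h]; rewrite ge_min ?lexx // h orbT.
Qed.

Lemma max_ge_seq (I : eqType) (w : seq I) (c : I -> R) : (forall i, 0 <= c i) ->
  exists2 m : R, 0 <= m & forall i, i \in w -> c i <= m.
Proof.
move=> c0; elim: w => [|i w [m m0 hm]]; first by exists 0.
exists (Num.max (c i) m); first by rewrite le_max m0 orbT.
by move=> l; rewrite inE => /orP[/eqP ->|/hm h]; rewrite le_max ?lexx // h orbT.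
Qed.

(* Translate by a lattice vector [z] with [tau z] close to [t]: points of [D1] then land in [D2]
   unless they lie within [om] of a wall, and those have small density by [slab_small]. *)
Lemma frequency_le (D1 D2 : V -> Prop) (f1 f2 : R) (t : 'rV[R]_n) (walls : seq ('I_n * R)) (p0 : V) :
  orbit p0 -> strip p0 -> has_frequency D1 f1 -> has_frequency D2 f2 ->
  (forall (om : R) p p', 0 < om -> orbit p -> orbit p' -> strip p -> D1 p ->
     (forall j, `|tau p' 0 j - tau p 0 j - t 0 j| < om) ->
     (forall jx, jx \in walls -> om < `|tau p 0 jx.1 - jx.2|) -> strip p' /\ D2 p') ->
  f1 <= f2.
Proof.
move=> op0 st0 h1 h2 close; rewrite leNgt; apply/negP => f21.
pose W : R := (size walls)%:R.
have W0 : 0 <= W by [].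
pose K := 3 + `|f2| + 2 * W.
have K0 : 0 < K.
  by rewrite /K -addrA ltr_pwDl // addr_ge0 // mulr_ge0.
pose eta := Num.min 1 ((f1 - f2) / K).
have eta0 : 0 < eta by rewrite lt_min ltr01 divr_gt0 // subr_gt0.
have eta1 : eta <= 1 by rewrite ge_min lexx.
have gap : eta * K <= f1 - f2 by rewrite -ler_pdivlMr // ge_min lexx orbT.
have /choice[omf /choice[cf hf]] : forall jx : 'I_n * R, exists om, exists c, [/\ 0 < om, 0 <= c & forall rad,
    (count (selected (slab A Wm jx.1 jx.2 om) rad))%:R <= eta * (total (rad + c))%:R].
  by move=> jx; have [om [c h]] := slab_small dk HW HF0 Hreg Hdense jx.1 jx.2 eta0; exists om, c.
have [om om0 hom] : exists2 m : R, 0 < m & forall i, i \in walls -> m <= omf i.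
  by apply: min_le_seq => i; case: (hf i).
have [c0 c00 hc0] : exists2 m : R, 0 <= m & forall i, i \in walls -> cf i <= m.
  by apply: max_ge_seq => i; case: (hf i).
have [z iz hz] := tau_dense HW Hdense t om0.
pose c := c0 + vnorm (pi1 z).
have cc0 : 0 <= c by rewrite addr_ge0 // vnorm_ge0.
have fin D rad : finite_set (selected D rad) := finite_selected dk s HW HF0 D rad.
pose X0 : set V := [set p | forall jx, jx \in walls -> om < `|tau p 0 jx.1 - jx.2|].
pose B (jx : 'I_n * R) : set V := [set p | `|tau p 0 jx.1 - jx.2| <= om].
have main rad : ((count (selected D1 rad))%:R : R) <= (count (selected D2 (rad + c)))%:R + W * eta * (total (rad + c))%:R.
  have cov : selected D1 rad `<=` X0 `|` [set x | exists2 i, i \in walls & B i x].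
    move=> p _; have [h|h] := pselect (X0 p); first by left.
    right; apply: contrapT => hn; apply: h => jx jw; rewrite ltNge; apply/negP => hb.
    by apply: hn; exists jx.
  have := count_cover (fin D1 rad) cov.
  rewrite -(@ler_nat R) natrD natr_sum => /le_trans; apply; apply: lerD.
    rewrite ler_nat; have := @count_le_inj R d k unit (selected D1 rad `&` X0) (selected D2 (rad + c)) (fun=> +%R^~ z).
    rewrite card_unit mul1n; apply; [exact: finite_setIl|exact: fin| |].
      move=> _ p [[op [st [Dp pr]]] X0p].
      have op' : orbit (p + z) by exact: orbitD.
      have [st' D2p] : strip (p + z) /\ D2 (p + z).
        apply: (close om p (p + z)) => // j.
        by rewrite window_coordD_coord [_ + tau z 0 j]addrC addrK.
      do 3!split => //; rewrite pi1D; apply: le_trans (vnormD _ _) _.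
      by rewrite /c addrA; apply: lerD => //; rewrite (le_trans pr) // lerDl.
    by move=> [] p [] p' _ _ /addIr.
  apply: le_trans (_ : \sum_(i <- walls) eta * (total (rad + c))%:R <= _); last first.
    by rewrite big_const_seq count_predT iter_addr_0 -[leLHS]mulr_natl mulrA.
  rewrite big_seq [leRHS]big_seq; apply: ler_sum => jx jw.
  have [_ _ hh] := hf jx.
  apply: le_trans (_ : (count (selected (slab A Wm jx.1 jx.2 (omf jx)) rad))%:R <= _).
    rewrite ler_nat; apply: count_sub; first exact: fin.
    move=> p [[op [st [_ pr]]] Bp]; do 3!split => //; exact: le_trans Bp (hom _ jw).
  apply: le_trans (hh rad) _; rewrite ler_pM2l // ler_nat; apply: total_mono => //.
  by rewrite lerD2l (le_trans (hc0 _ jw)) // lerDl vnorm_ge0.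
have [M1 hM1] := h1 _ eta0; have [M2 hM2] := h2 _ eta0.
have t0 : (0 < total (vnorm (pi1 p0)))%N.
  have [l [_ hl hs]] := finite_enum (fin (fun=> True) (vnorm (pi1 p0))).
  suff : (0 < size l)%N by rewrite hs.
  have : p0 \in l by apply/(hl p0).2; do 3!split => //.
  by case: l {hl hs}.
(* The translation enlarges the ball by [c]; at this radius the enlargement changes the total by a
   factor at most [1 + eta]. *)
have [rad [Mr Rr gr]] := slow_growth dk HW HF0 (Num.max M1 M2) t0 cc0 eta0.
have r1 : M1 <= rad by rewrite (le_trans _ Mr) // le_max lexx.
have r2 : M2 <= rad + c by rewrite (le_trans _ (_ : rad <= _)) ?lerDl // (le_trans _ Mr) // le_max lexx orbT.
have T1 : 1 <= (total rad)%:R :> R by rewrite ler1n (leq_trans t0) // total_mono.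
have T2 : 0 < (total (rad + c))%:R :> R.
  by rewrite ltr0n (leq_trans t0) // total_mono // (le_trans Rr) // lerDl.
have etaP : 0 < eta <= 1 by rewrite eta0.
exact: (frequency_gap etaP gap W0 T1 T2 _ gr (main rad) (hM1 _ r1) (hM2 _ r2)).
Qed.

End FrequencyComparison.

(** * Codes of patch classes *)

Section Enumeration.
Context {R : realType}.

Lemma bounded_uniq_enum (X : set R) (K : nat) :
  (forall l : seq R, uniq l -> (forall x, x \in l -> X x) -> (size l <= K)%N) ->
  exists l : seq R, [/\ uniq l, forall x, x \in l <-> X x & (size l <= K)%N].
Proof.
move=> h.
suff key m : (exists l : seq R, [/\ uniq l, forall x, x \in l <-> X x & (size l <= K)%N]) \/
    exists l : seq R, [/\ uniq l, forall x, x \in l -> X x & size l = m].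
  case: (key K.+1) => // -[l [ul lX sl]]; by have := h l ul lX; rewrite sl ltnn.
elim: m => [|m [|[l [ul lX sl]]]]; [by right; exists [::]|by left|].
have [hl|hl] := pselect (forall x, X x -> x \in l).
  by left; exists l; split => // [x|]; [split; [exact: lX|exact: hl]|exact: h].
have [x Xx xl] : exists2 x, X x & x \notin l.
  by apply: contrapT => hn; apply: hl => x Xx; apply: contrapT => /negP xl; apply: hn; exists x.
right; exists (x :: l); split; rewrite /= ?xl ?sl // => y.
by rewrite inE => /orP[/eqP ->|/lX].
Qed.

Lemma seq_max (l : seq R) (P : R -> Prop) (x0 : R) : P x0 ->
  exists m, [/\ P m, x0 <= m & forall x, x \in l -> P x -> x <= m].
Proof.
move=> P0; elim: l => [|y l [m [Pm xm hm]]]; first by exists x0.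
have [[Py ym]|h] := pselect (P y /\ m < y).
  exists y; split => // [|x]; first exact: le_trans xm (ltW ym).
  by rewrite inE => /orP[/eqP -> //|/hm hx /hx /le_trans]; apply; exact: ltW.
exists m; split => // x; rewrite inE => /orP[/eqP ->|/hm //] Py.
by rewrite leNgt; apply/negP => ym; apply: h.
Qed.

Lemma card_atmost_code (T : finType) (t0 : T) (X : set R) (code : R -> T -> Prop) :
  (forall f, X f -> exists t, code f t) ->
  (forall f f' t, X f -> X f' -> code f t -> code f' t -> f = f') ->
  card_atmost X #|T|%:R.
Proof.
move=> tot inj l ul lX.
have /choice[c hc] : forall f, exists t, X f -> code f t.
  by move=> f; have [Xf|nX] := pselect (X f); [have [t ht] := tot f Xf; exists t|exists t0].
rewrite ler_nat cardE -(size_map c); apply: uniq_leq_size; last by move=> t _; rewrite mem_enum.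
rewrite map_inj_in_uniq // => f f' /lX Xf /lX Xf' cc.
by apply: (inj f f' (c f)) => //; [exact: hc|rewrite cc; exact: hc].
Qed.

End Enumeration.

(** * Acceptance domains at a fixed scale *)

Section Level.
Context {R : realType} {d k : nat}.
Hypotheses (d0 : (0 < d)%N) (dk : (d < k)%N).
Local Notation n := (k - d)%N.
Local Notation V := 'rV[R]_(d + n).
Variables (A : 'M[R]_(d, n)) (Wz : 'M[int]_n) (F0 : 'M[R]_(d + n)) (s : V).
Local Notation Wm := (imx Wz : 'M[R]_n).
Hypothesis HW : int_generators Wm.
Hypothesis HF0 : admissible_F0 A F0.
Hypothesis Hreg : regular A (parallelotope Wm) s.
Hypothesis Hdense : forall eps : R, 0 < eps -> exists Z, dense_orbit 1%:M Z eps A.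
Local Notation tau := (window_coord A Wm).
Local Notation strip := (strip A (parallelotope Wm)).
Local Notation orbit := (lattice_coset s).
Local Notation val j := (value A (col j (invmx Wm))).

Definition lat (z1 : 'rV[int]_d) (z2 : 'rV[int]_n) : V := row_mx (imx z1) (imx z2).

Lemma val_tau j z1 z2 : val j z1 z2 = tau (lat z1 z2) 0 j.
Proof.
rewrite /value /window_coord row_mxKl row_mxKr.
by rewrite !mxE; apply: eq_bigr => l _; rewrite [col _ _ _ _]mxE.
Qed.

Lemma intvec_lat z1 z2 : intvec (lat z1 z2).
Proof. by apply/intvec_imx; exists (row_mx z1 z2); rewrite map_row_mx. Qed.

Lemma latP (z : V) : intvec z -> exists z1 z2, z = lat z1 z2.
Proof.
move=> /intvec_imx[x ->]; exists (lsubmx x), (rsubmx x).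
by rewrite /lat -map_row_mx hsubmxK.
Qed.

Lemma lat_shift z1 z2 (v : 'rV[int]_n) : lat z1 (z2 - v *m Wz) = lat z1 z2 - fiber_shift Wm (imx v).
Proof.
by rewrite /lat /fiber_shift map_mxB map_mxM opp_row_mx add_row_mx oppr0 addr0.
Qed.

(* [S0] and [S1] are the horizontal parts of the lattice vectors that certainly, respectively
   possibly, take part in the patch; [Test z] says that [z] does. *)
Variables (S0 S1 : 'rV[int]_d -> Prop) (Test : V -> Prop) (B rho : R) (kappa K : nat) (G : 'I_n -> R).
Hypothesis G0 : forall j, 0 < G j.
Hypothesis S00 : S0 0.
Hypothesis S01 : forall z, S0 z -> S1 z.
Hypothesis S1B : forall z i, S1 z -> `|z 0 i|%:~R <= B.
Hypothesis face : forall z, S1 z -> ~ S0 z ->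
  exists (i : 'I_d) (sg : bool), `|(z 0 i)%:~R - (-1) ^+ sg * rho| <= kappa%:R.
Hypothesis cover : forall j y, exists z1 z2, S0 z1 /\ `|val j z1 z2 - y| <= G j.
Hypothesis few : forall j (l : seq R), uniq l ->
  (forall x, x \in l -> small_values A (col j (invmx Wm)) (2 * B) (G j) x) -> (size l <= K)%N.
Hypothesis thin : forall j (z1 : 'rV[int]_d) (z2 : 'rV[int]_n), (forall i, `|z1 0 i|%:~R <= 4 * B) ->
  z1 = 0 \/ (exists i, `|z1 0 i| <= (4 * kappa)%N%:Z) -> `|val j z1 z2| <= 4 * G j -> val j z1 z2 = 0.
Hypothesis test_S0 : forall z1 z2, S0 z1 -> (forall j, `|tau (lat z1 z2) 0 j| < 1) -> Test (lat z1 z2).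
Hypothesis test_S1 : forall z1 z2, Test (lat z1 z2) -> (forall j, `|tau (lat z1 z2) 0 j| < 1) -> S1 z1.

Definition same_class (p p0 : V) : Prop :=
  forall z, intvec z -> Test z -> (strip (p + z) <-> strip (p0 + z)).

(** [p + z] meets the wall [tau_j = 0] where [tau_j p = - tau_j z]. The wall [tau_j = 1] gives the
    same cuts moved by 1, which are again cuts by [cutD]. *)
Definition cut (S : 'rV[int]_d -> Prop) (j : 'I_n) (x : R) : Prop :=
  exists z1 z2, S z1 /\ x = - val j z1 z2.

(* A cut from a vector whose [i]-th entry is close to that of the face [i], [sg] of the cube. *)
Definition face_cut (j : 'I_n) (i : 'I_d) (sg : bool) (x : R) : Prop :=
  exists z1 z2, [/\ S1 z1, `|(z1 0 i)%:~R - (-1) ^+ sg * rho| <= kappa%:R & x = - val j z1 z2].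

(** Only vectors that certainly take part bound a cell; the uncertain ones can merely subdivide
    it. *)
Definition is_cell (p : V) (lo hi : 'I_n -> R) : Prop := forall j,
  [/\ cut S0 j (lo j), cut S0 j (hi j), lo j < tau p 0 j < hi j, hi j - lo j <= 2 * G j &
      forall x, cut S0 j x -> ~ lo j < x < hi j].

Lemma cutD S j x m : cut S j x -> cut S j (x + m%:~R).
Proof.
move=> [z1 [z2 [h ->]]]; exists z1, (z2 - (m *: delta_mx 0 j) *m Wz); split => //.
rewrite !val_tau lat_shift tauB (tau_fiber_shift _ HW); move: (tau _) => u.
by rewrite !mxE !eqxx mulr1 opprB addrC.
Qed.

Lemma cut_neq S p j x : orbit p -> cut S j x -> tau p 0 j != x.
Proof.
move=> op [z1 [z2 [_ ->]]]; apply/eqP => e.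
apply: (@tau_notint _ _ _ _ _ HW _ Hreg (p + lat z1 z2) j 0).
  by apply: orbitD => //; exact: intvec_lat.
by rewrite window_coordD_coord e val_tau addNr.
Qed.

Lemma cut_diff S j x x' : (forall z, S z -> S1 z) -> cut S j x -> cut S j x' ->
  0 < x' - x <= 2 * G j -> small_values A (col j (invmx Wm)) (2 * B) (G j) (x' - x).
Proof.
move=> SS [z1 [z2 [h ->]]] [y1 [y2 [h' ->]]] hx; split => //.
exists (z1 - y1), (z2 - y2); split; last by rewrite valueB opprK addrC.
move=> i; rewrite !mxE; have := S1B i (SS _ h); have := S1B i (SS _ h').
have := ler_normB (z1 0 i) (y1 0 i); rewrite -(@ler_int R) intrD.
by move: (`|z1 0 i|%:~R : R) (`|y1 0 i|%:~R : R) => a b; lra.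
Qed.

Lemma cell_side j u : (forall x, cut S0 j x -> u != x) ->
  exists lo hi, [/\ cut S0 j lo, cut S0 j hi, lo < u < hi, hi - lo <= 2 * G j &
     forall x, cut S0 j x -> ~ lo < x < hi].
Proof.
move=> hu; have g0 := G0 j.
have [l [_ lX _]] := bounded_uniq_enum (@few j).
have near y : exists2 x, cut S0 j x & `|x - y| <= G j.
  have [z1 [z2 [h1 h2]]] := cover j (- y); exists (- val j z1 z2); first by exists z1, z2.
  by rewrite -normrN opprB opprK addrC -[y]opprK.
have [x0 cx0] := near (u - G j); rewrite ler_distl => /andP[a1 a2].
have [y0 cy0] := near (u + G j); rewrite ler_distl => /andP[b1 b2].
have x0u : x0 < u by rewrite lt_neqAle eq_sym hu //=; lra.
have uy0 : u < y0 by rewrite lt_neqAle hu //=; lra.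
(* A cut between [x0] and [u] differs from [x0] by a small value, and those are finitely many, so a
   last cut before [u] exists. The first cut after [u] is found as a maximum of negatives,
   [- m']. *)
have [m [[cm mu] m0 hm]] := @seq_max R [seq x0 + x | x <- l] (fun x => cut S0 j x /\ x < u) x0 (conj cx0 x0u).
have P0 : cut S0 j (- - y0) /\ u < - - y0 by rewrite opprK.
have [m' [[cm' mu'] m0' hm']] := @seq_max R [seq x - y0 | x <- l] (fun x => cut S0 j (- x) /\ u < - x) (- y0) P0.
have gap x : cut S0 j x -> ~ m < x < - m'.
  move=> cx /andP[mx xm']; have := hu x cx; rewrite neq_lt => /orP[ux|xu].
    have : x - y0 <= 0 by rewrite subr_le0 (le_trans (ltW xm')) // lerNl.
    rewrite le_eqVlt => /orP[/eqP e|xy0].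
      by move: xm' m0'; rewrite (subr0_eq e) ltrNr => h /(lt_le_trans h); rewrite ltxx.
    have hx : - x \in [seq x - y0 | x <- l].
      apply/mapP; exists (y0 - x); last by rewrite addrAC subrr add0r.
      apply/lX; apply: (@cut_diff S0) => //; apply/andP; split; lra.
    have := hm' _ hx; rewrite opprK => /(_ (conj cx ux)); lra.
  have hx : x \in [seq x0 + x | x <- l].
    apply/mapP; exists (x - x0); last by rewrite addrC subrK.
    apply/lX; apply: (@cut_diff S0) => //; apply/andP; split; lra.
  by have := hm _ hx (conj cx xu); rewrite leNgt mx.
exists m, (- m'); split => //; first by rewrite mu.
(* Some cut is within [G] of the midpoint and none is inside the cell, so the half length is at most
   [G]. *)
have [x cx] := near ((m - m') / 2); rewrite ler_distl => /andP[c1 c2].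
have := gap x cx; have [xm|mx] := leP x m; first by lra.
have [xm'|m'x] := ltP x (- m'); last by lra.
by move=> /(_ isT).
Qed.

Lemma cell_exists p : orbit p -> exists lo hi, is_cell p lo hi.
Proof.
move=> op; have /choice[lo /choice[hi h]] : forall j, exists lo, exists hi,
  [/\ cut S0 j lo, cut S0 j hi, lo < tau p 0 j < hi, hi - lo <= 2 * G j &
     forall x, cut S0 j x -> ~ lo < x < hi].
  move=> j; have [x cx|lo [hi h]] := @cell_side j (tau p 0 j); first exact: cut_neq cx.
  by exists lo, hi.
by exists lo, hi.
Qed.

(** The zero vector takes part, so 0 and 1 are themselves cuts. *)
Lemma cell_unit p lo hi j : orbit p -> strip p -> is_cell p lo hi -> 0 <= lo j /\ hi j <= 1.
Proof.
move=> op st /(_ j)[_ _ /andP[h1 h2] _ gap].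
have /(orbit_strip HW Hreg op) /(_ j) /andP[u0 u1] := st.
have c0 : cut S0 j 0.
  exists 0, 0; split => //; rewrite val_tau /window_coord row_mxKl row_mxKr !map_mx0 mul0mx subrr mul0mx.
  by rewrite mxE oppr0.
have c1 : cut S0 j 1 by have := @cutD S0 j 0 1 c0; rewrite add0r.
split; rewrite leNgt; apply/negP => h.
  by apply: (gap 0 c0); rewrite h (lt_trans u0).
by apply: (gap 1 c1); rewrite h andbT (lt_trans h1).
Qed.

Lemma strip_fold p : orbit p -> exists2 v : 'rV[int]_n,
  strip (p - fiber_shift Wm (imx v)) & forall j, 0 < tau p 0 j < 1 -> v 0 j = 0.
Proof.
move=> op; exists (map_mx Num.floor (tau p)).
  apply/(stripE _ HW) => j; rewrite tauB (tau_fiber_shift _ HW).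
  move: (tau p) => u; rewrite !mxE; have := floor_itv (u 0 j); rewrite intrD.
  by move: (u 0 j) (_%:~R) => a b /andP[? ?]; apply/andP; split; lra.
move=> j; move: (tau p) => u /andP[h1 h2]; rewrite mxE.
by apply: floor_def; rewrite add0r ltW.
Qed.

Lemma lat_coord_bound p z j : orbit p -> intvec z -> strip p -> strip (p + z) -> `|tau z 0 j| < 1.
Proof.
move=> op iz /(orbit_strip HW Hreg op) /(_ j) h /(orbit_strip HW Hreg (orbitD op iz)) /(_ j).
rewrite window_coordD_coord; move: (tau p 0 j) (tau z 0 j) h => a b /andP[? ?] /andP[? ?].
by rewrite ltr_norml; apply/andP; split; lra.
Qed.

(* A cut of [S0] separating [p] from [p0] in one coordinate is detected by some test vector:
   the window has integer edges, so the other coordinates can be folded into the window. *)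
Lemma same_class_cell p p0 lo hi : orbit p -> orbit p0 -> strip p -> strip p0 ->
  is_cell p0 lo hi -> same_class p p0 -> forall j, lo j < tau p 0 j < hi j.
Proof.
move=> op op0 st st0 cell cls j; have [clo chi /andP[l1 l2] _ _] := cell j.
have [lo0 hi1] := cell_unit j op0 st0 cell.
have /(orbit_strip HW Hreg op) /(_ j) /andP[u0 u1] := st.
have /(orbit_strip HW Hreg op0) /(_ j) /andP[v0 v1] := st0.
have nlo := cut_neq op clo; have nhi := cut_neq op chi.
apply/andP; split; rewrite lt_neqAle ?[lo j == _]eq_sym ?nlo ?nhi /= leNgt; apply/negP => h.
  have [z1 [z2 [h1 e]]] := clo; rewrite val_tau in e.
  have [v stv hv] := strip_fold (orbitD op0 (intvec_lat z1 z2)).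
  have vj : v 0 j = 0 by apply: hv; rewrite window_coordD_coord; apply/andP; split; lra.
  rewrite -addrA -lat_shift in stv.
  have iz := intvec_lat z1 (z2 - v *m Wz).
  have T : Test (lat z1 (z2 - v *m Wz)).
    by apply: test_S0 => // i; exact: lat_coord_bound op0 iz st0 stv.
  have /(orbit_strip HW Hreg (orbitD op iz)) /(_ j) := (cls _ iz T).2 stv.
  rewrite window_coordD_coord lat_shift tauB (tau_fiber_shift _ HW).
  have -> : (tau (lat z1 z2) - imx v) 0 j = tau (lat z1 z2) 0 j.
    by move: (tau (lat z1 z2)) => u; rewrite !mxE vj subr0.
  by move=> /andP[h3 _]; lra.
have [z1 [z2 [h1 e]]] := chi; rewrite val_tau in e.
have [v stv hv] := strip_fold (orbitD op (intvec_lat z1 z2)).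
have vj : v 0 j = 0 by apply: hv; rewrite window_coordD_coord; apply/andP; split; lra.
rewrite -addrA -lat_shift in stv.
have iz := intvec_lat z1 (z2 - v *m Wz).
have T : Test (lat z1 (z2 - v *m Wz)).
  by apply: test_S0 => // i; exact: lat_coord_bound op iz st stv.
have /(orbit_strip HW Hreg (orbitD op0 iz)) /(_ j) := (cls _ iz T).1 stv.
rewrite window_coordD_coord lat_shift tauB (tau_fiber_shift _ HW).
have -> : (tau (lat z1 z2) - imx v) 0 j = tau (lat z1 z2) 0 j.
  by move: (tau (lat z1 z2)) => u; rewrite !mxE vj subr0.
by move=> /andP[h3 _]; lra.
Qed.

Lemma B_ge0 : 0 <= B.
Proof. by have := S1B (Ordinal d0) (S01 S00); rewrite mxE normr0. Qed.

(** The difference of two vectors near the same face has a bounded [i]-th entry, so thinness forces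
    equal values. *)
Lemma face_cut_uniq j i sg x x' : face_cut j i sg x -> face_cut j i sg x' ->
  `|x - x'| <= 4 * G j -> x = x'.
Proof.
move=> [z1 [z2 [h f ->]]] [y1 [y2 [h' f' ->]]]; rewrite opprK addrC -valueB => hx.
have B0 := B_ge0.
suff /eqP : val j (y1 - z1) (y2 - z2) = 0 by rewrite valueB subr_eq0 => /eqP ->.
apply: thin hx => [i'|].
  rewrite !mxE; have := S1B i' h; have := S1B i' h'.
  have := ler_normB (y1 0 i') (z1 0 i'); rewrite -(@ler_int R) intrD.
  by move: (`|z1 0 i'|%:~R : R) (`|y1 0 i'|%:~R : R) => a b; lra.
right; exists i; rewrite !mxE -(@ler_int R) intr_norm rmorphB /= -pmulrn natrM.
move: f f'; rewrite !ler_norml.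
move: ((z1 0 i)%:~R : R) ((y1 0 i)%:~R : R) (_ * rho) (kappa%:R : R) => a b c e /andP[? ?] /andP[? ?].
by apply/andP; split; lra.
Qed.

(* Opposite faces: the difference of the two vectors has its [i]-th entry close to [2 rho], so
   two such differences are close in that entry and hence give the same value. *)
Lemma face_cut_pair j i x y x' y' :
  face_cut j i false x -> face_cut j i true y -> face_cut j i false x' -> face_cut j i true y' ->
  `|x - y| <= 2 * G j -> `|x' - y'| <= 2 * G j -> x - y = x' - y'.
Proof.
move=> [z1 [z2 [hz fz ->]]] [y1 [y2 [hy fy ->]]] [u1 [u2 [hu fu ->]]] [v1 [v2 [hv fv ->]]].
rewrite !opprK ![- _ + _]addrC -!valueB => h1 h2.
have B0 := B_ge0.
apply/eqP; rewrite -subr_eq0 -valueB; apply/eqP.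
apply: thin => [i'||].
- rewrite !mxE; have := S1B i' hz; have := S1B i' hy; have := S1B i' hu; have := S1B i' hv.
  have := ler_normB (y1 0 i' - z1 0 i') (v1 0 i' - u1 0 i').
  have := ler_normB (y1 0 i') (z1 0 i'); have := ler_normB (v1 0 i') (u1 0 i').
  rewrite -!(@ler_int R) !intrD.
  move: (`|z1 0 i'|%:~R : R) (`|y1 0 i'|%:~R : R) (`|u1 0 i'|%:~R : R) (`|v1 0 i'|%:~R : R).
  by move: (`|y1 0 i' - _|%:~R : R) (`|v1 0 i' - _|%:~R : R) => a b c e f g; lra.
- right; exists i; rewrite !mxE -(@ler_int R) intr_norm !rmorphB /= -pmulrn natrM.
  move: fz fy fu fv; rewrite expr0 expr1 !mul1r !mulN1r !ler_norml.
  move: ((z1 0 i)%:~R : R) ((y1 0 i)%:~R : R) ((u1 0 i)%:~R : R) ((v1 0 i)%:~R : R) (kappa%:R : R).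
  move=> a b c e f /andP[? ?] /andP[? ?] /andP[? ?] /andP[? ?].
  by apply/andP; split; lra.
rewrite valueB; move: (val j (y1 - z1) _) (val j (v1 - u1) _) h1 h2 => a b.
by rewrite !ler_norml => /andP[? ?] /andP[? ?]; apply/andP; split; lra.
Qed.

(** An [option] suffices: cells have length at most [2 * G j], so by [face_cut_uniq] each face
    contributes at most one cut. *)
Definition is_new (lo hi : 'I_n -> R) (nw : 'I_n -> 'I_d -> bool -> option R) : Prop :=
  forall j i sg x, nw j i sg = Some x <-> face_cut j i sg x /\ lo j < x < hi j.

Lemma new_exists p lo hi : is_cell p lo hi -> exists nw, is_new lo hi nw.
Proof.
move=> cell.
have /choice[f hf] : forall t : 'I_n * 'I_d * bool, exists o : option R,
    forall x, o = Some x <-> face_cut t.1.1 t.1.2 t.2 x /\ lo t.1.1 < x < hi t.1.1.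
  move=> [[j i] sg] /=.
  have [[x [fx hx]]|h] := pselect (exists x, face_cut j i sg x /\ lo j < x < hi j).
    exists (Some x) => y; split => [[<-] //|[fy hy]]; congr Some.
    apply: (face_cut_uniq fx fy).
    have [_ _ _ hl _] := cell j; have := G0 j.
    by move: hx hy => /andP[? ?] /andP[? ?] g0; rewrite ler_norml; apply/andP; split; lra.
  by exists None => x; split => // hx; case: h; exists x.
by exists (fun j i sg => f (j, i, sg)) => j i sg x; exact: hf.
Qed.

(** Names the chamber of the subdivided cell that contains [p]; an absent cut gets the value
    [false]. *)
Definition position (nw : 'I_n -> 'I_d -> bool -> option R) (p : V) : {ffun 'I_n * 'I_d * bool -> bool} :=
  [ffun t => oapp (fun x => x < tau p 0 t.1.1) false (nw t.1.1 t.1.2 t.2)].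

Section Cell.
Variables (p0 : V) (lo hi : 'I_n -> R) (nw : 'I_n -> 'I_d -> bool -> option R).
Hypotheses (cell : is_cell p0 lo hi) (new : is_new lo hi nw).

Lemma same_side p p' j x : cut S1 j x ->
  lo j < tau p 0 j < hi j -> lo j < tau p' 0 j < hi j -> position nw p = position nw p' ->
  x < tau p 0 j -> x < tau p' 0 j.
Proof.
move=> [z1 [z2 [h e]]] /andP[p1 p2] /andP[q1 q2] pp xp.
have [[x1 x2]|hx] := pselect (lo j < x /\ x < hi j); last first.
  have [xl|lx] := leP x (lo j); first exact: le_lt_trans xl q1.
  by case: hx; split => //; exact: lt_trans p2.
have [S0z|nS0] := pselect (S0 z1).
  have [_ _ _ _ gap] := cell j; case: (gap x); [by exists z1, z2|exact/andP].
have [i [sg hi']] := face h nS0.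
have ex : nw j i sg = Some x by apply/new; split; [exists z1, z2|exact/andP].
by have /ffunP /(_ (j, i, sg)) := pp; rewrite !ffunE /= ex /= xp => /esym.
Qed.

(** Membership in the class is constant on chambers: by [same_side], no cut of a participating
    vector separates two points of one chamber. *)
Lemma same_class_position p p' : orbit p -> orbit p' -> strip p -> strip p' ->
  (forall j, lo j < tau p 0 j < hi j) -> (forall j, lo j < tau p' 0 j < hi j) ->
  position nw p = position nw p' -> same_class p p0 -> same_class p' p0.
Proof.
have key q q' z1 z2 : orbit q -> orbit q' -> strip q -> strip q' ->
  (forall j, lo j < tau q 0 j < hi j) -> (forall j, lo j < tau q' 0 j < hi j) ->
  position nw q = position nw q' -> Test (lat z1 z2) -> strip (q + lat z1 z2) -> strip (q' + lat z1 z2).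
  move=> oq oq' sq sq' cq cq' pq T sz; have iz := intvec_lat z1 z2.
  have h1 : S1 z1 by apply: (test_S1 T) => j; exact: lat_coord_bound oq iz sq sz.
  apply/(orbit_strip HW Hreg (orbitD oq' iz)) => j.
  have /(orbit_strip HW Hreg (orbitD oq iz)) /(_ j) := sz.
  rewrite !window_coordD_coord -val_tau => /andP[a1 a2].
  have c1 : cut S1 j (- val j z1 z2) by exists z1, z2.
  have c2 : cut S1 j (- val j z1 z2 + 1) := @cutD S1 j _ 1 c1.
  have b1 : - val j z1 z2 < tau q' 0 j by apply: (same_side c1 (cq j)) => //; lra.
  have b2 : ~ (- val j z1 z2 + 1 < tau q' 0 j).
    by move=> hq; have := same_side c2 (cq' j) (cq j) (esym pq) hq; lra.
  have b3 := cut_neq oq' c2.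
  apply/andP; split; first by lra.
  rewrite lt_neqAle; apply/andP; split; last by rewrite leNgt; apply/negP => h; apply: b2; lra.
  by apply: contra b3 => /eqP h; rewrite -subr_eq0 opprD opprK addrA h subrr.
move=> op op' st st' cp cp' pp cls z iz T; rewrite -(cls z iz T).
have [z1 [z2 ez]] := latP iz; rewrite ez in T *; split; exact: key.
Qed.

End Cell.

(** Distances inside a cell are small values, hence few; numbering them codes lengths by integers.
    [K.+1] keeps the index type inhabited. *)
Lemma index_map : exists idx : 'I_n -> R -> 'I_K.+1, forall j x y,
  small_values A (col j (invmx Wm)) (2 * B) (G j) x ->
  small_values A (col j (invmx Wm)) (2 * B) (G j) y -> idx j x = idx j y -> x = y.
Proof.
have /choice[L hL] j := bounded_uniq_enum (@few j).
exists (fun j x => inord (index x (L j))) => j x y hx hy /(congr1 (@nat_of_ord _)) /=.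
have [_ lX sl] := hL j.
have i_lt z : z \in L j -> (index z (L j) < K.+1)%N.
  by rewrite -index_mem ltnS => hz; exact: leq_trans (ltnW hz) sl.
have xL : x \in L j by apply/lX.
have yL : y \in L j by apply/lX.
rewrite !inordK ?i_lt // => e.
by rewrite -(nth_index 0 xL) e nth_index.
Qed.

(* By [face_cut_pair] the new cuts of two opposite faces have a fixed difference, so when both are
   present only one of them has to be recorded: this is what makes the exponent [d + 1]. *)
Definition encode (f : R -> 'I_K.+1) (o1 o2 : option R) : option 'I_K.+1 * 'I_3 :=
  match o1, o2 with
  | None, None => (None, inord 0)
  | Some x, None => (Some (f x), inord 0)
  | None, Some y => (Some (f y), inord 1)
  | Some x, Some _ => (Some (f x), inord 2)
  end.

(** The first factor is the subdivided cell measured from its lower corner, hence up to translation.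
    The second is the set of chambers forming the acceptance domain, with a number of choices
    independent of [K]. *)
Definition code_type : finType :=
  ({ffun 'I_n -> 'I_K.+1 * {ffun 'I_d -> option 'I_K.+1 * 'I_3}}
   * {set {ffun 'I_n * 'I_d * bool -> bool}})%type.

Definition rel_to (c : R) (o : option R) : option R := omap (fun x => x - c) o.

Definition has_code (idx : 'I_n -> R -> 'I_K.+1) (p0 : V) (t : code_type) : Prop :=
  exists lo hi nw, [/\ is_cell p0 lo hi, is_new lo hi nw &
    t = ([ffun j => (idx j (hi j - lo j),
            [ffun i => encode (idx j) (rel_to (lo j) (nw j i false)) (rel_to (lo j) (nw j i true))])],
         [set sg | `[< exists p, [/\ orbit p, strip p, forall j, lo j < tau p 0 j < hi j,
            position nw p = sg & same_class p p0] >]]%SET)].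

Lemma code_exists idx p0 : orbit p0 -> exists t, has_code idx p0 t.
Proof.
move=> op0; have [lo [hi cell]] := cell_exists op0; have [nw new] := new_exists cell.
by eexists; exists lo, hi, nw; split.
Qed.

Lemma encode_inj (f : R -> 'I_K.+1) (P : R -> Prop) o1 o2 o1' o2' :
  (forall x y, P x -> P y -> f x = f y -> x = y) ->
  (forall x, o1 = Some x \/ o2 = Some x \/ o1' = Some x \/ o2' = Some x -> P x) ->
  (forall x y x' y', o1 = Some x -> o2 = Some y -> o1' = Some x' -> o2' = Some y' -> x - y = x' - y') ->
  encode f o1 o2 = encode f o1' o2' -> o1 = o1' /\ o2 = o2'.
Proof.
move=> finj hP hpair.
case: o1 o2 o1' o2' hP hpair => [x|] [y|] [x'|] [y'|] hP hpair //= [] //;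
  try by move=> _ /(congr1 (@nat_of_ord _)); rewrite /= !inordK.
- move=> e; have xx : x = x' by apply: finj e; apply: hP; intuition.
  have := hpair x y x' y' erefl erefl erefl erefl; by rewrite xx => /addrI /oppr_inj ->; split.
- by move=> e; have -> : x = x' by apply: finj e; apply: hP; intuition.
by move=> e; have -> : y = y' by apply: finj e; apply: hP; intuition.
Qed.

Local Notation has_frequency := (has_frequency A Wm F0 s).

(** Equal codes mean equal lengths and equal relative cuts, so the translation by [lo' - lo] matches
    the two subdivided cells, and equal chamber sets match the acceptance domains. *)
Lemma code_frequency (idx : 'I_n -> R -> 'I_K.+1) (p0 p0' : V) (t : code_type) (f f' : R) :
  (forall j x y, small_values A (col j (invmx Wm)) (2 * B) (G j) x ->
     small_values A (col j (invmx Wm)) (2 * B) (G j) y -> idx j x = idx j y -> x = y) ->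
  orbit p0 -> strip p0 -> orbit p0' -> strip p0' -> has_code idx p0 t -> has_code idx p0' t ->
  has_frequency (same_class^~ p0) f -> has_frequency (same_class^~ p0') f' -> f <= f'.
Proof.
move=> idx_inj op0 st0 op0' st0' [lo [hi [nw [cell new ->]]]] [lo' [hi' [nw' [cell' new' /esym [e1 e2]]]]] hf hf'.
have cut_S1 j x : cut S0 j x -> cut S1 j x by move=> [z1 [z2 [h ->]]]; exists z1, z2; split => //; exact: S01.
have cut_face j i sg x : face_cut j i sg x -> cut S1 j x by move=> [z1 [z2 [h _ ->]]]; exists z1, z2.
have small_new q l h w : is_cell q l h -> is_new l h w -> forall j i sg x, rel_to (l j) (w j i sg) = Some x ->
    small_values A (col j (invmx Wm)) (2 * B) (G j) x.
  move=> cl nwl j i sg x; rewrite /rel_to; case ew : (w j i sg) => [y|] //= [<-].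
  have /nwl [fy /andP[y1 y2]] := ew; have [cl1 _ _ w2 _] := cl j.
  apply: (@cut_diff S1) => //; [exact: cut_S1|exact: cut_face fy|].
  by apply/andP; split; lra.
have small_hi q l h : is_cell q l h -> forall j, small_values A (col j (invmx Wm)) (2 * B) (G j) (h j - l j).
  move=> cl j; have [cl1 cl2 /andP[y1 y2] w2 _] := cl j.
  by apply: (@cut_diff S0) => //; apply/andP; split => //; lra.
have new_face q l h w : is_cell q l h -> is_new l h w -> forall j i x y,
    rel_to (l j) (w j i false) = Some x -> rel_to (l j) (w j i true) = Some y ->
    exists x0 y0, [/\ face_cut j i false x0, face_cut j i true y0, x - y = x0 - y0 & `|x0 - y0| <= 2 * G j].
  move=> cl nwl j i x y; rewrite /rel_to; case ex : (w j i false) => [x0|] //= [<-].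
  case ey : (w j i true) => [y0|] //= [<-].
  have /nwl [fx /andP[x1 x2]] := ex; have /nwl [fy /andP[y1 y2]] := ey.
  have [_ _ _ w2 _] := cl j.
  exists x0, y0; split => //; first by rewrite opprB addrA subrK.
  by rewrite ler_norml; apply/andP; split; lra.
have ehi j : hi j - lo j = hi' j - lo' j.
  have /ffunP /(_ j) := e1; rewrite !ffunE => -[/esym e _].
  by apply: (idx_inj j) e; [exact: small_hi cell j|exact: small_hi cell' j].
have enw j i sg : rel_to (lo j) (nw j i sg) = rel_to (lo' j) (nw' j i sg).
  have /ffunP /(_ j) := e1; rewrite !ffunE => -[_ /ffunP /(_ i)]; rewrite !ffunE => e.
  have [||ef et] := @encode_inj _ _ _ _ _ _ (idx_inj j) _ _ (esym e).
  - by move=> x [|[|[|]]]; [exact: small_new cell new j i _ x|exact: small_new cell new j i _ x|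
      exact: small_new cell' new' j i _ x|exact: small_new cell' new' j i _ x].
  - move=> x y x' y' hx hy hx' hy'.
    have [x0 [y0 [fx fy -> b]]] := new_face _ _ _ _ cell new j i x y hx hy.
    have [x0' [y0' [fx' fy' -> b']]] := new_face _ _ _ _ cell' new' j i x' y' hx' hy'.
    exact: face_cut_pair fx fy fx' fy' b b'.
  by case: sg.
have nwE j i sg x : nw j i sg = Some x -> nw' j i sg = Some (x + (lo' j - lo j)).
  move=> ex; have := enw j i sg; rewrite ex /rel_to /=; case: (nw' j i sg) => [y|] //= [e].
  by congr Some; rewrite addrA addrAC e subrK.
(* Ends of the cell and new cuts; for an absent cut the default wall [0] is harmless, its slabs
   being as thin as the others. *)
pose walls : seq ('I_n * R) := [seq (j, lo j) | j <- enum 'I_n] ++ [seq (j, hi j) | j <- enum 'I_n] ++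
  [seq (u.1.1, odflt 0 (nw u.1.1 u.1.2 u.2)) | u <- enum {: 'I_n * 'I_d * bool}].
have key := @frequency_le R d k dk A Wm F0 s HW HF0 Hreg Hdense _ _ f f' (\row_j (lo' j - lo j)) walls p0 op0 st0 hf hf'.
apply: key => om p p' om0 op op' st cls close far.

have cl j := same_class_cell op op0 st st0 cell cls j.
have close' j : `|tau p' 0 j - (tau p 0 j + (lo' j - lo j))| < om.
  by have := close j; rewrite [(\row_j _) 0 j]mxE -addrA -opprD.
have far_lo j : om < `|tau p 0 j - lo j|.
  apply: (far (j, lo j)); rewrite mem_cat; apply/orP; left.
  by apply/mapP; exists j; rewrite ?mem_enum.
have far_hi j : om < `|tau p 0 j - hi j|.
  apply: (far (j, hi j)); rewrite !mem_cat; apply/orP; right; apply/orP; left.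
  by apply/mapP; exists j; rewrite ?mem_enum.
have far_nw j i sg x : nw j i sg = Some x -> om < `|tau p 0 j - x|.
  move=> ex; apply: (far (j, x)); rewrite !mem_cat; apply/orP; right; apply/orP; right.
  by apply/mapP; exists (j, i, sg); rewrite ?mem_enum //= ex.
have cl' j : lo' j < tau p' 0 j < hi' j.
  have := cl j; have := far_lo j; have := far_hi j; have := close' j; have := ehi j.
  move: (tau p 0 j) (tau p' 0 j) (lo j) (hi j) (lo' j) (hi' j) => a b l h l' h'.
  move=> e c1 c2 c3 /andP[b1 b2].
  rewrite gtr0_norm ?subr_gt0 // in c3; rewrite ltr0_norm ?subr_lt0 // in c2.
  by move: c1; rewrite ltr_norml => /andP[? ?]; apply/andP; split; lra.
have st' : strip p'.
  apply/(stripE _ HW) => j; have [a1 a2] := cell_unit j op0' st0' cell'.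
  by have /andP[? ?] := cl' j; apply/andP; split; lra.
split => //.
have pos : position nw' p' = position nw p.
  apply/ffunP => -[[j i] sg]; rewrite !ffunE /=.
  case ex : (nw j i sg) => [x|] /=; last first.
    by have := enw j i sg; rewrite ex /rel_to /=; case: (nw' j i sg).
  rewrite (nwE _ _ _ _ ex) /=.
  have := far_nw _ _ _ _ ex; have := close' j; have := cut_neq op (cut_face _ _ _ _ ((new j i sg x).1 ex).1).
  move: (tau p 0 j) (tau p' 0 j) (lo' j - lo j) => a b c ax.
  rewrite ltr_norml => /andP[c1 c2]; case: (ltgtP x a) => [xa|xa|xa]; last by rewrite xa eqxx in ax.
    by rewrite gtr0_norm ?subr_gt0 // => h; lra.
  by rewrite ltr0_norm ?subr_lt0 // => h; apply/negbTE; rewrite -leNgt; lra.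
(* The chamber of [p] is recorded for [p0], hence for [p0']: some [q] in the corresponding chamber
   has the class of [p0'], and [p'] shares that chamber. *)
have : position nw p \in [set sg | `[< exists p, [/\ orbit p, strip p, forall j, lo' j < tau p 0 j < hi' j,
            position nw' p = sg & same_class p p0'] >]]%SET.
  by rewrite e2 inE; apply/asboolP; exists p; split.
rewrite inE => /asboolP[q [oq sq cq pq clq]].
by apply: (same_class_position cell' new' oq op' sq st' cq cl') => //; rewrite pq pos.
Qed.

Local Notation W := (parallelotope Wm).
Local Notation lift := (@Defs.lift R d k A F0 W s).
Local Notation cps := (@Defs.cps R d k A F0 W s).
Local Notation pi1 := (pi1 A F0).
Local Notation selected := (selected A Wm F0 s).
Local Notation count := (@Defs.count R d k).

Variables (P : V -> R -> set V) (r : R).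
Hypothesis patchP : forall y p, lift y p -> forall y', P y r y' <-> exists p', lift y' p' /\ Test (p' - p).

Lemma addr_swap (U : zmodType) (a b c : U) : a + c = b + c + (a - b).
Proof. by rewrite [b + c]addrC -addrA [b + _]addrC subrK addrC. Qed.

(** Injectivity of [pi1] on the orbit lets two translated patches be compared on lifts, one lattice
    vector at a time. *)
Lemma patch_equiv_class y1 y2 p1 p2 : lift y1 p1 -> lift y2 p2 ->
  patch_equiv P r y1 y2 <-> same_class p1 p2.
Proof.
move=> l1 l2; have [o1 [st1 e1]] := l1; have [o2 [st2 e2]] := l2.
have back y' p' : lift y' p' -> pi1 p' = y' by case=> _ [].
split => [pe z iz T|cls].
  have T1 : Test (p1 + z - p1) by rewrite addrAC subrr add0r.
  have T2 : Test (p2 + z - p2) by rewrite addrAC subrr add0r.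
  have oz1 : orbit (p1 + z) := orbitD o1 iz; have oz2 : orbit (p2 + z) := orbitD o2 iz.
  split => sz.
    have : P y1 r (pi1 (p1 + z)) by apply/(patchP l1); exists (p1 + z).
    rewrite pe => -[y' /(patchP l2)[p' [[op' [sp' ep']] Tp']] e].
    suff <- : p' = p2 + z by [].
    apply: (pi1_inj HF0 op' oz2); rewrite ep'.
    by apply: (addIr (y1 - y2)); rewrite e !pi1D e1 e2; exact: addr_swap.
  have : P y1 r (pi1 (p2 + z) + (y1 - y2)).
    by rewrite pe; exists (pi1 (p2 + z)) => //; apply/(patchP l2); exists (p2 + z).
  move=> /(patchP l1)[p' [[op' [sp' ep']] Tp']].
  suff <- : p' = p1 + z by [].
  apply: (pi1_inj HF0 op' oz1); rewrite ep' !pi1D e1 e2.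
  by rewrite -addr_swap.
rewrite /patch_equiv; apply/seteqP; split => y' /=.
  move=> /(patchP l1)[p' [[op' [sp' ep']] Tp']].
  have iz := orbitB op' o1.
  have sz : strip (p2 + (p' - p1)).
    by apply/(cls _ iz Tp'); rewrite addrC subrK.
  exists (pi1 (p2 + (p' - p1))).
    apply/(patchP l2); exists (p2 + (p' - p1)); split; last by rewrite addrAC subrr add0r.
    by split; first exact: orbitD.
  by rewrite pi1D pi1B e1 e2 ep' -addr_swap addrC subrK.
move=> [y'' /(patchP l2)[p' [[op' [sp' ep']] Tp']] <-].
have iz := orbitB op' o2.
have sz : strip (p1 + (p' - p2)).
  by apply/(cls _ iz Tp'); rewrite addrC subrK.
apply/(patchP l1); exists (p1 + (p' - p2)); split; last by rewrite addrAC subrr add0r.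
split; first exact: orbitD.
by split => //; rewrite pi1D pi1B e1 e2 ep' addrCA.
Qed.

Lemma count_image (X : set V) : finite_set X -> (forall p, X p -> orbit p) ->
  count (pi1 @` X) = count X.
Proof.
move=> fX oX; rewrite /Defs.count fset_set_image // card_in_imfset // => p p'.
rewrite !in_fset_set // => /set_mem /oX op /set_mem /oX op'; exact: (pi1_inj HF0 op op').
Qed.

Lemma is_frequency_class y0 p0 f : lift y0 p0 -> is_frequency cps P r y0 f ->
  has_frequency (same_class^~ p0) f.
Proof.
move=> l0 hf eps e0; have [M hM] := hf _ e0; exists M => rad Mrad.
have := hM rad Mrad.
have fin D : finite_set (selected D rad) := finite_selected dk s HW HF0 D rad.
have -> : [set y | cps y /\ vnorm y <= rad /\ patch_equiv P r y y0] = pi1 @` selected (same_class^~ p0) rad.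
  apply/seteqP; split => y /=.
    move=> [[p lp] [yr pe]]; have [op [sp ep]] := lp; exists p => //.
    by do 2!split => //; split; [exact/(patch_equiv_class lp l0)|rewrite ep].
  move=> [p [op [sp [cls pr]]] <-].
  have lp : lift (pi1 p) p by [].
  by split; [exists p|split => //; exact/(patch_equiv_class lp l0)].
have -> : [set y | cps y /\ vnorm y <= rad] = pi1 @` selected (fun=> True) rad.
  apply/seteqP; split => y /=.
    by move=> [[p [op [sp ep]]] yr]; exists p => //; do 3!split => //; rewrite ep.
  by move=> [p [op [sp [_ pr]]] <-]; split => //; exists p.
by rewrite !count_image // => p [].
Qed.

Lemma card_frequencies : card_atmost (xi cps P r) #|code_type|%:R.
Proof.
have [idx idx_inj] := index_map.
pose code f (t : code_type) := exists y0 p0, [/\ lift y0 p0, is_frequency cps P r y0 f & has_code idx p0 t].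
have t0 : code_type := ([ffun=> (ord0, [ffun=> (None, ord0)])], finset.set0).
apply: (@card_atmost_code R code_type t0 (xi cps P r) code).
  move=> f [y0 [[p0 l0] hf]]; have [t ht] := code_exists idx l0.1.
  by exists t, y0, p0.
move=> f f' t _ _ [y0 [p0 [l0 hf ht]]] [y0' [p0' [l0' hf' ht']]].
have fc := is_frequency_class l0 hf; have fc' := is_frequency_class l0' hf'.
apply/eqP; rewrite eq_le; apply/andP; split.
  exact: (code_frequency idx_inj l0.1 l0.2.1 l0'.1 l0'.2.1 ht ht' fc fc').
exact: (code_frequency idx_inj l0'.1 l0'.2.1 l0.1 l0.2.1 ht' ht fc' fc).
Qed.

Lemma card_code_type : #|code_type| =
  ((K.+1 * ((K.+2) * 3) ^ d) ^ n * 2 ^ 2 ^ (n * d * 2))%N.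
Proof.
rewrite card_prod; congr (_ * _)%N.
  by rewrite card_ffun card_prod card_ffun card_prod card_option !card_ord.
have := card_powerset [set: {ffun 'I_n * 'I_d * bool -> bool}]%SET.
by rewrite powersetT cardsT cardsT card_ffun !card_prod !card_ord card_bool.
Qed.

End Level.

(** * The number of frequencies *)

Section Growth.
Context {R : realType}.

Lemma ln2_ge : 2^-1 <= ln 2 :> R.
Proof.
have h : -1 < - 2^-1 :> R by lra.
have := le_ln1Dx h; have -> : 1 + - 2^-1 = 2^-1 :> R by field.
by rewrite lnV ?posrE //; lra.
Qed.

(** The power 4 is twice the power of the logarithm in [psi]; the surplus square absorbs the
    constants. *)
Lemma expR_ge_pow4 (y : R) : 0 <= y -> (y / 4) ^+ 4 <= expR y.
Proof.
move=> y0; have -> : expR y = expR (y / 4) ^+ 4.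
  by rewrite -expRM_natl -mulr_natl; congr expR; field.
rewrite lerXn2r ?nnegrE ?divr_ge0 ?expR_ge0 //.
by apply: le_trans (expR_ge1Dx _); rewrite lerDr.
Qed.

Lemma psi_log_bound (C eps c : R) : 0 < C -> 0 < eps -> 0 < c ->
  exists H : nat, forall h, (H <= h)%N -> forall r, c * 2 ^+ h <= r ->
    1 <= ln r /\ C * psi h <= ln r `^ (1 + eps).
Proof.
move=> C0 eps0 c0.
(* For [L >= T] the first term gives [L - ln 4 >= L / 2], the second [L >= 1], and the third lets
   [(eps * L / 8) ^+ 4] exceed the required multiple of [L ^+ 2]. *)
pose T := 4 * ln 4 + 2 + (16 * C * (8 ^+ 4 / eps ^+ 4)).
have ln4 : 0 <= ln 4 :> R by rewrite ln_ge0 // ler1n.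
have [H H0 hH] := nat_above (expR T + 4 + 4 * `|ln c|).
exists H => h Hh r hr.
have hR : expR T + 4 + 4 * `|ln c| <= h%:R by apply: le_trans hH _; rewrite ler_nat.
have eT := expR_gt0 T; have lc := normr_ge0 (ln c).
have x0 : 0 < h.+1%:R :> R by [].
have xT : expR T <= h.+1%:R by rewrite -[h.+1%:R]natr1; lra.
set L := ln h.+1%:R : R.
have LT : T <= L by rewrite -ler_expR lnK ?posrE.
have r0 : 0 < r by apply: lt_le_trans hr; rewrite mulr_gt0 // exprn_gt0.
have lnr : h.+1%:R / 4 <= ln r.
  apply: le_trans (_ : ln (c * 2 ^+ h) <= _); last first.
    by rewrite ler_ln ?posrE // mulr_gt0 // exprn_gt0.
  rewrite lnM ?posrE ?exprn_gt0 // lnXn // -[ln 2 *+ h]mulr_natl -[h.+1%:R]natr1.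
  have n1 := ler_norm (- ln c); rewrite normrN in n1.
  have : h%:R * 2^-1 <= h%:R * ln 2 :> R by rewrite ler_wpM2l // ln2_ge.
  by move: (h%:R * ln 2 : R) => a; lra.
have lnr1 : 1 <= ln r by apply: le_trans lnr; rewrite -[h.+1%:R]natr1; lra.
split => //.
have x4 : 0 < h.+1%:R / 4 :> R by rewrite divr_gt0.
apply: le_trans (_ : (h.+1%:R / 4) `^ (1 + eps) <= _); last first.
  by apply: ge0_ler_powR; rewrite ?nnegrE ?addr_ge0 ?(ltW eps0) ?(ltW x4) // (le_trans ler01).
rewrite powRD; last by rewrite gt_eqF ?implybT // ltr_wpDl.
rewrite powRr1 ?(ltW x4) // /psi mulrCA -mulrA ler_pM2l //.
rewrite [leRHS]mulrC ler_pdivlMr // -/L [leLHS]mulrAC /powR gt_eqF //.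
have -> : ln (h.+1%:R / 4) = L - ln 4 by rewrite ln_div ?posrE.
have D0 : 0 <= 16 * C * (8 ^+ 4 / eps ^+ 4).
  by apply/ltW; rewrite !mulr_gt0 ?invr_gt0 ?exprn_gt0.
have L1 : 1 <= L by apply: le_trans LT; rewrite /T; move: (16 * C * _) D0 => a; lra.
have L0 : 0 < L by apply: lt_le_trans L1.
have hy : eps * (L / 2) <= eps * (L - ln 4).
  rewrite ler_pM2l //.
  by move: LT; rewrite /T; move: (16 * C * _) D0 => a; lra.
apply: le_trans (_ : expR (eps * (L / 2)) <= _); last by rewrite ler_expR.
apply: le_trans (expR_ge_pow4 _); last by rewrite mulr_ge0 ?divr_ge0 // ltW.
have -> : (eps * (L / 2) / 4) ^+ 4 = eps ^+ 4 / 8 ^+ 4 * L ^+ 2 * L ^+ 2.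
  by field.
rewrite ler_pM2r ?exprn_gt0 //.
have LC : 16 * C * (8 ^+ 4 / eps ^+ 4) <= L ^+ 2.
  apply: le_trans (_ : L <= _); last by rewrite expr2 ler_peMr // ltW.
  by apply: le_trans LT; rewrite /T lerDr addr_ge0 // mulr_ge0.
have e4 : 0 < eps ^+ 4 by rewrite exprn_gt0.
apply: le_trans (_ : eps ^+ 4 / 8 ^+ 4 * (16 * C * (8 ^+ 4 / eps ^+ 4)) <= _); last first.
  by rewrite ler_pM2l // divr_gt0 // exprn_gt0.
have -> : eps ^+ 4 / 8 ^+ 4 * (16 * C * (8 ^+ 4 / eps ^+ 4)) = 16 * C.
  by field; rewrite gt_eqF.
lra.
Qed.

Lemma dyadic_scale (H : nat) (y : R) : 2 ^+ H <= y -> exists2 h, (H <= h)%N & 2 ^+ h <= y <= 2 ^+ h.+1.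
Proof.
move=> hy.
have ex : exists m, y < 2 ^+ m.
  have [N N0 hN] := nat_above y; exists N; apply: le_lt_trans hN _.
  by rewrite -natrX ltr_nat ltn_expl.
have [m ym hm] := ex_minnP ex; have Hm : (H < m)%N.
  rewrite ltnNge; apply/negP => mH.
  have := lt_le_trans ym (_ : 2 ^+ m <= 2 ^+ H); rewrite ler_weXn2l ?ler1n // => /(_ isT).
  by rewrite ltNge hy.
case: m ym hm Hm => // h ym hm Hm; exists h => //.
rewrite (ltW ym) andbT leNgt; apply/negP => yh.
by have := hm h yh; rewrite ltnn.
Qed.

End Growth.

Section Assembly.
Context {R : realType} {d k : nat}.
Hypotheses (d0 : (0 < d)%N) (dk : (d < k)%N).
Local Notation n := (k - d)%N.
Local Notation V := 'rV[R]_(d + n).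
Variables (A : 'M[R]_(d, n)) (Wz : 'M[int]_n) (F0 : 'M[R]_(d + n)) (s : V).
Local Notation Wm := (imx Wz : 'M[R]_n).
Hypothesis HW : int_generators Wm.
Hypothesis HF0 : admissible_F0 A F0.
Hypothesis Hreg : regular A (parallelotope Wm) s.
Hypothesis Hgen : generic A.

Lemma det_neq0 : \det Wz != 0.
Proof.
have := Wm_unit HW; rewrite unitmxE unitfE det_map_mx intr_eq0.
by [].
Qed.

(** Cramer's rule: up to the integer [\det Wz], the dual basis of the edges consists of integral
    directions, to which genericity applies. *)
Lemma scaled_dual j : (\det Wz)%:~R *: col j (invmx Wm) = imx (col j (\adj Wz)) :> 'cV[R]_n.
Proof.
rewrite /invmx Wm_unit // det_map_mx -map_mx_adj.
apply/colP => i; rewrite !mxE mulrA mulfV ?mul1r //.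
by rewrite intr_eq0 det_neq0.
Qed.

Lemma row_dual j : (row j Wm *m col j (invmx Wm)) 0 0 = 1.
Proof.
have e : (Wm *m invmx Wm) j j = 1 by rewrite mulmxV ?Wm_unit // mxE eqxx.
rewrite -[RHS]e [LHS]mxE [RHS]mxE; apply: eq_bigr => l _.
by congr (_ * _); rewrite [LHS]mxE.
Qed.

Lemma adj_col_neq0 j : col j (\adj Wz) != 0.
Proof.
apply/eqP => h; have := scaled_dual j; rewrite h map_mx0 => /eqP.
rewrite scaler_eq0 intr_eq0 (negbTE det_neq0) /= => /eqP w0.
by have := row_dual j; rewrite w0 mulmx0 mxE => /eqP; rewrite eq_sym oner_eq0.
Qed.

Lemma dual_int j (m : int) : exists z2 : 'rV[int]_n, (imx z2 *m col j (invmx Wm)) 0 0 = m%:~R.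
Proof.
exists (m *: row j Wz); rewrite map_mxZ map_row /= -scalemxAl.
by rewrite mxE row_dual mulr1.
Qed.

Lemma uniform_scale (c1 C1 : R) (kappa : nat) : 0 < c1 -> c1 <= C1 ->
  exists (C : R) (H : nat), 0 < C /\ forall h, (H <= h)%N -> forall r,
  `|\det Wz|%:~R * 2 ^+ h <= c1 * r -> c1 * r <= `|\det Wz|%:~R * 2 ^+ h.+1 ->
  exists G : 'I_n -> R, forall j, let value := value A (col j (invmx Wm)) in [/\ 0 < G j,
   forall y, exists (z1 : 'rV[int]_d) (z2 : 'rV[int]_n),
     (forall i, `|z1 0 i|%:~R <= c1 * r) /\ `|value z1 z2 - y| <= G j,
   forall l : seq R, uniq l -> (forall x, x \in l -> small_values A (col j (invmx Wm)) (2 * C1 * r) (G j) x) ->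
     (size l)%:R <= C * psi h
   & forall (z1 : 'rV[int]_d) (z2 : 'rV[int]_n), (forall i, `|z1 0 i|%:~R <= 4 * C1 * r) ->
     z1 = 0 \/ (exists i, `|z1 0 i| <= (4 * kappa)%N%:Z) -> `|value z1 z2| <= 4 * G j ->
     value z1 z2 = 0].
Proof.
move=> c10 c1C1.
have /choice[Cf /choice[Hf h]] j := @direction_scale R d n A (col j (\adj Wz)) (\det Wz) (col j (invmx Wm))
  d0 det_neq0 (scaled_dual j) (dual_int j) (Hgen.2 _ (adj_col_neq0 j)).1 (Hgen.2 _ (adj_col_neq0 j)).2 c1 C1 kappa c10 c1C1.
pose C := 1 + \sum_j `|Cf j|.
have CC j : Cf j <= C.
  apply: le_trans (ler_norm _) _; rewrite /C (bigD1 j) //= addrCA lerDl.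
  by rewrite addr_ge0 // sumr_ge0.
exists C, (\max_j Hf j).+1; split; first by rewrite /C ltr_wpDr // sumr_ge0.
move=> h0 Hh r r1 r2.
have hj j : (Hf j <= h0)%N.
  by apply: leq_trans (ltnW Hh); apply: (@leq_bigmax _ Hf j).
have /choice[G hG] j := h j h0 (hj j) r r1 r2.
exists G => j; have [g1 g2 g3 g4] := hG j; split => // l ul lX.
apply: le_trans (g3 l ul lX) _; rewrite ler_wpM2r //.
by apply/ltW/psi_gt0; apply: leq_trans Hh.
Qed.

Lemma psi_ge1 (h : nat) : (3 <= h)%N -> 1 <= psi h :> R.
Proof.
move=> h3; have h1 : 1 <= h.+1%:R :> R by rewrite ler1n.
have l1 : 1 <= ln h.+1%:R :> R.
  apply: le_trans (_ : ln (2 * 2) <= _).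
    by rewrite lnM ?posrE //; have := @ln2_ge R; lra.
  by rewrite ler_ln ?posrE ?mulr_gt0 // -natrM ler_nat.
by rewrite /psi -[leLHS]mulr1 ler_pM // exprn_ege1.
Qed.

(** The constant [2 ^ 2 ^ (n * d * 2)] is moved inside the power, so that [psi_log_bound] absorbs
    all constants before the power is taken. *)
Lemma code_count_bound (C : R) (h K : nat) : 0 < C -> (3 <= h)%N -> K%:R <= C * psi h ->
  (((K.+1 * (K.+2 * 3) ^ d) ^ n * 2 ^ 2 ^ (n * d * 2))%N)%:R <=
  (((C + 2) * 3 * (2 ^ 2 ^ (n * d * 2))%N%:R) * psi h) ^+ (d.+1 * n).
Proof.
move=> C0 h3 hK; have p1 := psi_ge1 h3.
have psi0 : 0 <= psi h :> R by apply: le_trans p1.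
have C20 : 0 <= C + 2 by rewrite addr_ge0 // ltW.
set D := (2 ^ _)%N.
have D1 : (1 <= D)%N by rewrite expn_gt0.
have N1 : (0 < d.+1 * n)%N by rewrite muln_gt0 subn_gt0.
apply: le_trans (_ : ((K.+2 * 3 * D) ^ (d.+1 * n))%N%:R <= _).
  rewrite ler_nat [X in (_ <= X)%N]expnMn; apply: leq_mul.
    rewrite expnM leq_exp2r ?subn_gt0 // expnS leq_mul2r.
    by apply/orP; right; rewrite (leq_trans (leqnSn _)) // leq_pmulr.
  by rewrite -[X in (X <= _)%N]expn1 leq_pexp2l.
have RHS0 : 0 <= (C + 2) * 3 * D%:R * psi h.
  by apply: mulr_ge0 => //; apply: mulr_ge0 => //; apply: mulr_ge0.
rewrite natrX; apply: lerXn2r; rewrite ?nnegrE //.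
have hK2 : K.+2%:R <= (C + 2) * psi h.
  by rewrite -addn2 natrD mulrDl; apply: lerD => //; rewrite -[leLHS]mulr1 ler_pM.
have -> : (C + 2) * 3 * D%:R * psi h = (C + 2) * psi h * (3 * D%:R) by move: (psi h) (D%:R) => ? ?; ring.
by rewrite !natrM -mulrA; apply: ler_wpM2r => //; apply: mulr_ge0.
Qed.

Lemma frequencies_bound (P : V -> R -> set V) (S0 S1 : R -> 'rV[int]_d -> Prop) (Test : R -> V -> Prop)
    (c1 C1 r1 : R) (rho : R -> R) (kappa : nat) : 0 < c1 -> c1 <= C1 ->
  (forall r, r1 <= r -> [/\ (forall z1, S0 r z1 -> S1 r z1),
     (forall (z1 : 'rV[int]_d) (i : 'I_d), S1 r z1 -> `|z1 0 i|%:~R <= C1 * r),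
     (forall z1 : 'rV[int]_d, S1 r z1 -> ~ S0 r z1 ->
        exists (i : 'I_d) (sg : bool), `|(z1 0 i)%:~R - (-1) ^+ sg * rho r| <= kappa%:R)
     & (forall z1 : 'rV[int]_d, (forall i, `|z1 0 i|%:~R <= c1 * r) -> S0 r z1)]) ->
  (forall r, r1 <= r -> [/\ (forall z1 z2, S0 r z1 -> (forall j, `|window_coord A Wm (lat z1 z2) 0 j| < 1) -> Test r (lat z1 z2)),
     (forall z1 z2, Test r (lat z1 z2) -> (forall j, `|window_coord A Wm (lat z1 z2) 0 j| < 1) -> S1 r z1)
     & (forall y p, Defs.lift A F0 (parallelotope Wm) s y p -> forall y', P y r y' <->
          exists p', Defs.lift A F0 (parallelotope Wm) s y' p' /\ Test r (p' - p))]) ->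
  forall eps : R, 0 < eps -> exists r0 : R, forall r : R, r0 <= r ->
    card_atmost (xi (cps A F0 (parallelotope Wm) s) P r) (powR (ln r) ((1 + eps) * (d.+1)%:R * n%:R)).
Proof.
move=> c10 c1C1 hS hT eps eps0.
have q0 : 0 < `|\det Wz|%:~R :> R by rewrite ltr0z normr_gt0 det_neq0.
have [C [H [C0 hH]]] := uniform_scale kappa c10 c1C1.
pose D : R := (C + 2) * 3 * (2 ^ 2 ^ (n * d * 2))%N%:R.
have D0 : 0 < D by rewrite !mulr_gt0 ?addr_gt0 // ltr0n expn_gt0.
have c0 : 0 < `|\det Wz|%:~R / c1 by rewrite divr_gt0.
have [H2 hH2] := psi_log_bound D0 eps0 c0.
pose H' := maxn H (maxn H2 3).
exists (Num.max r1 (Num.max 1 (`|\det Wz|%:~R / c1 * 2 ^+ H'))) => r.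
rewrite !ge_max => /and3P[r1r r1' rH].
have r0 : 0 < r by apply: lt_le_trans r1'.
(* The scale is normalized by the determinant because [cover_values] multiplies its vectors by
   it. *)
have : 2 ^+ H' <= c1 * r / `|\det Wz|%:~R.
  by rewrite ler_pdivlMr // [leLHS]mulrC [leRHS]mulrC -ler_pdivrMr // mulrAC.
move=> /dyadic_scale[h Hh /andP[h1 h2]].
rewrite ler_pdivlMr // mulrC in h1; rewrite ler_pdivrMr // [leRHS]mulrC in h2.
have hHh : (H <= h)%N by apply: leq_trans Hh; rewrite leq_maxl.
have hH2h : (H2 <= h)%N by apply: leq_trans Hh; rewrite !leq_max leqnn !orbT.
have h3 : (3 <= h)%N by apply: leq_trans Hh; rewrite !leq_max leqnn !orbT.
have [G hG] := hH h hHh r h1 h2.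
have [lr1 lrp] : 1 <= ln r /\ D * psi h <= ln r `^ (1 + eps).
  by apply: (hH2 h hH2h r); rewrite mulrAC ler_pdivrMr // [r * _]mulrC.
have [s1 s2 s3 s4] := hS r r1r; have [t1 t2 t3] := hT r r1r.
pose K := Num.truncn (C * psi h).
have Cp0 : 0 <= C * psi h by rewrite mulr_ge0 ?(ltW C0) // (le_trans _ (psi_ge1 h3)).
have main : card_atmost (xi (cps A F0 (parallelotope Wm) s) P r) #|@code_type d k K|%:R.
  apply: (@card_frequencies R d k d0 dk A Wz F0 s HW HF0 Hreg Hgen.1 (S0 r) (S1 r) (Test r) (C1 * r) (rho r) kappa K G) => //.
  - by move=> j; case: (hG j).
  - by apply: s4 => i; rewrite mxE normr0 mulr_ge0 // ltW.
  - move=> j y; have [_ g2 _ _] := hG j; have [z1 [z2 [a b]]] := g2 y.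
    by exists z1, z2; split => //; exact: s4.
  - move=> j l ul lX; have [_ _ g3 _] := hG j.
    by rewrite truncn_ge_nat //; apply: g3 => // x /lX; rewrite mulrA.
  by move=> j z1 z2 hz; have [_ _ _ g4] := hG j; apply: g4 => i; rewrite -mulrA.
move=> l ul lX; apply: le_trans (main l ul lX) _.
rewrite card_code_type.
apply: le_trans (@code_count_bound C h K C0 h3 _) _; first by have := truncn_le (C * psi h); rewrite Cp0.
have -> : (1 + eps) * d.+1%:R * n%:R = (1 + eps) * (d.+1 * n)%:R by rewrite natrM mulrA.
rewrite powRrM powR_mulrn ?powR_ge0 // lerXn2r ?nnegrE ?powR_ge0 //.
by rewrite mulr_ge0 ?(ltW D0) // (le_trans _ (psi_ge1 h3)).
Qed.

End Assembly.

(** * The two types of patches *)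

Section Patches.
Context {R : realType} {d k : nat}.
Hypotheses (d0 : (0 < d)%N) (dk : (d < k)%N).
Local Notation n := (k - d)%N.
Local Notation V := 'rV[R]_(d + n).
Variable A : 'M[R]_(d, n).
Hypothesis Hgen : generic A.

Lemma scaledE (Om : set V) (r : R) v : 0 < r -> scaled r Om v <-> Om (r^-1 *: v).
Proof.
move=> r0; have rn0 : r != 0 by rewrite gt_eqF.
split => [[w [ow ->]]|ov]; first by rewrite scalerA mulVf // scale1r.
by exists (r^-1 *: v); rewrite scalerA mulfV // scale1r.
Qed.

Lemma scale_graph (r : R) (x : 'rV[R]_d) : r *: row_mx x (x *m A) = row_mx (r *: x) ((r *: x) *m A).
Proof. by rewrite scale_row_mx scalemxAl. Qed.

Lemma norm_perturb (x y b : R) : `|x - y| <= b -> `|x| <= `|y| + b.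
Proof. by move=> h; rewrite -{1}(subrK y x) addrC (le_trans (ler_normD _ _)) // lerD2l. Qed.

Lemma sign_dist (x y : R) : `|x - (-1) ^+ (x < 0)%R * y| = `| `|x| - y|.
Proof.
case: ltrP => s0; last by rewrite expr0 mul1r (ger0_norm s0).
by rewrite expr1 mulN1r (ltr0_norm s0) -[LHS]normrN opprD opprK.
Qed.

(** The first [d] coordinates are matched exactly by the point of [E]; orbit density in all fiber
    directions at once adjusts the others. *)
Lemma generic_totally_irrational : totally_irrational A.
Proof.
move=> p delta delta0; have d20 : 0 < delta / 2 by rewrite divr_gt0.
have [Z /(_ (lsubmx p *m A - rsubmx p))[z _ [v hv]]] := Hgen.1 _ d20.
rewrite map_mx1 mulmx1 in hv.
pose x := lsubmx p - imx z.
exists (row_mx x (x *m A)), (row_mx (imx z) (imx v)); split; first by exists x.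
split; first by apply/intvec_imx; exists (row_mx z v); rewrite map_row_mx.
have -> : row_mx x (x *m A) + row_mx (imx z) (imx v) - p =
    row_mx 0 (- (imx z *m A - imx v - (lsubmx p *m A - rsubmx p))).
  rewrite -{1}(hsubmxK p) opp_row_mx !add_row_mx /x subrK subrr mulmxBl.
  congr row_mx; move: (lsubmx p *m A) (imx z *m A) (rsubmx p) (imx v) => a b e f.
  by apply/rowP => j; rewrite !mxE; ring.
apply: le_lt_trans (_ : delta / 2 < _); last by rewrite ltr_pdivrMr // ltr_pMr ?ltr1n.
apply: vnorm_le => [|i]; first exact: ltW.
rewrite -(splitK i); case: (split i) => j /=; first by rewrite row_mxEl mxE normr0 ltW.
by rewrite row_mxEr [X in `|X|]mxE normrN.
Qed.

Section IntegerWindow.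
Variables (Wz : 'M[int]_n) (F0 : 'M[R]_(d + n)) (s : V).
Local Notation Wm := (imx Wz : 'M[R]_n).
Local Notation W := (parallelotope Wm).
Hypothesis HW : int_generators Wm.
Hypothesis HF0 : admissible_F0 A F0.
Hypothesis Hreg : regular A W s.

Lemma lift_inj y p p' : Defs.lift A F0 W s y p -> Defs.lift A F0 W s y p' -> p = p'.
Proof. by move=> [o [_ e]] [o' [_ e']]; apply: (pi1_inj HF0 o o'); rewrite e e'. Qed.

Lemma patch2P (Om : set V) (r : R) y p : Defs.lift A F0 W s y p -> forall y',
  patch2 A F0 W s Om y r y' <-> exists p', Defs.lift A F0 W s y' p' /\ scaled r Om (pi2 A (p' - p)).
Proof.
move=> lp y'; split => [[_ [q [p' [lq [lp' h]]]]]|[p' [lp' h]]].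
  by exists p'; rewrite (lift_inj lp lq).
by split; [exists p'|exists p, p'].
Qed.

Lemma patch1P (Om : set V) (r : R) y p : Defs.lift A F0 W s y p -> forall y',
  patch1 A F0 W s Om y r y' <-> exists p', Defs.lift A F0 W s y' p' /\ scaled r Om (pi1 A F0 (p' - p)).
Proof.
move=> [_ [_ <-]] y'; split => [[[p' lp'] h]|[p' [lp' h]]].
  by exists p'; split => //; rewrite pi1B; case: lp' => _ [_ ->].
by split; [exists p'|case: lp' => _ [_ <-]; rewrite -pi1B].
Qed.

(** [pi2] of a lattice vector depends on its horizontal part alone, so participation is certain:
    [S0] and [S1] coincide and the face condition is vacuous. *)
Lemma frequencies2_bound (Om : set V) : admissible_Omega A Om ->
  forall eps : R, 0 < eps -> exists r0 : R, forall r : R, r0 <= r ->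
    card_atmost (xi (cps A F0 W s) (patch2 A F0 W s Om) r) (powR (ln r) ((1 + eps) * (d.+1)%:R * n%:R)).
Proof.
move=> [_ [[CO hCO] [_ [delta [delta0 hdelta]]]]].
have [CA CA0 hCA] := vnorm_mulmx (row_mx (1%:M : 'M[R]_d) A).
have CA1 : 0 < 1 + CA by rewrite ltr_pwDl.
pose c1 := delta / 2 / (1 + CA).
have c10 : 0 < c1 by rewrite !divr_gt0.
pose S (r : R) (z1 : 'rV[int]_d) := scaled r Om (row_mx (imx z1) (imx z1 *m A)).
have SE r z1 z2 : scaled r Om (pi2 A (lat z1 z2)) <-> S r z1.
  by rewrite pi2E /lat row_mxKl.
apply: (@frequencies_bound R d k d0 dk A Wz F0 s HW HF0 Hreg Hgen (patch2 A F0 W s Om) S S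
  (fun r z => scaled r Om (pi2 A z)) c1 (Num.max c1 CO) 1 (fun=> 0) 0) => //.
- by rewrite le_max lexx.
- move=> r r1; have r0 : 0 < r by apply: lt_le_trans r1.
  split => // [z1 i|z1 hz].
    move=> [w [ow e]].
    rewrite intr_norm.
    have <- : (row_mx (imx z1) (imx z1 *m A)) 0 (lshift n i) = (z1 0 i)%:~R :> R by rewrite row_mxEl mxE.
    rewrite e [X in `|X|]mxE normrM gtr0_norm // mulrC ler_wpM2r ?(ltW r0) //.
    by rewrite le_max (le_trans (coord_le_vnorm w _) (hCO w ow)) orbT.
  apply/scaledE => //; rewrite scale_graph; apply: hdelta; first by eexists.
  rewrite -[X in row_mx X]mulmx1 -mul_mx_row; apply: le_lt_trans (hCA _) _.
  have vc1 : vnorm (r^-1 *: imx z1) <= c1.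
    apply: vnorm_le => [|i]; first exact: ltW.
    by rewrite !mxE normrM gtr0_norm ?invr_gt0 // mulrC ler_pdivrMr // -intr_norm.
  apply: (@le_lt_trans _ _ ((1 + CA) * c1)).
    by apply: ler_pM => //; [exact: vnorm_ge0|rewrite lerDr].
  by rewrite mulrC divfK ?gt_eqF // ltr_pdivrMr // ltr_pMr ?ltr1n.
- move=> r r1; split => [z1 z2 /SE //|z1 z2 /SE //|].
  exact: patch2P.
Qed.

(* Since [pi1] and [pi2] differ by a bounded amount on the strip, whether [pi1] of a lattice vector
   lies in the cube is decided by its first [d] entries, up to a bounded layer around the faces. *)
Lemma frequencies1_bound (c : R) : 0 < c ->
  let Om := [set p | exists x : 'rV[R]_d, (forall i, `|x 0 i| <= c) /\ p = row_mx x (x *m A)] in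
  forall eps : R, 0 < eps -> exists r0 : R, forall r : R, r0 <= r ->
    card_atmost (xi (cps A F0 W s) (patch1 A F0 W s Om) r) (powR (ln r) ((1 + eps) * (d.+1)%:R * n%:R)).
Proof.
move=> c0 Om.
have OmE (r : R) v : 0 < r -> scaled r Om (pi1 A F0 v) <-> forall i, `|lsubmx (pi1 A F0 v) 0 i| <= c * r.
  move=> r0; rewrite scaledE //; move: (pi1_graph A F0 v); move: (lsubmx _) => u ->.
  rewrite scale_graph /Om /=; split => [[x [hx /eq_row_mx[e _]]] i|h].
    have -> : u = r *: x by rewrite -e scalerA mulfV ?gt_eqF // scale1r.
    by rewrite mxE normrM gtr0_norm // mulrC ler_wpM2r // ltW.
  exists (r^-1 *: u); split => // i.
  by rewrite mxE normrM gtr0_norm ?invr_gt0 // mulrC ler_pdivrMr.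
have [Cb Cb0 hCb] := lsub_pi1_bound HW HF0.
have [kappa _ hkappa] := nat_above Cb.
have near z1 z2 i : (forall j, `|window_coord A Wm (lat z1 z2) 0 j| < 1) ->
    `|lsubmx (pi1 A F0 (lat z1 z2)) 0 i - (z1 0 i)%:~R| <= Cb.
  move=> h; have := hCb (lat z1 z2) i; rewrite {2}/lat row_mxKl [imx z1 0 i]mxE => hle.
  apply: le_trans hle _; rewrite -[leRHS]mulr1 ler_wpM2l //.
  by apply: vnorm_le => // j; apply: ltW.
(* [Cb] bounds the discrepancy between [pi1] and the first entries. For [r >= 2 * Cb / c] the bounds
   [c * r - Cb] and [c * r + Cb] lie between [c / 2 * r] and [2 * c * r]. *)
apply: (@frequencies_bound R d k d0 dk A Wz F0 s HW HF0 Hreg Hgen (patch1 A F0 W s Om)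
  (fun r z1 => forall i, `|z1 0 i|%:~R <= c * r - Cb) (fun r z1 => forall i, `|z1 0 i|%:~R <= c * r + Cb)
  (fun r z => scaled r Om (pi1 A F0 z)) (c / 2) (2 * c) (Num.max 1 (2 * Cb / c)) (fun r => c * r) kappa).
- by rewrite divr_gt0.
- by lra.
- move=> r; rewrite ge_max => /andP[r1]; rewrite ler_pdivrMr // => r2.
  split => [z1 h i|z1 i h|z1 h1 h0|z1 h i].
  + by apply: le_trans (h i) _; lra.
  + by apply: le_trans (h i) _; lra.
  + have [i hi] : exists i, ~ `|z1 0 i|%:~R <= c * r - Cb :> R by apply/existsNP.
    move/negP: hi; rewrite -ltNge => hi; have := h1 i => hi1.
    rewrite intr_norm in hi hi1.
    exists i, ((z1 0 i)%:~R < 0 :> R).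
    rewrite sign_dist.
    by rewrite ler_norml; apply/andP; split; lra.
  + by apply: le_trans (h i) _; lra.
- move=> r; rewrite ge_max => /andP[r1 _]; have r0 : 0 < r by apply: lt_le_trans r1.
  split => [z1 z2 h1 h2|z1 z2 /OmE h1 h2 i|y p hp y'].
  + apply/OmE => // i; have := near z1 z2 i h2; have := h1 i; rewrite intr_norm => a b.
    by have := norm_perturb b; lra.
  + have := near z1 z2 i h2; have := h1 r0 i; rewrite intr_norm distrC => a b.
    by have := norm_perturb b; lra.
  + exact: patch1P.
Qed.

End IntegerWindow.
End Patches.

Theorem theorem1p2 (R : realType) (d k : nat) (hd : (1 <= d)%N) (hdk : (d < k)%N) :
  exists LL : set 'M[R]_(d, k - d),
    full_measure LL /\
    forall A : 'M[R]_(d, k - d), LL A ->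
      totally_irrational A /\
      (forall (Wm : 'M[R]_(k - d)) (F0 : 'M[R]_(d + (k - d))) (Om : set 'rV[R]_(d + (k - d)))
              (s : 'rV[R]_(d + (k - d))),
         int_generators Wm -> admissible_F0 A F0 -> admissible_Omega A Om ->
         regular A (parallelotope Wm) s ->
         forall eps : R, 0 < eps -> exists r0 : R, forall r : R, r0 <= r ->
           card_atmost (xi (cps A F0 (parallelotope Wm) s) (patch2 A F0 (parallelotope Wm) s Om) r)
             (powR (ln r) ((1 + eps) * (d.+1)%:R * (k - d)%:R))) /\
      (forall (Wm : 'M[R]_(k - d)) (F0 : 'M[R]_(d + (k - d))) (c : R)
              (s : 'rV[R]_(d + (k - d))),
         int_generators Wm -> admissible_F0 A F0 -> 0 < c ->
         regular A (parallelotope Wm) s ->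
         let Om := [set p | exists x : 'rV[R]_d, (forall i, `|x 0 i| <= c) /\
                                                  p = row_mx x (x *m A)] in
         forall eps : R, 0 < eps -> exists r0 : R, forall r : R, r0 <= r ->
           card_atmost (xi (cps A F0 (parallelotope Wm) s) (patch1 A F0 (parallelotope Wm) s Om) r)
             (powR (ln r) ((1 + eps) * (d.+1)%:R * (k - d)%:R))).
Proof.
(* An integer matrix is extracted so that determinant and adjugate are integral. *)
have windowP (Wm : 'M[R]_(k - d)) : int_generators Wm -> exists Wz : 'M[int]_(k - d), Wm = imx Wz.
  move=> [/= h _]; have /choice[f hf] i : exists g : 'I_(k - d) -> int, forall j, Wm i j = (g j)%:~R.
    by have /choice[g hg] := h i; exists g.
  by exists (\matrix_(i, j) f i j); apply/matrixP => i j; rewrite !mxE hf.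
exists [set A | generic A]; split; first by apply: full_measure_generic; rewrite // subn_gt0.
move=> A gA; split; first exact: generic_totally_irrational.
split => [Wm F0 Om s hW hF hO hs eps eps0|Wm F0 c s hW hF c0 hs Om eps eps0].
  have [Wz eW] := windowP Wm hW; rewrite {}eW in hW hs *.
  exact: frequencies2_bound.
have [Wz eW] := windowP Wm hW; rewrite {}eW in hW hs *.
exact: frequencies1_bound.
Qed.
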